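(* $\mathrm{MC}(\mathtt{FKS},\mathtt{CCTL^*})$ is reducible to the satisfiability problem of $\mathtt{PH}$ in polynomial time: there is a polynomial-time computable map sending each flat Kripke structure $\mathcal{K}$ and $\mathtt{CCTL^*}$ formula $\Phi$ to a $\mathtt{PH}$ formula that is satisfiable if and only if $\mathcal{K}\models\Phi$.
   Context: $\mathtt{PH}$: formulae over variables $V$ given by $\varphi ::= \tau\le\tau\mid\neg\varphi\mid\varphi\land\varphi\mid\exists x.\varphi\mid\exists^{=x}y.\varphi$, terms $\tau ::= a\mid a\cdot x\mid\tau+\tau$ with $a\in\mathbb{N}$, $x,y\in V$. Semantics over valuations $\eta:V\to\mathbb{N}$ as usual for first-order logic over $(\mathbb{N},+)$, with $\eta\models\exists^{=x}y.\varphi$ iff $\{b\in\mathbb{N}\mid\eta[y\mapsto b]\models\varphi\}$ is finite and of cardinality $\eta(x)$. Satisfiability: existence of a satisfying $\eta$. Kripke structure $\mathcal{K}=(S,s_I,E,\lambda)$: finite $S$, $s_I\in S$, $E\subseteq S\times S$, $\lambda:S\to2^{AP}$ ($AP$ finite). Runs: infinite paths $\rho$ with $\rho(0)=s_I$; $\mathtt{Runs}(\mathcal{K})$. Simple loop: finite path of pairwise distinct states $s_0\dots s_k$ with $(s_k,s_0)\in E$; $\mathcal{K}$ is flat if each state is the first state of at most one simple loop; $\mathtt{FKS}$ is the class of flat Kripke structures. $\mathtt{CCTL^*}$ over variables $V$: $\varphi ::= p\mid\varphi\land\varphi\mid\neg\varphi\mid\mathtt{X}\varphi\mid\varphi\mathtt{U}\varphi\mid\mathtt{E}\varphi\mid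 x.\varphi\mid\tau\le\tau$, $\tau ::= a\mid a\cdot\#_x(\varphi)\mid\tau+\tau$ ($p\in AP$, $x\in V$, $a\in\mathbb{Z}$, numbers in binary). Semantics over a run $\rho$, position $i$, valuation $\theta:V\to\mathbb{N}$: $p$ iff $p\in\lambda(\rho(i))$; Booleans usual; $\mathtt{X}\varphi$ iff $(\rho,i+1,\theta)\models\varphi$; $\varphi\mathtt{U}\psi$ iff some $k\ge i$ has $(\rho,k,\theta)\models\psi$ and $(\rho,j,\theta)\models\varphi$ for all $j\in[i,k-1]$; $\mathtt{E}\varphi$ iff some $\rho'\in\mathtt{Runs}(\mathcal{K})$ agrees with $\rho$ on positions $0..i$ and $(\rho',i,\theta)\models\varphi$; $x.\varphi$ iff $(\rho,i,\theta[x\mapsto i])\models\varphi$; $\tau_1\le\tau_2$ iff $[\![\tau_1]\!]\le[\![\tau_2]\!]$, where $[\![a]\!]=a$, $[\![\tau_1+\tau_2]\!]$ is the sum, $[\![a\cdot\#_x(\varphi)]\!]=a\cdot|\{j\mid\theta(x)\le j\le i,(\rho,j,\theta)\models\varphi\}|$. A state $s$ satisfies $\varphi$ if some $\rho\in\mathtt{Runs}(\mathcal{K})$ and $i$ have $\rho(i)=s$ and $(\rho,i,\mathbf{0})\models\varphi$; $\mathcal{K}\models\varphi$ iff $s_I$ satisfies $\varphi$. $\mathrm{MC}(\mathfrak{K},\mathcal{L})$: given $\mathcal{K}\in\mathfrak{K}$, $\varphi\in\mathcal{L}$, decide $\mathcal{K}\models\varphi$. *)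

(* Defs.v *)
From Stdlib Require Import ZArith ClassicalEpsilon.
From mathcomp Require Import all_boot.
Set Implicit Arguments. Unset Strict Implicit. Unset Printing Implicit Defensive.

(* Kripke structures: states are 0 .. ks_size-1, edges a list of pairs,
   ks_label gives for each state the (finite) list of atomic propositions
   (atomic propositions are natural numbers). *)
Record KS := mkKS {
  ks_size : nat;
  ks_init : nat;
  ks_edges : seq (nat * nat);
  ks_label : seq (seq nat) }.

Definition ks_wf (K : KS) : bool :=
  [&& ks_init K < ks_size K,
      all (fun e => (e.1 < ks_size K) && (e.2 < ks_size K)) (ks_edges K)
    & size (ks_label K) == ks_size K].

Definition ks_edge (K : KS) (s t : nat) : bool := (s, t) \in ks_edges K.
Definition ks_lab (K : KS) (s : nat) : seq nat := nth [::] (ks_label K) s.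

Definition is_run (K : KS) (rho : nat -> nat) : Prop :=
  rho 0 = ks_init K /\ forall i, ks_edge K (rho i) (rho i.+1).

Definition simple_loop (K : KS) (l : seq nat) : bool :=
  match l with
  | [::] => false
  | s0 :: l' => [&& uniq l, path (ks_edge K) s0 l' & ks_edge K (last s0 l') s0]
  end.

Definition flat (K : KS) : Prop :=
  forall l1 l2, simple_loop K l1 -> simple_loop K l2 ->
    head 0 l1 = head 0 l2 -> l1 = l2.

Inductive cform : Type :=
| CAP : nat -> cform
| CAnd : cform -> cform -> cform
| CNot : cform -> cform
| CX : cform -> cform
| CU : cform -> cform -> cform
| CE : cform -> cform
| CBind : nat -> cform -> cform
| CLe : cterm -> cterm -> cform
with cterm : Type :=
| CConst : Z -> cterm
| CCount : Z -> nat -> cform -> cterm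
| CPlus : cterm -> cterm -> cterm.

Definition upd (th : nat -> nat) (x v : nat) : nat -> nat :=
  fun y => if y == x then v else th y.

Definition agree (r r' : nat -> nat) (i : nat) : Prop :=
  forall j, j <= i -> r j = r' j.

Definition ind (P : Prop) : nat :=
  if excluded_middle_informative P then 1 else 0.

Fixpoint csat (K : KS) (f : cform) (rho : nat -> nat) (i : nat)
  (th : nat -> nat) {struct f} : Prop :=
  match f with
  | CAP p => p \in ks_lab K (rho i)
  | CAnd f1 f2 => csat K f1 rho i th /\ csat K f2 rho i th
  | CNot f1 => ~ csat K f1 rho i th
  | CX f1 => csat K f1 rho i.+1 th
  | CU f1 f2 => exists k, i <= k /\ csat K f2 rho k th /\
                  (forall j, i <= j -> j < k -> csat K f1 rho j th)
  | CE f1 => exists rho', is_run K rho' /\ agree rho rho' i /\ csat K f1 rho' i th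
  | CBind x f1 => csat K f1 rho i (upd th x i)
  | CLe t1 t2 => (cteval K t1 rho i th <= cteval K t2 rho i th)%Z
  end
with cteval (K : KS) (t : cterm) (rho : nat -> nat) (i : nat)
  (th : nat -> nat) {struct t} : Z :=
  match t with
  | CConst a => a
  | CCount a x f1 =>
      (a * Z.of_nat (\sum_(th x <= j < i.+1) ind (csat K f1 rho j th)))%Z
  | CPlus t1 t2 => (cteval K t1 rho i th + cteval K t2 rho i th)%Z
  end.

Definition models (K : KS) (Phi : cform) : Prop :=
  exists rho i, is_run K rho /\ rho i = ks_init K /\ csat K Phi rho i (fun _ => 0).

Inductive pterm : Type :=
| PConst : nat -> pterm
| PMul : nat -> nat -> pterm
| PPlus : pterm -> pterm -> pterm.

Inductive pform : Type :=
| PLe : pterm -> pterm -> pform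
| PNot : pform -> pform
| PAnd : pform -> pform -> pform
| PEx : nat -> pform -> pform
| PExCount : nat -> nat -> pform -> pform.

Fixpoint pteval (eta : nat -> nat) (t : pterm) : nat :=
  match t with
  | PConst a => a
  | PMul a x => a * eta x
  | PPlus t1 t2 => pteval eta t1 + pteval eta t2
  end.

Fixpoint psat (f : pform) (eta : nat -> nat) : Prop :=
  match f with
  | PLe t1 t2 => pteval eta t1 <= pteval eta t2
  | PNot g => ~ psat g eta
  | PAnd g h => psat g eta /\ psat h eta
  | PEx y g => exists b, psat g (upd eta y b)
  | PExCount x y g =>
      exists s : seq nat, [/\ uniq s, size s = eta x &
                              forall b, b \in s <-> psat g (upd eta y b)]
  end.

Definition ph_satisfiable (f : pform) : Prop := exists eta, psat f eta.

Inductive sym : Type := SLeaf | SNode | SEnd | S0 | S1.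

Inductive tree : Type :=
| Leaf : nat -> tree
| Node : nat -> seq tree -> tree.

Fixpoint pos_bits (p : positive) : seq sym :=
  match p with
  | xH => [:: S1]
  | xO q => S0 :: pos_bits q
  | xI q => S1 :: pos_bits q
  end.

Definition nat_bits (n : nat) : seq sym :=
  match N.of_nat n with N0 => [::] | Npos p => pos_bits p end.

Fixpoint ser (t : tree) : seq sym :=
  match t with
  | Leaf n => SLeaf :: nat_bits n ++ [:: SEnd]
  | Node k ks => SNode :: nat_bits k ++ SEnd :: flatten (map ser ks) ++ [:: SEnd]
  end.

Definition enc_Z (z : Z) : tree :=
  Node (if (z <? 0)%Z then 1 else 0) [:: Leaf (Z.abs_nat z)].

Definition enc_KS (K : KS) : tree :=
  Node 0 [:: Leaf (ks_size K); Leaf (ks_init K);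
             Node 0 (map (fun e => Node 0 [:: Leaf e.1; Leaf e.2]) (ks_edges K));
             Node 0 (map (fun l => Node 0 (map Leaf l)) (ks_label K))].

Fixpoint enc_cform (f : cform) : tree :=
  match f with
  | CAP p => Node 0 [:: Leaf p]
  | CAnd f1 f2 => Node 1 [:: enc_cform f1; enc_cform f2]
  | CNot f1 => Node 2 [:: enc_cform f1]
  | CX f1 => Node 3 [:: enc_cform f1]
  | CU f1 f2 => Node 4 [:: enc_cform f1; enc_cform f2]
  | CE f1 => Node 5 [:: enc_cform f1]
  | CBind x f1 => Node 6 [:: Leaf x; enc_cform f1]
  | CLe t1 t2 => Node 7 [:: enc_cterm t1; enc_cterm t2]
  end
with enc_cterm (t : cterm) : tree :=
  match t with
  | CConst a => Node 8 [:: enc_Z a]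
  | CCount a x f1 => Node 9 [:: enc_Z a; Leaf x; enc_cform f1]
  | CPlus t1 t2 => Node 10 [:: enc_cterm t1; enc_cterm t2]
  end.

Fixpoint enc_pterm (t : pterm) : tree :=
  match t with
  | PConst a => Node 0 [:: Leaf a]
  | PMul a x => Node 1 [:: Leaf a; Leaf x]
  | PPlus t1 t2 => Node 2 [:: enc_pterm t1; enc_pterm t2]
  end.

Fixpoint enc_pform (f : pform) : tree :=
  match f with
  | PLe t1 t2 => Node 0 [:: enc_pterm t1; enc_pterm t2]
  | PNot g => Node 1 [:: enc_pform g]
  | PAnd g h => Node 2 [:: enc_pform g; enc_pform h]
  | PEx y g => Node 3 [:: Leaf y; enc_pform g]
  | PExCount x y g => Node 4 [:: Leaf x; Leaf y; enc_pform g]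
  end.

Definition enc_instance (K : KS) (Phi : cform) : seq sym :=
  ser (Node 0 [:: enc_KS K; enc_cform Phi]).

(* Deterministic single-tape Turing machines over tape alphabet option sym
   (None = blank); states are 'I_tm_states. *)
Inductive move : Type := MLeft | MRight | MStay.

Record TM := mkTM {
  tm_states : nat;
  tm_start : 'I_tm_states;
  tm_halt : 'I_tm_states;
  tm_delta : 'I_tm_states -> option sym -> 'I_tm_states * option sym * move }.

Record config (M : TM) := mkConfig {
  cf_state : 'I_(tm_states M);
  cf_tape : Z -> option sym;
  cf_pos : Z }.

Definition tm_step (M : TM) (c : config M) : config M :=
  if cf_state c == tm_halt M then c else
  let: (q', w, m) := tm_delta (cf_state c) (cf_tape c (cf_pos c)) in
  mkConfig q' (fun z => if Z.eqb z (cf_pos c) then w else cf_tape c z)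
           (match m with MLeft => cf_pos c - 1 | MRight => cf_pos c + 1
                       | MStay => cf_pos c end)%Z.

Definition tm_init (M : TM) (x : seq sym) : config M :=
  mkConfig (tm_start M)
    (fun z => if (0 <=? z)%Z then nth None (map Some x) (Z.to_nat z) else None) 0%Z.

Definition tape_output (tape : Z -> option sym) (pos : Z) (y : seq sym) : Prop :=
  (forall j, j < size y -> tape (pos + Z.of_nat j)%Z = Some (nth S0 y j)) /\
  tape (pos + Z.of_nat (size y))%Z = None.

Definition tm_computes_within (M : TM) (x : seq sym) (T : nat) (y : seq sym) : Prop :=
  exists t, t <= T /\
    let c := iter t (@tm_step M) (tm_init M x) in
    cf_state c = tm_halt M /\ tape_output (cf_tape c) (cf_pos c) y.

(* Main.v *)
(* In a flat structure a state has at most one successor inside its strongly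
   connected component, so a run visits each state along one arithmetic
   progression, possibly cut at some time. A run is thus described by three numbers
   per state, and "state v at time i" is a Presburger formula once the
   bounded products (period times number of turns) are unfolded. Validity of a
   description is checked locally, along the edges; the path quantifier copies
   the current description, guesses a new one and compares the two up to the
   current time, and counting terms become counting quantifiers. All variable
   names are fixed up to the states and the variables of the instance, since an
   inner formula never needs what it rebinds.

   The translation then is a top-down transduction of the input tree in which
   the edge and label lists are re-read at each use. It is carried out by a
   machine with eight stacks, one of them an agenda of templates still to be
   expanded, and the stacks are kept side by side on a single tape. *)
Require Import Defs.
From HB Require Import structures.
From Stdlib Require Import ZArith NArith Nnat Lia.
From Stdlib Require Import Classical ClassicalEpsilon PropExtensionality FunctionalExtensionality.
From mathcomp Require Import all_boot zify.
Set Implicit Arguments. Unset Strict Implicit. Unset Printing Implicit Defensive.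

(** * Single-tape machines with an arbitrary finite set of states *)

(** [PH] cannot multiply two variables. A product is needed only for period times number of turns,
    and flatness bounds the period by the number of edges, so one unfolding per edge is enough. Each
    clause of the translation uses every immediate subformula once, and the edge and label lists a
    constant number of times; this keeps the output at most quadratic in the input. Counting every
    written symbol would force the cost analysis to follow the output in detail. Output steps are
    therefore free: an item causes at most a constant number of pushes, so running time and output
    length are both recovered from the number of the remaining steps. That number is of order
    [n ^ 2], and one stack operation sweeps a tape whose length is again of order [n ^ 2], whence
    the exponent 4. *)

Definition sym_code (s : sym) : 'I_5 :=
  match s with SLeaf => inord 0 | SNode => inord 1 | SEnd => inord 2
             | S0 => inord 3 | S1 => inord 4 end.
Definition sym_decode (i : 'I_5) : sym :=
  match val i with 0 => SLeaf | 1 => SNode | 2 => SEnd | 3 => S0 | _ => S1 end.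
Lemma sym_codeK : cancel sym_code sym_decode.
Proof. by case; rewrite /sym_code /sym_decode /= inordK. Qed.
HB.instance Definition _ := Equality.copy sym (can_type sym_codeK).
HB.instance Definition _ := Choice.copy sym (can_type sym_codeK).
HB.instance Definition _ := Countable.copy sym (can_type sym_codeK).
HB.instance Definition _ := Finite.copy sym (can_type sym_codeK).

Section FiniteControlMachine.
Variables (Q : finType) (d : Q -> option sym -> Q * option sym * move) (q0 h : Q).

Definition fin_TM : TM :=
  @mkTM #|Q| (enum_rank q0) (enum_rank h)
    (fun i o => let: (q, w, m) := d (enum_val i) o in (enum_rank q, w, m)).

(** [l] lists the cells left of the head, nearest first, and [r] the cells from the head on. The
    default [None] makes every cell beyond the lists blank, so trailing blanks may be added or
    dropped ([rep_pad]). *)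
Definition rep (c : config fin_TM) (q : Q) (l r : seq (option sym)) : Prop :=
  [/\ cf_state c = enum_rank q,
      forall n, cf_tape c (cf_pos c + Z.of_nat n)%Z = nth None r n
    & forall n, cf_tape c (cf_pos c - 1 - Z.of_nat n)%Z = nth None l n].

Definition moved (l r : seq (option sym)) (w : option sym) (m : move) :=
  match m with
  | MLeft => (behead l, head None l :: w :: behead r)
  | MRight => (w :: l, behead r)
  | MStay => (l, w :: behead r)
  end.

Lemma rep_step c q l r q' w m : rep c q l r -> q != h ->
  d q (head None r) = (q', w, m) ->
  rep (tm_step c) q' (moved l r w m).1 (moved l r w m).2.
Proof.
case: c => st tape pos [/= -> Hr Hl] nh Hd; rewrite /tm_step /=.
rewrite (inj_eq enum_rank_inj) (negbTE nh) enum_rankK.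
have -> : tape pos = head None r by rewrite -nth0 -Hr Z.add_0_r.
rewrite Hd.
have Hr' n : tape (pos + Z.of_nat n.+1)%Z = nth None (behead r) n.
  by rewrite Hr nth_behead.
have Hl' n : tape (pos - 1 - Z.of_nat n.+1)%Z = nth None (behead l) n.
  by rewrite Hl nth_behead.
have H0 : tape (pos - 1)%Z = head None l by rewrite -nth0 -Hl /= Z.sub_0_r.
case: m {Hd}; split=> //= n.
- case: n => [|[|n]] /=.
  + by case: Z.eqb_spec => [|_]; [lia | rewrite Z.add_0_r].
  + by case: Z.eqb_spec => [|] //; lia.
  + case: Z.eqb_spec => [|_]; first lia.
    by rewrite -Hr'; congr tape; lia.
- case: Z.eqb_spec => [|_]; first lia.
  by rewrite -Hl'; congr tape; lia.
- case: Z.eqb_spec => [|_]; first lia.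
  by rewrite -Hr'; congr tape; lia.
- case: n => [|n] /=; case: Z.eqb_spec => [|] //; try lia.
  by move=> _; rewrite -Hl; congr tape; lia.
- case: n => [|n] /=; case: Z.eqb_spec => [|] //; try lia.
  by move=> _; rewrite -Hr'; congr tape; lia.
- case: Z.eqb_spec => [|_]; first lia.
  by rewrite Hl.
Qed.

Definition reach (q : Q) l r q' l' r' n : Prop :=
  forall c, rep c q l r -> rep (iter n (@tm_step fin_TM) c) q' l' r'.

Lemma reach_trans q1 l1 r1 q2 l2 r2 q3 l3 r3 n m :
  reach q1 l1 r1 q2 l2 r2 n -> reach q2 l2 r2 q3 l3 r3 m ->
  reach q1 l1 r1 q3 l3 r3 (n + m).
Proof. by move=> H1 H2 c Hc; rewrite addnC iterD; apply/H2/H1. Qed.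

Lemma reach_step q l r q' w m q2 l2 r2 n : q != h ->
  d q (head None r) = (q', w, m) ->
  reach q' (moved l r w m).1 (moved l r w m).2 q2 l2 r2 n ->
  reach q l r q2 l2 r2 n.+1.
Proof. by move=> nh Hd H c Hc; rewrite iterSr; apply: H; apply: rep_step Hd. Qed.

Lemma reach0 q l r : reach q l r q l r 0.
Proof. by move=> c. Qed.

Lemma rep_pad c q l l' r r' :
  (forall n, nth None l n = nth None l' n) ->
  (forall n, nth None r n = nth None r' n) ->
  rep c q l r -> rep c q l' r'.
Proof. by move=> El Er [H1 H2 H3]; split=> // n; rewrite -?El -?Er. Qed.
End FiniteControlMachine.

(** * Simulation of stack machines *)

Inductive instr (Q : Type) : Type :=
| Push : nat -> sym -> Q -> instr Q
| Pop : nat -> (option sym -> Q) -> instr Q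
| Jump : Q -> instr Q.
Arguments Push {Q}. Arguments Pop {Q}. Arguments Jump {Q}.

(** One stack operation is a few sweeps of the head. The index in ['I_R.+1] counts the blanks still
    to be crossed, which is how a register is located; the [option sym] is the cell carried along
    while the contents are shifted by one place. *)
Inductive phase (Q : Type) (R : nat) : Type :=
| Start
| Seek of 'I_R.+1
| Insert of 'I_R.+1 & option sym
| Home of 'I_R.+1 & Q
| SeekEnd of 'I_R.+1
| Delete of 'I_R.+1 & option sym.
Arguments Start {Q R}. Arguments Seek {Q R}. Arguments Insert {Q R}.
Arguments Home {Q R}. Arguments SeekEnd {Q R}. Arguments Delete {Q R}.

Section PhaseFinite.
Variables (Q : finType) (R : nat).
Definition phase_code (p : phase Q R) :=
  match p with
  | Start => inl (inl None)
  | Seek r => inl (inl (Some r))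
  | Insert r x => inl (inr (r, x))
  | Home r q => inr (inl (inl (r, q)))
  | SeekEnd r => inr (inl (inr r))
  | Delete r x => inr (inr (r, x))
  end.
Definition phase_decode c : phase Q R :=
  match c with
  | inl (inl None) => Start
  | inl (inl (Some r)) => Seek r
  | inl (inr (r, x)) => Insert r x
  | inr (inl (inl (r, q))) => Home r q
  | inr (inl (inr r)) => SeekEnd r
  | inr (inr (r, x)) => Delete r x
  end.
Lemma phase_codeK : cancel phase_code phase_decode.
Proof. by case. Qed.
HB.instance Definition _ := Equality.copy (phase Q R) (can_type phase_codeK).
HB.instance Definition _ := Choice.copy (phase Q R) (can_type phase_codeK).
HB.instance Definition _ := Countable.copy (phase Q R) (can_type phase_codeK).
HB.instance Definition _ := Finite.copy (phase Q R) (can_type phase_codeK).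
End PhaseFinite.

(* The tape holds the registers side by side, each terminated by a blank, with
   the head at home on the first cell; tops are on the left. *)
Definition layout (ws : seq (seq sym)) : seq (option sym) :=
  flatten [seq rcons (map Some w) None | w <- ws].

Definition blanks (s : seq (option sym)) := count (pred1 None) s.

Lemma layout_cat ws1 ws2 : layout (ws1 ++ ws2) = layout ws1 ++ layout ws2.
Proof. by rewrite /layout map_cat flatten_cat. Qed.
Lemma layout_cons w ws : layout (w :: ws) = map Some w ++ None :: layout ws.
Proof. by rewrite /layout /= cat_rcons. Qed.
Lemma blanks_map w : blanks (map Some w) = 0.
Proof. by elim: w. Qed.
Lemma blanks_layout ws : blanks (layout ws) = size ws.
Proof.
elim: ws => // w ws IH.
by rewrite layout_cons /blanks count_cat /= -!/(blanks _) blanks_map IH.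
Qed.
Lemma layout_rcons ws : ws != [::] ->
  exists L, layout ws = rcons L None /\ blanks L = (size ws).-1.
Proof.
case/lastP: ws => // ws w _; exists (layout ws ++ map Some w).
rewrite -cats1 layout_cat layout_cons -cats1 catA; split=> //.
by rewrite size_cat addn1 /= /blanks count_cat -!/(blanks _) blanks_layout blanks_map addn0.
Qed.
Lemma size_layout ws : size (layout ws) = size ws + sumn (map size ws).
Proof.
elim: ws => // w ws IH; rewrite layout_cons size_cat size_map /= IH; lia.
Qed.

Lemma nth_pad (l : seq (option sym)) n : nth None (l ++ [:: None]) n = nth None l n.
Proof.
rewrite nth_cat; case: ltnP => // Hn; rewrite [RHS]nth_default //.
by case: (n - _) => [|[|k]].
Qed.

Section StackMachine.
Variables (Q : finType) (R : nat) (ins : Q -> instr Q) (q0 h : Q).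

Definition reg_ok (i : instr Q) : bool :=
  match i with Push j _ _ => j < R | Pop j _ => j < R | Jump _ => true end.
Hypothesis ins_ok : forall q, reg_ok (ins q).

Definition sstep (c : Q * seq (seq sym)) : Q * seq (seq sym) :=
  if c.1 == h then c else
  match ins c.1 with
  | Push j s q => (q, set_nth [::] c.2 j (s :: nth [::] c.2 j))
  | Pop j f => (f (ohead (nth [::] c.2 j)), set_nth [::] c.2 j (behead (nth [::] c.2 j)))
  | Jump q => (q, c.2)
  end.

Local Notation st := (Q * phase Q R)%type.

(** A push shifts rightwards from the insertion point. A pop first runs to the last separator and
    then shifts leftwards, so that the symbol carried at the end is the popped one and can be handed
    to [f]. The branches in which the phase does not match the instruction are never entered from
    [Start]. *)
Definition delta (qp : st) (o : option sym) : st * option sym * move :=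
  let: (q, p) := qp in
  match p with
  | Start =>
      match ins q with
      | Push j _ _ => ((q, Seek (inord j)), o, MStay)
      | Pop j _ => ((q, Seek (inord j)), o, MStay)
      | Jump q' => ((q', Start), o, MStay)
      end
  | Seek r =>
      if val r == 0 then
        match ins q with
        | Push j s _ => ((q, Insert (inord (R - j)) (Some s)), o, MStay)
        | Pop j f => if o is Some _ then ((q, SeekEnd (inord (R - j))), o, MStay)
                     else ((q, Home (inord j.+1) (f None)), o, MStay)
        | Jump q' => ((q', Start), o, MStay)
        end
      else ((q, Seek (if o is None then inord r.-1 else r)), o, MRight)
  | Insert r x =>
      if o is Some _ then ((q, Insert r o), x, MRight)
      else if val r == 1 then
        match ins q with
        | Push _ _ q' => ((q, Home (inord R) q'), x, MRight)
        | _ => ((q, Start), x, MRight)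
        end
      else ((q, Insert (inord r.-1) None), x, MRight)
  | SeekEnd r =>
      if o is Some _ then ((q, SeekEnd r), o, MRight)
      else if val r == 1 then
        match ins q with
        | Pop j _ => ((q, Delete (inord (R - j).-1) None), None, MLeft)
        | _ => ((q, Start), o, MRight)
        end
      else ((q, SeekEnd (inord r.-1)), o, MRight)
  | Delete r x =>
      if o is Some _ then ((q, Delete r o), x, MLeft)
      else if val r == 0 then
        match ins q with
        | Pop j f => ((q, Home (inord j) (f x)), None, MStay)
        | _ => ((q, Start), o, MRight)
        end
      else ((q, Delete (inord r.-1) None), x, MLeft)
  | Home r q' =>
      if o is Some _ then ((q, Home r q'), o, MLeft)
      else if val r == 0 then ((q', Start), None, MRight)
      else ((q, Home (inord r.-1) q'), None, MLeft)
  end.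

Local Notation reaches := (@reach [the finType of st] delta (q0, Start) (h, Start)).

Lemma busy q p : p != Start -> (q, p) != (h, Start) :> st.
Proof. by move=> Hp; rewrite xpair_eqE (negbTE Hp) andbF. Qed.

Lemma seek_reach q L : last None L = None -> forall l r, blanks L <= R ->
  reaches (q, Seek (inord (blanks L))) l (L ++ r) (q, Seek (inord 0)) (rev L ++ l) r (size L).
Proof.
elim: L => [|x L IH] HL l r HR; first by apply: reach0.
have Hb : 0 < blanks (x :: L).
  by case/lastP: L HL {IH HR} => [/= ->|L y] //; rewrite last_cons last_rcons => ->;
    rewrite /blanks -cats1 -cat_cons count_cat /= addn1.
have Hl : last None L = None by case: L {IH HR Hb} HL.
rewrite /= rev_cons cat_rcons.
apply: (reach_step (q' := (q, Seek (inord (blanks L)))) (w := x) (m := MRight)).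
- exact: busy.
- rewrite /= inordK // eqn0Ngt Hb /=.
  by case: x {HL Hb} HR => [s|] HR.
- by apply: IH => //; apply: leq_trans HR; rewrite /blanks /= leq_addl.
Qed.

(** The blank left of the first cell is the one met with the counter at 0, so the counter has to
    start at the number of blanks from the current cell [y] leftwards. *)
Lemma home_reach q q' l1 : forall y l0 r, blanks (y :: l1) <= R ->
  reaches (q, Home (inord (blanks (y :: l1))) q') (l1 ++ None :: l0) (y :: r)
          (q', Start) (None :: l0) (rev l1 ++ y :: r) (size l1).+2.
Proof.
elim: l1 => [|x l1 IH] y l0 r HR.
- apply: (reach_step (q' := (q, Home (inord 0) q')) (w := y) (m := MLeft)).
  + exact: busy.
  + by case: y HR => [s|] HR //=; rewrite inordK.
  + apply: (reach_step (q' := (q', Start)) (w := None) (m := MRight)); first exact: busy.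
      by rewrite /= inordK.
    exact: reach0.
- have Hb : blanks (x :: l1) <= R by apply: leq_trans HR; rewrite /blanks /= leq_addl.
  rewrite rev_cons cat_rcons.
  apply: (reach_step (q' := (q, Home (inord (blanks (x :: l1))) q')) (w := y) (m := MLeft)).
  + exact: busy.
  + by case: y HR => [s|] HR //=; rewrite inordK.
  + exact: IH.
Qed.

(** The last separator need not be written: the head ends on the blank cell just beyond, which takes
    its place. *)
Lemma insert_reach q j s q' L : ins q = Push j s q' -> forall x l, blanks L < R ->
  reaches (q, Insert (inord (blanks L).+1) x) l (rcons L None)
          (q, Home (inord R) q') (rev (x :: L) ++ l) [::] (size L).+1.
Proof.
move=> Hq; elim: L => [|y L IH] x l HR.
- apply: (reach_step (q' := (q, Home (inord R) q')) (w := x) (m := MRight)).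
  + exact: busy.
  + by rewrite /= inordK ?Hq.
  + exact: reach0.
- rewrite rev_cons cat_rcons.
  apply: (reach_step (q' := (q, Insert (inord (blanks L).+1) y)) (w := x) (m := MRight)).
  + exact: busy.
  + by case: y HR => [t|] HR //=; rewrite inordK.
  + by apply: IH => //; apply: leq_ltn_trans HR; rewrite /blanks /= leq_addl.
Qed.

(** Of the [R - j] separators from register [j] on, the last is left behind, so [Delete] has
    [(R - j).-1] to cross before it meets the blank that precedes register [j]. *)
Lemma seek_end_reach q j f L : ins q = Pop j f -> forall l l0, blanks L < R ->
  reaches (q, SeekEnd (inord (blanks L).+1)) (rev l ++ l0) (rcons L None)
          (q, Delete (inord (R - j).-1) None) (behead (rev (l ++ L) ++ l0))
          [:: head None (rev (l ++ L) ++ l0); None] (size L).+1.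
Proof.
move=> Hq; elim: L => [|y L IH] l l0 HR.
- rewrite cats0.
  apply: (reach_step (q' := (q, Delete (inord (R - j).-1) None)) (w := None) (m := MLeft)).
  + exact: busy.
  + by rewrite /= inordK ?Hq.
  + exact: reach0.
- apply: (reach_step (q' := (q, SeekEnd (inord (blanks L).+1))) (w := y) (m := MRight)).
  + exact: busy.
  + by case: y HR => [t|] HR //=; rewrite inordK.
  + rewrite -cat_rcons -[(moved _ _ _ _).1]/((y :: rev l) ++ l0) -rev_rcons.
    by apply: IH => //; apply: leq_ltn_trans HR; rewrite /blanks /= leq_addl.
Qed.

(** Going left, the shift meets the top of register [j] last; hence [f] receives [last y l1]. *)
Lemma delete_reach q j f l1 : ins q = Pop j f -> forall y c l0 r, blanks (y :: l1) <= R ->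
  reaches (q, Delete (inord (blanks (y :: l1))) c) (l1 ++ None :: l0) (y :: r)
          (q, Home (inord j) (f (last y l1))) l0 (None :: behead (rev (y :: l1)) ++ c :: r)
          (size l1).+2.
Proof.
move=> Hq; elim: l1 => [|x l1 IH] y c l0 r HR.
- apply: (reach_step (q' := (q, Delete (inord 0) y)) (w := c) (m := MLeft)).
  + exact: busy.
  + by case: y HR => [t|] HR //=; rewrite inordK.
  + apply: (reach_step (q' := (q, Home (inord j) (f y))) (w := None) (m := MStay)).
    * exact: busy.
    * by rewrite /= inordK // Hq.
    * exact: reach0.
- have -> : behead (rev [:: y, x & l1]) ++ c :: r = behead (rev (x :: l1)) ++ y :: c :: r.
    rewrite rev_cons -cats1; case E: (rev (x :: l1)) => [|z s] /=; last by rewrite -catA.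
    by move/(congr1 size): E; rewrite size_rev.
  apply: (reach_step (q' := (q, Delete (inord (blanks (x :: l1))) y)) (w := c) (m := MLeft)).
  + exact: busy.
  + by case: y HR => [t|] HR //=; rewrite inordK.
  + by apply: IH; apply: leq_trans HR; rewrite /blanks /= leq_addl.
Qed.

Lemma push_reach q j s q' ws : q != h -> ins q = Push j s q' -> size ws = R ->
  exists2 n, n <= 4 * size (layout ws) + 10 &
    reaches (q, Start) [::] (layout ws)
            (q', Start) [::] (layout (set_nth [::] ws j (s :: nth [::] ws j))) n.
Proof.
move=> nh Hq Hs.
have Hj : j < R by have := ins_ok q; rewrite Hq.
have Ews : ws = take j ws ++ drop j ws by rewrite cat_take_drop.
have Hj' : j < size ws by rewrite Hs.
have Sd : size (drop j ws) = R - j by rewrite size_drop Hs.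
have St : size (take j ws) = j by rewrite size_takel // ltnW.
have nd : drop j ws != [::] by rewrite -size_eq0 Sd; lia.
have [L [EL BL]] := layout_rcons nd; rewrite Sd in BL.
set lt := layout (take j ws).
have Elw : layout ws = lt ++ rcons L None by rewrite {1}Ews layout_cat EL.
have Elw' : layout (set_nth [::] ws j (s :: nth [::] ws j)) =
    lt ++ Some s :: rcons L None.
  rewrite -EL set_nthE Hj' layout_cat layout_cons /= (drop_nth [::] Hj') layout_cons //.
have Blt : blanks lt = j by rewrite /lt blanks_layout St.
have Llt : last None lt = None.
  rewrite /lt; case: (take j ws) => [|w0 ws0] //.
  by have [//|L0 [-> _]] := @layout_rcons (w0 :: ws0); rewrite last_rcons.
exists (1 + (size lt + (1 + ((size L).+1 + (size (rev (Some s :: L) ++ rev lt)).+2)))).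
  by rewrite Elw !(size_cat, size_rcons, size_rev) /=; lia.
rewrite Elw Elw'.
apply: reach_trans.
  apply: (reach_step (q' := (q, Seek (inord j))) (w := head None (lt ++ rcons L None)) (m := MStay)).
  - by rewrite xpair_eqE (negbTE nh).
  - by rewrite /= Hq.
  - exact: reach0.
set r := (X in reach _ _ _ _ _ X).
have {r} -> : r = lt ++ rcons L None by rewrite /r /moved; case: (lt) => //=; case: (L).
rewrite -{1}Blt; apply: reach_trans; first by apply: seek_reach => //; rewrite Blt ltnW.
rewrite cats0; apply: reach_trans.
  apply: (reach_step (q' := (q, Insert (inord (R - j)) (Some s)))
     (w := head None (rcons L None)) (m := MStay)).
  - exact: busy.
  - by rewrite /= inordK // Hq.
  - exact: reach0.
rewrite [(moved _ _ _ _).1]/= [(moved _ _ _ _).2]/=.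
have -> : head None (rcons L None) :: behead (rcons L None) = rcons L None by case: (L).
have -> : R - j = (blanks L).+1 by rewrite BL; lia.
apply: reach_trans; first by apply: insert_reach Hq _ _ _; lia.
set l1 := _ ++ _.
have Hl1 : blanks l1 = R.-1.
  by rewrite /l1 /blanks count_cat !count_rev /= -!/(blanks _) Blt; lia.
(* The head stands on the new last separator; with the [R.-1] blanks to its left this makes [R]. *)
have HH : blanks (None :: l1) = R by rewrite /blanks /= -/(blanks _); lia.
move=> c Hc.
have {}Hc : rep c (q, Home (inord (blanks (None :: l1))) q') (l1 ++ [:: None]) [:: None].
  rewrite HH; move: Hc; apply: rep_pad => [n|[|[|n]]] //.
  by rewrite nth_pad.
have := @home_reach q q' l1 None [::] [::] _ c Hc; rewrite HH => /(_ (leqnn _)).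
apply: rep_pad => n; first by case: n => [|n] //=; rewrite nth_nil.
by rewrite /l1 rev_cat !revK -cats1 -catA.
Qed.

Lemma pop_reach q j f ws : q != h -> ins q = Pop j f -> size ws = R ->
  exists2 n, n <= 4 * size (layout ws) + 10 &
    reaches (q, Start) [::] (layout ws)
            (f (ohead (nth [::] ws j)), Start) [::]
            (layout (set_nth [::] ws j (behead (nth [::] ws j)))) n.
Proof.
move=> nh Hq Hs.
have Hj : j < R by have := ins_ok q; rewrite Hq.
have Ews : ws = take j ws ++ drop j ws by rewrite cat_take_drop.
have Hj' : j < size ws by rewrite Hs.
have Sd : size (drop j ws) = R - j by rewrite size_drop Hs.
have St : size (take j ws) = j by rewrite size_takel // ltnW.
set lt := layout (take j ws).
have Blt : blanks lt = j by rewrite /lt blanks_layout St.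
have Llt : last None lt = None.
  rewrite /lt; case: (take j ws) => [|w0 ws0] //.
  by have [//|L0 [-> _]] := @layout_rcons (w0 :: ws0); rewrite last_rcons.
set w := nth [::] ws j.
set l2 := layout (drop j.+1 ws).
have Elw : layout ws = lt ++ map Some w ++ None :: l2.
  by rewrite {1}Ews layout_cat (drop_nth [::] Hj') layout_cons.
have Elw' : layout (set_nth [::] ws j (behead w)) = lt ++ map Some (behead w) ++ None :: l2.
  by rewrite set_nthE Hj' layout_cat layout_cons.
have start : reaches (q, Start) [::] (layout ws) (q, Seek (inord 0)) (rev lt)
      (map Some w ++ None :: l2) (1 + size lt).
  apply: reach_trans.
    apply: (reach_step (q' := (q, Seek (inord j))) (w := head None (layout ws)) (m := MStay)).
    - by rewrite xpair_eqE (negbTE nh).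
    - by rewrite /= Hq.
    - exact: reach0.
  set r := (X in reach _ _ _ _ _ X).
  have {r} -> : r = layout ws by rewrite /r /moved Elw; case: (lt) => //=; case: (w).
  rewrite -{1}Blt Elw -[rev lt]cats0.
  by apply: seek_reach => //; rewrite Blt ltnW.
rewrite Elw'.
case Ew: w start Elw => [|a w'] start Elw.
(* Empty register: the cell under the head is its own separator, so [j.+1] blanks lie at or left of
   the head. *)
- exists ((1 + size lt) + (1 + (size (rev lt)).+2)).
    by rewrite Elw !size_cat /= size_rev; lia.
  apply: reach_trans start _; apply: reach_trans.
    apply: (reach_step (q' := (q, Home (inord j.+1) (f None))) (w := None) (m := MStay)).
    - exact: busy.
    - by rewrite /= inordK // Hq.
    - exact: reach0.
  rewrite /= => c Hc.
  have HH : blanks (None :: rev lt) = j.+1 by rewrite /blanks /= count_rev -/(blanks _) Blt.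
  have {}Hc : rep c (q, Home (inord (blanks (None :: rev lt))) (f None)) (rev lt ++ [:: None]) (None :: l2).
    rewrite HH; move: Hc; apply: rep_pad => n //.
    by rewrite nth_pad.
  have := @home_reach q (f None) (rev lt) None [::] l2 _ c Hc; rewrite HH => /(_ Hj).
  apply: rep_pad => n; first by case: n => [|n] //=; rewrite nth_nil.
  by rewrite revK.
- have nd : drop j ws != [::] by rewrite -size_eq0 Sd; lia.
  have [L [EL BL]] := layout_rcons nd; rewrite Sd in BL.
  have EL' : map Some w ++ None :: l2 = rcons L None.
    by rewrite -EL (drop_nth [::] Hj') layout_cons.
  have [L' EL2] : exists L', L = Some a :: L'.
    by move: EL'; rewrite Ew; case: (L) => [|b L'] //= [<- _]; exists L'.
  have ER : R - j = (blanks L).+1 by rewrite BL; lia.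
  have Erl : exists y l1, rev L = y :: l1.
    case E: (rev L) => [|y l1]; last by exists y, l1.
    by move/(congr1 size): E; rewrite size_rev EL2.
  have {Erl} [y [l1 Erl]] := Erl.
  have Hlast : last y l1 = Some a.
    have : last None (rev L) = Some a by rewrite EL2 rev_cons last_rcons.
    by rewrite Erl.
  have By : blanks (y :: l1) = blanks L by rewrite -Erl /blanks count_rev.
  have Sl1 : (size l1).+1 = size L by rewrite -(size_rev L) Erl.
  have HB : blanks (y :: l1) <= R by lia.
  have Eres : behead (rev (y :: l1)) ++ [:: None; None] = map Some w' ++ None :: rcons l2 None.
    rewrite -Erl revK EL2 /=.
    move: EL'; rewrite Ew EL2 /= => -[EL'].
    by rewrite -[None :: rcons l2 None]/(rcons (None :: l2) None) -rcons_cat EL' -!cats1 -catA.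
  (* The way home after a removal. For [j = 0] no separator precedes the register: the head is on
     the blank left of the first cell, and one step to the right suffices. *)
  have Efin t l : last None t = None -> blanks t = j -> exists2 m, m <= size t + 2 &
      reaches (q, Home (inord j) (f (Some a))) (behead (rev t ++ [:: None]))
        (None :: l) (f (Some a), Start) [::] (t ++ l) m.
    case/lastP: t => [|lt' x] Lt Bt.
    - exists 1 => // c Hc.
      have Ej : j = 0 by rewrite -Bt.
      have : reaches (q, Home (inord j) (f (Some a))) [::] (None :: l) (f (Some a), Start) [:: None] l 1.
        apply: (reach_step (q' := (f (Some a), Start)) (w := None) (m := MRight)).
        + exact: busy.
        + by rewrite /= inordK ?Ej.
        + exact: reach0.
      by move=> /(_ c Hc); apply: rep_pad => [[|[|n]]|n].
    - rewrite last_rcons in Lt; subst x.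
      exists (size (rev lt')).+2; first by rewrite size_rev size_rcons addn2.
      rewrite rev_rcons /= => c Hc.
      have HH : blanks (None :: rev lt') = j.
        by rewrite -Bt -cats1 /blanks /= count_rev count_cat /= addnC.
      have HjR : blanks (None :: rev lt') <= R by rewrite HH ltnW.
      have := @home_reach q (f (Some a)) (rev lt') None [::] l HjR c; rewrite HH.
      by move=> /(_ Hc); rewrite revK cat_rcons; apply: rep_pad => [[|[|n]]|n].
  have [m Hm {}Efin] := Efin lt (map Some w' ++ None :: rcons l2 None) Llt Blt.
  exists ((1 + size lt) + (1 + ((size L).+1 + ((size l1).+2 + m)))).
    by rewrite Elw -Ew EL' size_cat size_rcons; lia.
  apply: reach_trans start _; rewrite -Ew EL'; apply: reach_trans.
    apply: (reach_step (q' := (q, SeekEnd (inord (R - j)))) (w := Some a) (m := MStay)).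
    - exact: busy.
    - by rewrite /= inordK // Hq EL2.
    - exact: reach0.
  rewrite ER EL2 [(moved _ _ _ _).1]/= [(moved _ _ _ _).2]/= -rcons_cons -EL2.
  apply: reach_trans.
    apply: (seek_end_reach Hq (l := [::])); lia.
  rewrite cat0s Erl /= ER /= -By; apply: reach_trans.
    move=> c Hc; apply: (delete_reach Hq (l0 := behead (rev lt ++ [:: None])) HB).
    move: Hc; apply: rep_pad => // n.
    rewrite -[catrev lt [::]]/(rev lt); case E: (rev lt) => [|x r]; first by rewrite cats0 nth_pad.
    have -> : x = None.
      by move: Llt; rewrite -(revK lt) E rev_cons last_rcons.
    by rewrite /= -cat_cons catA nth_pad.
  rewrite Hlast; move=> c Hc.
  have : rep c (q, Home (inord j) (f (Some a))) (behead (rev lt ++ [:: None]))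
    (None :: map Some w' ++ None :: rcons l2 None).
    by rewrite -Eres.
  rewrite Ew; move=> /Efin; apply: rep_pad => // n.
  by rewrite -[RHS]nth_pad -!catA /= cats1.
Qed.

Lemma sumn_size_set_nth ws j v : j < size ws ->
  sumn (map size (set_nth [::] ws j v)) + size (nth [::] ws j) =
  sumn (map size ws) + size (v : seq sym).
Proof. by elim: ws j => [|w ws IH] [|j] //= Hj; [lia | have := IH j Hj; lia]. Qed.

Lemma sstep_size c : size c.2 = R ->
  size (sstep c).2 = R /\ sumn (map size (sstep c).2) <= (sumn (map size c.2)).+1.
Proof.
case: c => q ws /= Hs; rewrite /sstep /=; case: eqP => //= _.
have := ins_ok q; case: (ins q) => [j s q'|j f|q'] //= Hj; rewrite -Hs in Hj.
- split; first by rewrite size_set_nth Hs; apply/maxn_idPr; rewrite -Hs.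
  by have := sumn_size_set_nth (s :: nth [::] ws j) Hj; rewrite /=; lia.
- split; first by rewrite size_set_nth Hs; apply/maxn_idPr; rewrite -Hs.
  by have := sumn_size_set_nth (behead (nth [::] ws j)) Hj; rewrite size_behead; lia.
Qed.

Lemma sstep_reach c : size c.2 = R ->
  exists2 n, n <= 4 * size (layout c.2) + 10 &
    reaches (c.1, Start) [::] (layout c.2) ((sstep c).1, Start) [::] (layout (sstep c).2) n.
Proof.
case: c => q ws /= Hs; rewrite /sstep /=; case: eqP => [->|/eqP nh].
  by exists 0 => //; apply: reach0.
case Hq: (ins q) => [j s q'|j f|q'].
- exact: push_reach.
- exact: pop_reach.
- exists 1; first by rewrite addnC.
  move=> c Hc.
  have : reaches (q, Start) [::] (layout ws) (q', Start) [::] (head None (layout ws) :: behead (layout ws)) 1.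
    apply: (reach_step (q' := (q', Start)) (w := head None (layout ws)) (m := MStay)).
    + by rewrite xpair_eqE (negbTE nh).
    + by rewrite /= Hq.
    + exact: reach0.
  by move=> /(_ c Hc); apply: rep_pad => // n; case: (layout ws) => //; case: n => [|[]].
Qed.

(** A stack step lengthens the contents by at most one symbol, so [B] bounds the tape length
    throughout and each step costs a bounded number of sweeps over [B] cells. *)
Lemma iter_sstep_reach t c : size c.2 = R ->
  let B := R + sumn (map size c.2) + t in
  exists2 n, n <= t * (4 * B + 10) &
    reaches (c.1, Start) [::] (layout c.2)
            ((iter t sstep c).1, Start) [::] (layout (iter t sstep c).2) n.
Proof.
elim: t c => [|t IH] c Hs B; first by exists 0 => //; apply: reach0.
have [Hs1 Hs2] := sstep_size Hs.
have [n Hn r1] := sstep_reach Hs.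
have [m Hm r2] := IH _ Hs1.
exists (n + m); last by rewrite iterSr; apply: reach_trans r1 r2.
rewrite mulSn; apply: leq_add.
  by apply: leq_trans Hn _; rewrite size_layout Hs /B; lia.
by apply: leq_trans Hm _; rewrite leq_mul2l /B; lia.
Qed.

Definition stack_TM : TM := fin_TM delta (q0, Start) (h, Start).

(** Register 0 begins at the home cell and ends with a blank, so input and output of the tape
    machine are this register itself, with no conversion. *)
Theorem stack_TM_computes (x y : seq sym) t rs : 0 < R ->
  iter t sstep (q0, x :: nseq R.-1 [::]) = (h, y :: rs) ->
  tm_computes_within stack_TM x (t * (4 * (R + size x + t) + 10)) y.
Proof.
move=> HR Ht.
have Hsz : size (x :: nseq R.-1 [::]) = R by rewrite /= size_nseq prednK.
have Hsum : sumn (map size (x :: nseq R.-1 [::])) = size x.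
  by rewrite /= map_nseq sumn_nseq mul0n addn0.
have [n] := @iter_sstep_reach t (q0, x :: nseq R.-1 [::]) Hsz.
rewrite /= in Hsum; rewrite /= Hsum Ht => Hn r.
exists n; split=> //.
have Hc : rep (tm_init stack_TM x : config (fin_TM delta (q0, Start) (h, Start)))
     (q0, Start) [::] (layout (x :: nseq R.-1 [::])).
  split=> // k; rewrite /tm_init [cf_tape _]/= [cf_pos _]/=.
  - rewrite Z.add_0_l Nat2Z.id; case: Z.leb_spec => [_|H]; last lia.
    rewrite layout_cons nth_cat size_map; case: ltnP => // Hk.
    rewrite nth_default ?size_map //.
    have : all (pred1 None) (None :: layout (nseq R.-1 [::])) by rewrite /=; elim: (R.-1).
    by move/(all_nthP None) => Ha; case: (ltnP (k - size x) (size (None :: layout (nseq R.-1 [::])))) =>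
      [/Ha /eqP -> //|H]; rewrite nth_default.
  - by rewrite nth_nil; case: Z.leb_spec => // H; exfalso; lia.
have {r Hc} [E1 E2 _] := r _ Hc.
split; first exact: E1.
have E z : cf_tape (iter n (@tm_step stack_TM) (tm_init stack_TM x))
   (cf_pos (iter n (@tm_step stack_TM) (tm_init stack_TM x)) + Z.of_nat z)%Z =
   nth None (map Some y ++ None :: layout rs) z.
  by rewrite -layout_cons; apply: E2.
split=> [j Hj|]; rewrite E nth_cat size_map ?ltnn ?subnn //.
by rewrite Hj (nth_map S0).
Qed.
End StackMachine.

(** * Agenda machines *)

(* Register 2 holds the agenda, a stack of items; item [g] is coded as [S0^g S1]. *)
Definition encode_item (g : nat) : seq sym := rcons (nseq g S0) S1.
Definition encode_agenda (W : seq nat) : seq sym := flatten (map encode_item W).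

Definition push_on (rs : seq (seq sym)) (p : nat * sym) :=
  set_nth [::] rs p.1 (p.2 :: nth [::] rs p.1).

Section AgendaMachine.
Variables (R G : nat) (act : nat -> nat * (option sym -> seq (nat * sym) * seq nat))
  (emits : pred nat).

Definition reg_fine (r : nat) := (r < R) && (r != 2).
Hypothesis R_large : 2 < R.
Hypothesis act_reg : forall g, reg_fine (act g).1.
Hypothesis act_push : forall g o, all (fun p => reg_fine p.1) ((act g).2 o).1.
Hypothesis act_items : forall g o, all (fun g => g <= G) ((act g).2 o).2.
Hypothesis act_emits : forall g o, emits g -> ((act g).2 o).2 = [::].

Definition cfg := (seq (seq sym) * seq nat)%type.

Definition perform (rs : seq (seq sym)) (g : nat) (W : seq nat) : cfg :=
  let r := (act g).1 in
  let a := (act g).2 (ohead (nth [::] rs r)) in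
  (foldl push_on (set_nth [::] rs r (behead (nth [::] rs r))) a.1, a.2 ++ W).

(* The index counts only the steps that are not plain output: the others are
   paid for by the step that put them on the agenda. *)
Inductive wsteps : cfg -> cfg -> nat -> Prop :=
| wsteps_refl c : wsteps c c 0
| wsteps_step rs g W c s : wsteps (perform rs g W) c s ->
    wsteps (rs, g :: W) c (~~ emits g + s).

Lemma wsteps_trans c1 c2 c3 s1 s2 :
  wsteps c1 c2 s1 -> wsteps c2 c3 s2 -> wsteps c1 c3 (s1 + s2).
Proof.
elim=> // rs g W c s _ IH H; rewrite -addnA.
by apply: wsteps_step; apply: IH.
Qed.

(** The agenda code is pushed in reverse, so that the first new item ends up on top. *)
Definition pushes (g : nat) (o : option sym) : seq (nat * sym) :=
  ((act g).2 o).1 ++ [seq (2, s) | s <- rev (encode_agenda ((act g).2 o).2)].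

Definition width : nat :=
  \max_(p : 'I_G.+1 * option sym) size (pushes p.1 p.2).

Lemma size_pushes g o : g <= G -> size (pushes g o) <= width.
Proof.
move=> Hg; have := @leq_bigmax _ (fun p : 'I_G.+1 * option sym => size (pushes p.1 p.2)) (inord g, o).
by rewrite /= inordK.
Qed.

Local Notation ctl :=
  (option ('I_G.+1 + 'I_G.+1 + 'I_G.+1 * option sym * 'I_width.+1)).

Definition Dec g : ctl := Some (inl (inl (inord g))).
Definition Do g : ctl := Some (inl (inr (inord g))).
Definition Psh g o m : ctl := Some (inr (inord g, o, inord m)).

(** [Dec] counts through the unary code of the top item, [Do] makes the pop of its action, [Psh]
    performs its pushes one at a time. A missing code means an empty agenda and leads to the halting
    state [None]. *)
Definition control (q : ctl) : instr ctl :=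
  match q with
  | None => Jump None
  | Some (inl (inl g)) =>
      Pop 2 (fun o => match o with
                      | None => None
                      | Some S0 => Dec g.+1
                      | Some _ => Do g end)
  | Some (inl (inr g)) => Pop (act g).1 (fun o => Psh g o 0)
  | Some (inr (g, o, m)) =>
      if m < size (pushes g o) then
        let p := nth (0, S0) (pushes g o) m in Push p.1 p.2 (Psh g o m.+1)
      else Jump (Dec 0)
  end.

Lemma pushes_regs g o : all (fun p => p.1 < R) (pushes g o).
Proof.
rewrite all_cat; apply/andP; split.
  by apply: sub_all (act_push g o) => p /andP[].
by rewrite all_map; apply/allP => s _ /=.
Qed.

Lemma control_ok q : reg_ok R (control q).
Proof.
case: q => [[[g|g]|[[g o] m]]|] //=; first by case/andP: (act_reg g).
by case: ifP => //= Hm; apply: (all_nthP (0, S0) (pushes_regs g o)).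
Qed.

Definition conc (c : cfg) : seq (seq sym) := set_nth [::] c.1 2 (encode_agenda c.2).

Local Notation cstep := (sstep control None).

Lemma cstep_dec g n rs W : n + g <= G -> size rs = R ->
  iter n.+1 cstep (Dec g, set_nth [::] rs 2 (nseq n S0 ++ S1 :: W)) =
  (Do (n + g), set_nth [::] rs 2 W).
Proof.
move=> + Hs; elim: n g => [|n IH] g Hg.
  by rewrite /= /sstep /= nth_set_nth /= ?eqxx /= set_set_nth ?eqxx inordK.
rewrite iterSr.
have -> : cstep (Dec g, set_nth [::] rs 2 (nseq n.+1 S0 ++ S1 :: W)) =
   (Dec g.+1, set_nth [::] rs 2 (nseq n S0 ++ S1 :: W)).
  by rewrite /sstep /= nth_set_nth /= ?eqxx /= set_set_nth ?eqxx inordK //; lia.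
by rewrite IH addnS ?addSn //; lia.
Qed.

Lemma cstep_push g o m rs : g <= G -> m <= size (pushes g o) ->
  iter (size (pushes g o) - m).+1 cstep (Psh g o m, rs) =
  (Dec 0, foldl push_on rs (drop m (pushes g o))).
Proof.
move=> Hg; move E: (size (pushes g o) - m) => k.
elim: k m rs E => [|k IH] m rs E Hm.
  have -> : m = size (pushes g o) by lia.
  have Em : (inord (size (pushes g o)) : 'I_width.+1) = size (pushes g o) :> nat.
    by rewrite inordK // ltnS size_pushes.
  by rewrite drop_size /= /sstep /= Em inordK // ltnn.
rewrite iterSr.
have Hm' : m < size (pushes g o) by lia.
have Em : (inord m : 'I_width.+1) = m :> nat.
  by rewrite inordK // ltnS; apply: leq_trans (size_pushes o Hg); apply: ltnW.
have -> : cstep (Psh g o m, rs) = (Psh g o m.+1, push_on rs (nth (0, S0) (pushes g o) m)).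
  by rewrite /sstep /= Em inordK // Hm'.
by rewrite IH ?(drop_nth (0, S0) Hm') //; lia.
Qed.

Lemma foldl_push_agenda rs w W :
  foldl push_on (set_nth [::] rs 2 W) [seq (2, s) | s <- rev w] = set_nth [::] rs 2 (w ++ W).
Proof.
elim/last_ind: w W => [|w s IH] W //=.
have E : push_on (set_nth [::] rs 2 W) (2, s) = set_nth [::] rs 2 (s :: W).
  by rewrite /push_on nth_set_nth /= set_set_nth ?eqxx.
by rewrite rev_rcons /= E IH cat_rcons.
Qed.

Lemma foldl_push_other rs ps W : all (fun p => reg_fine p.1) ps ->
  foldl push_on (set_nth [::] rs 2 W) ps = set_nth [::] (foldl push_on rs ps) 2 W.
Proof.
elim: ps rs => [|p ps IH] rs //= /andP[/andP[_ Hp] Hps].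
rewrite -IH //; congr foldl.
by rewrite /push_on nth_set_nth /= (negbTE Hp) set_set_nth eq_sym (negbTE Hp).
Qed.

Lemma size_push_all rs ps : size rs = R -> all (fun p => reg_fine p.1) ps ->
  size (foldl push_on rs ps) = R.
Proof.
elim: ps rs => [|p ps IH] rs //= Hs /andP[/andP[Hp _] Hps].
by apply: IH => //; rewrite size_set_nth Hs; apply/maxn_idPr.
Qed.

Lemma size_perform rs g W : size rs = R -> size (perform rs g W).1 = R.
Proof.
move=> Hs; apply: size_push_all => //.
by rewrite size_set_nth Hs; apply/maxn_idPr; case/andP: (act_reg g).
Qed.

Lemma control_perform rs g W : size rs = R -> g <= G ->
  exists2 n, n <= G + width + 3 &
    iter n cstep (Dec 0, conc (rs, g :: W)) = (Dec 0, conc (perform rs g W)).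
Proof.
move=> Hs Hg.
have [Hr1 Hr2] := andP (act_reg g).
set o := ohead (nth [::] rs (act g).1).
exists ((size (pushes g o) - 0).+1 + (1 + g.+1)).
  by have := size_pushes o Hg; lia.
have E0 : conc (rs, g :: W) = set_nth [::] rs 2 (nseq g S0 ++ S1 :: encode_agenda W).
  by rewrite /conc -cat_rcons.
have Hg0 : g + 0 <= G by rewrite addn0.
rewrite iterD iterD E0 (cstep_dec _ Hg0 Hs) addn0 [iter 1 _ _]/=.
have -> : cstep (Do g, set_nth [::] rs 2 (encode_agenda W)) =
    (Psh g o 0, set_nth [::] (set_nth [::] rs (act g).1 (behead (nth [::] rs (act g).1))) 2 (encode_agenda W)).
  rewrite /sstep /= inordK // nth_set_nth /= (negbTE Hr2) -/o.
  by rewrite [in LHS]set_set_nth eq_sym (negbTE Hr2).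
rewrite cstep_push // drop0 foldl_cat foldl_push_other //.
by rewrite foldl_push_agenda /conc /perform /encode_agenda /= map_cat flatten_cat.
Qed.

Lemma size_encode_agenda W : size W <= size (encode_agenda W).
Proof.
elim: W => // g W IH; rewrite [encode_agenda _]/(encode_item g ++ encode_agenda W).
by rewrite size_cat size_rcons /=; lia.
Qed.

(** Amortisation: an emitting item leaves no new items, any other leaves at most [width], and each
    item costs at most [G + width + 3] stack steps. The items still on the agenda are the potential,
    so the [s] counted steps and the initial agenda pay for everything. *)
Lemma wsteps_control c c' s : wsteps c c' s -> size c.1 = R -> all (fun g => g <= G) c.2 ->
  size c'.1 = R /\ exists2 n, n + size c'.2 * (G + width + 3) <=
                (s * width.+1 + size c.2) * (G + width + 3) &
     iter n cstep (Dec 0, conc c) = (Dec 0, conc c').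
Proof.
elim=> {c c' s} [c|rs g W c s _ IH] /= Hs Ha; first by split=> //; exists 0.
case/andP: Ha => Hg HW.
have [||Hsz [m Hm Em]] := IH.
- exact: size_perform.
- by rewrite all_cat act_items.
split=> //.
have [n Hn En] := control_perform W Hs Hg.
exists (m + n); last by rewrite iterD En.
have Hit o : size ((act g).2 o).2 <= ~~ emits g * width.
  case Eg: (emits g); first by rewrite act_emits.
  rewrite mul1n; apply: leq_trans (size_pushes o Hg).
  rewrite /pushes size_cat size_map size_rev.
  by apply: leq_trans (size_encode_agenda _) _; apply: leq_addl.
move: Hm; rewrite /= size_cat; have := Hit (ohead (nth [::] rs (act g).1)).
move: (size _) => a; move: (width) Hn => w Hn Ha.
set B := G + w + 3 => Hm.
have : m + n + size c.2 * B <= (s * w.+1 + (a + size W)) * B + B by lia.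
move/leq_trans; apply.
rewrite -mulSnr leq_mul2r; apply/orP; right.
by case: (emits g) Ha => /=; lia.
Qed.

Lemma size_push_reg ps rs r :
  size (nth [::] (foldl push_on rs ps) r) <= size ps + size (nth [::] rs r).
Proof.
elim: ps rs => [|p ps IH] rs //=; apply: leq_trans (IH _) _.
by rewrite nth_set_nth /=; case: eqP => [->|_] /=; lia.
Qed.

(** The same potential, measured in symbols: an item on the agenda may still add [width] symbols to
    register [r], and a counted step adds at most [width] items. This bounds the output length
    without looking into the templates. *)
Lemma wsteps_output c c' s r : wsteps c c' s -> all (fun g => g <= G) c.2 ->
  size (nth [::] c'.1 r) + size c'.2 * width <=
  size (nth [::] c.1 r) + size c.2 * width + s * (width + width * width).
Proof.
elim=> {c c' s} [c|rs g W c s _ IH] /= Ha; first by rewrite mul0n addn0.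
case/andP: Ha => Hg HW.
apply: leq_trans (IH _) _; first by rewrite all_cat act_items.
rewrite /= size_cat; set o := ohead _.
have Hp := size_push_reg ((act g).2 o).1 (set_nth [::] rs (act g).1 (behead (nth [::] rs (act g).1))) r.
have Hr : size (nth [::] (set_nth [::] rs (act g).1 (behead (nth [::] rs (act g).1))) r) <= size (nth [::] rs r).
  by rewrite nth_set_nth /=; case: eqP => [->|//]; rewrite size_behead leq_pred.
have := size_pushes o Hg; rewrite /pushes size_cat size_map size_rev => Hw.
have := size_encode_agenda ((act g).2 o).2.
case Eg: (emits g); first by rewrite act_emits //= add0n in Hw *; lia.
move: (size ((act g).2 o).2) => a; move: (size (encode_agenda _)) Hw => b Hw Hab /=.
have : a * width <= width * width by rewrite leq_mul2r; apply/orP; right; lia.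
lia.
Qed.

Variable g0 : nat.
Hypothesis g0_ok : g0 <= G.
Hypothesis g0_push : ((act g0).2 None).1 = [::].

(** Starting in the middle of item [g0], after its pop, loads the initial agenda and leaves the
    input intact. *)
Definition agenda_TM : TM := stack_TM R control (Psh g0 None 0) None.

Lemma agenda_TM_computes : exists K, forall x y rs s,
  wsteps (x :: nseq R.-1 [::], ((act g0).2 None).2) (y :: rs, [::]) s ->
  tm_computes_within agenda_TM x (K * s.+1 * (4 * (R + size x + K * s.+1) + 10)) y.
Proof.
set w0 := ((act g0).2 None).2.
(* The product pays for the agenda items, [width + 2] for loading the initial agenda and for the
   halting step. *)
exists ((width.+1 + size w0) * (G + width + 3) + width + 2) => x y rs s Hw.
have Hsz : size (x :: nseq R.-1 [::]) = R by rewrite /= size_nseq; lia.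
have [|Hs [n Hn En]] := wsteps_control Hw Hsz.
  exact: act_items.
have E0 : iter (size (pushes g0 None) - 0).+1 cstep
     (Psh g0 None 0, x :: nseq R.-1 [::]) = (Dec 0, conc (x :: nseq R.-1 [::], w0)).
  rewrite cstep_push // drop0 /pushes g0_push cat0s /conc.
  have {1}-> : x :: nseq R.-1 [::] = set_nth [::] (x :: nseq R.-1 [::]) 2 [::].
    by move: R_large; case: (R) => [|[|[|r]]].
  by rewrite foldl_push_agenda cats0.
have E1 : cstep (Dec 0, conc (y :: rs, [::])) = (None, conc (y :: rs, [::])).
  rewrite /sstep /conc /= nth_set_nth /= set_set_nth ?eqxx //.
have Et : iter (1 + (n + (size (pushes g0 None) - 0).+1)) cstep
     (Psh g0 None 0, x :: nseq R.-1 [::]) = (None, y :: (set_nth [::] rs 1 [::])).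
  by rewrite iterD iterD E0 En [LHS]/= E1.
have := stack_TM_computes control_ok _ Et.
move=> /(_ ltac:(lia)) [t [Ht HT]]; exists t; split=> //; apply: leq_trans Ht _.
have HK : 1 + (n + (size (pushes g0 None) - 0).+1) <=
   ((width.+1 + size w0) * (G + width + 3) + width + 2) * s.+1.
  have := size_pushes None g0_ok; move: (width) Hn => w Hn Hp.
  rewrite /= mul0n addn0 in Hn; nia.
by apply: leq_mul => //; lia.
Qed.
End AgendaMachine.

(** * Runs of flat structures *)

(** Shortening the way from [u] back to [s] to a path without repetitions keeps its first state, so
    the resulting simple loop still leaves [s] by the given edge. *)
Lemma simple_loop_through K s u p :
  ks_edge K s u -> path (ks_edge K) u p -> last u p = s ->
  exists l, simple_loop K (s :: l) /\ head s l = u.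
Proof.
move=> Hsu Hp Hl; case: (shortenP Hp) Hl => p' Hp' Up' _ Hl.
case/lastP: p' Hp' Up' Hl => [|p' x] Hp' Up' Hl.
  by exists [::]; rewrite /= in Hl; subst u; split=> //=; apply/andP.
rewrite last_rcons in Hl; subst x.
exists (u :: p'); split=> //; rewrite /simple_loop.
move: Hp'; rewrite rcons_path => /andP[Hp' He]; apply/and3P; split=> //.
- by move: Up'; rewrite -rcons_cons rcons_uniq.
- by rewrite /= Hsu.
Qed.

Lemma flat_next K s u1 p1 u2 p2 : flat K ->
  ks_edge K s u1 -> path (ks_edge K) u1 p1 -> last u1 p1 = s ->
  ks_edge K s u2 -> path (ks_edge K) u2 p2 -> last u2 p2 = s -> u1 = u2.
Proof.
move=> HK E1 P1 L1 E2 P2 L2.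
have [l1 [S1 <-]] := simple_loop_through E1 P1 L1.
have [l2 [S2 <-]] := simple_loop_through E2 P2 L2.
by have [->] := HK _ _ S1 S2 erefl.
Qed.

Lemma run_path K rho a n : is_run K rho ->
  path (ks_edge K) (rho a) (map rho (iota a.+1 n)) /\
  last (rho a) (map rho (iota a.+1 n)) = rho (a + n).
Proof.
case=> _ He; elim: n a => [|n IH] a /=; first by rewrite addn0.
by have [-> ->] := IH a.+1; rewrite He addSnnS.
Qed.

(** A time [m] between [f] and a later return to [rho f] lies on a cycle: follow the run to the
    return, then from [f] up to [m]. So flatness fixes the successor of [rho m] as long as a return
    is still ahead. *)
Lemma run_next K rho f i bi j bj : flat K -> is_run K rho ->
  f <= i -> i < bi -> rho bi = rho f ->
  f <= j -> j < bj -> rho bj = rho f ->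
  rho i = rho j -> rho i.+1 = rho j.+1.
Proof.
move=> HK Hr.
have back m b : f <= m -> m < b -> rho b = rho f ->
    exists p, path (ks_edge K) (rho m.+1) p /\ last (rho m.+1) p = rho m.
  move=> Hfm Hmb Eb.
  have [P1 L1] := run_path m.+1 (b - m.+1) Hr.
  have [P2 L2] := run_path f (m - f) Hr.
  rewrite subnKC // Eb in L1; rewrite subnKC // in L2.
  exists (map rho (iota m.+2 (b - m.+1)) ++ map rho (iota f.+1 (m - f))).
  split; last by rewrite last_cat L1; exact: L2.
  by rewrite cat_path P1 L1.
move=> Hi Hbi Ebi Hj Hbj Ebj E.
have [p1 [P1 L1]] := back _ _ Hi Hbi Ebi.
have [p2 [P2 L2]] := back _ _ Hj Hbj Ebj.
have [_ He] := Hr.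
by apply: (flat_next HK (He i) P1 L1 _ P2); rewrite E.
Qed.

(* [l = 0] means that the progression [f], [f + p], ... is not cut. *)
Lemma run_visits K rho s : flat K -> is_run K rho ->
  exists f l p, p <= size (ks_edges K) /\
    forall i, rho i = s <-> (exists q, i = f + p * q) /\ ~ (0 < l /\ l <= i).
Proof.
move=> HK Hr.
case: (classic (exists i, rho i == s)) => [Hex|Hno]; last first.
  (* Never visited: the progression consisting of 1 alone is cut at time 1, hence empty. *)
  exists 1, 1, 0; split=> // i; split.
    by move=> E; case: Hno; exists i; apply/eqP.
  by case=> [[q ->] []]; rewrite mul0n.
case: (ex_minnP Hex) => f /eqP Ef Hmin.
case: (classic (exists k, (0 < k) && (rho (f + k) == s))) => [Hex2|Hno]; last first.
  (* Visited exactly once: period 0 and no cut. *)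
  exists f, 0, 0; split=> // i; split.
    move=> E; split; last by case.
    exists 0; rewrite addn0; apply/eqP; rewrite eqn_leq Hmin ?E // andbT leqNgt; apply/negP => Hi.
    by apply: Hno; exists (i - f); rewrite subn_gt0 Hi subnKC ?E ?eqxx // ltnW.
  by case=> [[q ->] _]; rewrite addn0.
case: (ex_minnP Hex2) => p /andP[p0 /eqP Ep] Hpmin.
(* The run repeats with period [p] for as long as some visit [b] to [s] is still to come. *)
have shift k b : f + p + k <= b -> rho b = s -> rho (f + p + k) = rho (f + k).
  elim: k => [|k IH] Hb Eb; first by rewrite !addn0 Ep Ef.
  rewrite !addnS; apply: (@run_next K rho f _ b _ b) => //; rewrite ?Ef //; lia || (apply: IH => //; lia).
have mult i : rho i = s -> exists q, i = f + p * q.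
  elim/ltn_ind: i => i IH Ei.
  have Hfi : f <= i by apply: Hmin; rewrite Ei.
  case: (ltnP i (f + p)) => Hi.
    exists 0; apply/eqP; rewrite muln0 addn0 eqn_leq Hfi andbT leqNgt; apply/negP => Hlt.
    have : p <= i - f by apply: Hpmin; rewrite subn_gt0 Hlt subnKC ?Ei ?eqxx.
    by lia.
  have Hk : f + p + (i - (f + p)) = i by lia.
  have [||q Eq] := IH (f + (i - (f + p))); first lia.
    by rewrite -(shift _ i) ?Hk.
  by exists q.+1; rewrite mulnS; lia.
have conv q b : f + p * q <= b -> rho b = s -> rho (f + p * q) = s.
  elim: q => [|q IH] Hb Eb; first by rewrite muln0 addn0.
  rewrite mulnS addnA (shift _ b) ?IH //; first by move: Hb; rewrite mulnS; lia.
  by rewrite -addnA -mulnS.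
(* The edges of the first turn are distinct: a state repeated at offsets [c < d] would force a
   return to [s] after only [c + (p - d) < p] steps. *)
have Hp : p <= size (ks_edges K).
  pose es := [seq (rho (f + k), rho (f + k).+1) | k <- iota 0 p].
  have -> : p = size es by rewrite size_map size_iota.
  apply: uniq_leq_size.
    rewrite map_inj_in_uniq ?iota_uniq // => c d; rewrite !mem_iota !add0n => /andP[_ Hc] /andP[_ Hd] [E _].
    wlog cd : c d Hc Hd E / c < d.
      by move=> W; case: (ltngtP c d) => // H; [apply: W | apply/esym; apply: W].
    have step k : d + k <= p -> rho (f + c + k) = rho (f + d + k).
      elim: k => [|k IH] Hk; first by rewrite !addn0.
      rewrite !addnS; apply: (@run_next K rho f _ (f + p) _ (f + p)) => //; rewrite ?Ep ?Ef //; lia || (apply: IH; lia).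
    have : p <= c + (p - d).
      apply: Hpmin; apply/andP; split; first by lia.
      by rewrite addnA step ?subnKC // -?addnA ?subnKC ?Ep // ltnW.
    by lia.
  by move=> x /mapP[k _ ->]; have [_ He] := Hr; exact: (He (f + k)).
case: (classic (exists N, forall i, rho i = s -> i < N)) => [[N HN]|Hinf].
  have Hub i : rho i == s -> i <= N by move/eqP/HN/ltnW.
  case: (ex_maxnP Hex Hub) => L /eqP EL HL.
  (* [L] is the last visit; the cut [L.+1] is positive, so it cannot be mistaken for the uncut
     case. *)
  exists f, L.+1, p; split=> // i; split.
    by move=> Ei; split; [apply: mult | move=> [_]; rewrite ltnNge HL ?Ei].
  case=> [[q ->] Hn]; apply: (conv q L) => //.
  by rewrite leqNgt; apply/negP => H; apply: Hn.
exists f, 0, p; split=> // i; split.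
  by move=> Ei; split; [apply: mult | case].
case=> [[q ->] _].
case: (classic (exists2 b, f + p * q <= b & rho b = s)) => [[b Hb Eb]|Hb].
  exact: conv Eb.
case: Hinf; exists (f + p * q) => j Ej; rewrite ltnNge; apply/negP => H.
by apply: Hb; exists j.
Qed.

(** * Formulas describing runs *)

Arguments psat : simpl never.
Arguments upd : simpl never.

(* [vF j] are bookkeeping variables, [vU x] stands for the variable [x] of the
   source formula, and [vR c s] are the numbers describing the visits to state [s]:
   start, end and period for the current run (c = 0, 1, 2) and for its saved
   copy (c = 3, 4, 5). In binary each is a fixed prefix followed by the argument. *)
Definition vF (j : nat) : nat := 32 * j.
Definition vR (c s : nat) : nat := 16 + 2 * c + 32 * s.
Definition vU (x : nat) : nat := 2 * x + 1.

Lemma vF_vF a b : (vF a == vF b) = (a == b).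
Proof. by rewrite /vF; lia. Qed.
Lemma vF_vU a x : (vF a == vU x) = false.
Proof. by rewrite /vF /vU; lia. Qed.
Lemma vU_vF a x : (vU x == vF a) = false.
Proof. by rewrite /vF /vU; lia. Qed.
Lemma vU_vU x y : (vU x == vU y) = (x == y).
Proof. by rewrite /vU; lia. Qed.
Lemma vR_vU c s x : (vR c s == vU x) = false.
Proof. by rewrite /vR /vU; lia. Qed.
Lemma vU_vR c s x : (vU x == vR c s) = false.
Proof. by rewrite /vR /vU; lia. Qed.
Lemma vR_vF c s a : c < 8 -> (vR c s == vF a) = false.
Proof. by rewrite /vR /vF; lia. Qed.
Lemma vF_vR c s a : c < 8 -> (vF a == vR c s) = false.
Proof. by rewrite /vR /vF; lia. Qed.
Lemma vR_vR c s c' s' : c < 8 -> c' < 8 ->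
  (vR c s == vR c' s') = (c == c') && (s == s').
Proof. by rewrite /vR; lia. Qed.

Lemma upd_same eta x v : upd eta x v x = v.
Proof. by rewrite /upd eqxx. Qed.
Lemma upd_diff eta x v y : y != x -> upd eta x v y = eta y.
Proof. by rewrite /upd => /negbTE ->. Qed.

Ltac distinct_vars :=
  match goal with
  | |- is_true (vF ?a != vF ?b) => exact isT
  | |- is_true (vF ?a != vU ?b) => by rewrite vF_vU
  | |- is_true (vU ?a != vF ?b) => by rewrite vU_vF
  | |- is_true (vR _ _ != vU _) => by rewrite vR_vU
  | |- is_true (vU _ != vR _ _) => by rewrite vU_vR
  | |- is_true (vR _ _ != vF _) => rewrite vR_vF //; lia
  | |- is_true (vF _ != vR _ _) => rewrite vF_vR //; lia
  | |- is_true (vR _ _ != vR _ _) => rewrite vR_vR //; lia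
  end.
Ltac upd1 :=
  match goal with
  | |- context [upd ?e ?x ?v ?y] =>
      tryif constr_eq x y then rewrite (upd_same e x v)
      else (rewrite (@upd_diff e x v y); [ | solve [distinct_vars]])
  end.
Ltac upds := rewrite /= ?mul1n; repeat upd1; rewrite /= ?mul1n.

(** * Derived connectives of [PH] and their semantics *)

Definition PV x := PMul 1 x.
Definition PEq s t := PAnd (PLe s t) (PLe t s).
Definition PLt s t := PNot (PLe t s).
Definition POr f g := PNot (PAnd (PNot f) (PNot g)).
Definition PLet x t g := PEx x (PAnd (PEq (PV x) t) g).
Definition PFalse := PLe (PConst 1) (PConst 0).

Fixpoint pvars (t : pterm) : seq nat :=
  match t with
  | PConst _ => [::]
  | PMul _ x => [:: x]
  | PPlus t1 t2 => pvars t1 ++ pvars t2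
  end.

Lemma pteval_upd eta x v t : x \notin pvars t -> pteval (upd eta x v) t = pteval eta t.
Proof.
elim: t => //= [a y|t1 IH1 t2 IH2].
  by rewrite inE eq_sym => H; rewrite upd_diff.
by rewrite mem_cat negb_or => /andP[/IH1 -> /IH2 ->].
Qed.

Lemma propext (A B : Prop) : (A <-> B) -> A = B.
Proof. exact: propositional_extensionality. Qed.

Lemma psat_le s t eta : psat (PLe s t) eta = (pteval eta s <= pteval eta t).
Proof. by []. Qed.
Lemma psat_not f eta : psat (PNot f) eta = (~ psat f eta).
Proof. by []. Qed.
Lemma psat_and f g eta : psat (PAnd f g) eta = (psat f eta /\ psat g eta).
Proof. by []. Qed.
Lemma psat_ex x f eta : psat (PEx x f) eta = (exists b, psat f (upd eta x b)).
Proof. by []. Qed.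
Lemma psat_eq s t eta : psat (PEq s t) eta = (pteval eta s = pteval eta t).
Proof.
apply: propext; rewrite psat_and !psat_le; split=> [[H1 H2]|->] //.
by apply/eqP; rewrite eqn_leq H1.
Qed.
Lemma psat_lt s t eta : psat (PLt s t) eta = (pteval eta s < pteval eta t).
Proof.
by apply: propext; rewrite psat_not psat_le ltnNge; split=> [/negP|/negP].
Qed.
Lemma psat_or f g eta : psat (POr f g) eta = (psat f eta \/ psat g eta).
Proof.
apply: propext; rewrite psat_not psat_and !psat_not; split; last tauto.
by move=> H; apply: NNPP; tauto.
Qed.
Lemma psat_let x t g eta : x \notin pvars t ->
  psat (PLet x t g) eta = psat g (upd eta x (pteval eta t)).
Proof.
move=> Hx; apply: propext; rewrite psat_ex; split=> [[b]|H].
  by rewrite psat_and psat_eq (pteval_upd _ _ Hx) /= upd_same mul1n => -[->].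
exists (pteval eta t); rewrite psat_and psat_eq (pteval_upd _ _ Hx) /= upd_same mul1n.
by split.
Qed.
Lemma psat_false eta : psat PFalse eta = False.
Proof. by apply: propext; rewrite psat_le. Qed.
Ltac ps1 :=
  match goal with
  | |- context [psat (PAnd ?f ?g) ?e] => rewrite [psat (PAnd f g) e]psat_and
  | |- context [psat (PNot ?f) ?e] => rewrite [psat (PNot f) e]psat_not
  | |- context [psat (PLe ?f ?g) ?e] => rewrite [psat (PLe f g) e]psat_le
  | |- context [psat (PEx ?x ?f) ?e] => rewrite [psat (PEx x f) e]psat_ex
  | |- context [psat (PEq ?f ?g) ?e] => rewrite [psat (PEq f g) e]psat_eq
  | |- context [psat (PLt ?f ?g) ?e] => rewrite [psat (PLt f g) e]psat_lt
  | |- context [psat (POr ?f ?g) ?e] => rewrite [psat (POr f g) e]psat_or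
  | |- context [psat PFalse ?e] => rewrite [psat PFalse e]psat_false
  | |- context [psat (PLet ?x ?t ?g) ?e] =>
      rewrite [psat (PLet x t g) e](@psat_let x t g e isT)
  end.
Ltac ps := repeat ps1.

Notation vi := (vF 0).
Notation vc := (vF 1).
Notation ti := (vF 2).
Notation tv := (vF 3).
Notation vf := (vF 4).
Notation vl := (vF 5).
Notation vp := (vF 6).
Notation vq := (vF 7).
Notation vm := (vF 8).
Notation vp1 := (vF 9).
Notation vm1 := (vF 10).
Notation vu := (vF 11).
Notation va := (vF 12).
Notation vb := (vF 13).
Notation vk := (vF 14).
Notation vj := (vF 15).
Notation vx := (vF 16).
Notation vw := (vF 17).
Notation vP := (vF 18).
Notation vN := (vF 19).
Notation vP1 := (vF 20).
Notation vN1 := (vF 21).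
Notation vP2 := (vF 22).
Notation vN2 := (vF 23).
Notation vz := (vF 24).
Notation vy := (vF 25).

(** Either subtract 1 from [p] and [q] from [m], or stay put once [p] is 0. Staying put lets a fixed
    number of unfoldings serve every smaller [p]. *)
Definition fStep : pform :=
  POr (PAnd (PEq (PV vp) (PPlus (PV vp1) (PConst 1))) (PEq (PV vm) (PPlus (PV vm1) (PV vq))))
      (PAnd (PEq (PV vp) (PConst 0)) (PAnd (PEq (PV vp1) (PConst 0)) (PEq (PV vm) (PV vm1)))).

(* [m = p * q], the product being unfolded once per edge. *)
Fixpoint fMul (es : seq (nat * nat)) : pform :=
  match es with
  | [::] => PAnd (PEq (PV vp) (PConst 0)) (PEq (PV vm) (PConst 0))
  | _ :: es => PEx vp1 (PEx vm1 (PAnd fStep (PLet vp (PV vp1) (PLet vm (PV vm1) (fMul es)))))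
  end.

Lemma fMulP es eta :
  psat (fMul es) eta <-> eta vp <= size es /\ eta vm = eta vp * eta vq.
Proof.
elim: es eta => [|e es IH] eta.
  rewrite /=; ps; rewrite /= !mul1n leqn0; split=> [[-> ->]//|[/eqP -> ->]].
  by rewrite mul0n.
rewrite /=; ps; split.
  case=> p1; ps => -[m1]; rewrite /fStep; ps; upds.
  rewrite IH; upds.
  case=> H [Hp Hm]; case: H => [[-> ->]|[-> [Ep ->]]]; first by split; lia.
  by rewrite Hm Ep !mul0n.
case: (posnP (eta vp)) => [E0|Hp] [H1 H2].
  exists 0; ps; exists 0; rewrite /fStep; ps; upds.
  rewrite IH; upds; split; last by split.
  by right; rewrite H2 E0.
exists (eta vp).-1; ps; exists ((eta vp).-1 * eta vq); rewrite /fStep; ps; upds.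
rewrite IH; upds; split; last by split; lia.
left; split; first by lia.
by rewrite H2 -[in LHS](prednK Hp); lia.
Qed.

(** A variable cannot be indexed by the value of [tv], so the description of state [tv] is fetched
    by a disjunction over the sources of edges. A state without successor never occurs on a run, and
    a repeated source merely repeats a disjunct. *)
Fixpoint fLook (c : nat) (es : seq (nat * nat)) : pform :=
  match es with
  | [::] => PFalse
  | e :: es =>
      POr (PAnd (PEq (PV tv) (PConst e.1))
             (PAnd (PEq (PV vf) (PV (vR c e.1)))
                (PAnd (PEq (PV vl) (PV (vR c.+1 e.1)))
                      (PEq (PV vp) (PV (vR c.+2 e.1))))))
          (fLook c es)
  end.

Lemma fLookP c es eta : psat (fLook c es) eta <->
  [/\ eta tv \in map fst es, eta vf = eta (vR c (eta tv)),
      eta vl = eta (vR c.+1 (eta tv)) & eta vp = eta (vR c.+2 (eta tv))].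
Proof.
elim: es => [|e es IH]; first by rewrite /=; ps; split=> // -[].
rewrite /=; ps; rewrite IH /= !mul1n; split.
  case=> [[-> [-> [-> ->]]]|[H1 H2 H3 H4]]; first by split=> //; apply: mem_head.
  by split=> //; rewrite inE H1 orbT.
case; rewrite inE => /orP[/eqP ->|H1] H2 H3 H4; first by left.
by right.
Qed.

Definition fSt (c : nat) (es : seq (nat * nat)) : pform :=
  PEx vf (PEx vl (PEx vp (PAnd (fLook c es)
    (PEx vq (PEx vm (PAnd (fMul es)
       (PAnd (PEq (PV ti) (PPlus (PV vf) (PV vm)))
             (PNot (PAnd (PLe (PConst 1) (PV vl)) (PLe (PV vl) (PV ti))))))))))).

(** The bound on the period is included because the unfolded product in [fMul] enforces it. *)
Definition visits (es : seq (nat * nat)) (c : nat) (eta : nat -> nat) (i v : nat) : Prop :=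
  [/\ v \in map fst es, eta (vR c.+2 v) <= size es,
      exists q, i = eta (vR c v) + eta (vR c.+2 v) * q
    & ~ (0 < eta (vR c.+1 v) /\ eta (vR c.+1 v) <= i)].

Lemma fStP c es eta : c.+2 < 8 -> psat (fSt c es) eta <-> visits es c eta (eta ti) (eta tv).
Proof.
move=> Hc; have Hc1 : c.+1 < 8 by lia. have Hc0 : c < 8 by lia.
rewrite /fSt /visits; ps; split.
  case=> f; ps => -[l]; ps => -[p]; ps.
  rewrite fLookP; upds.
  case=> -[H1 -> -> ->]; ps => -[q]; ps => -[m].
  ps; rewrite fMulP /=; upds.
  case=> -[H2 ->] [Ei Hn]; split=> //.
  by exists q.
case=> H1 H2 [q Eq] Hn.
exists (eta (vR c (eta tv))); ps; exists (eta (vR c.+1 (eta tv))); ps.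
exists (eta (vR c.+2 (eta tv))); ps; split.
  by rewrite fLookP; upds.
ps; exists q; ps; exists (eta (vR c.+2 (eta tv)) * q).
by ps; rewrite fMulP /=; upds.
Qed.

Definition fAt c es (t v : pterm) : pform := PLet ti t (PLet tv v (fSt c es)).

Lemma visits_ext es c c' eta eta' i v :
  (v \in map fst es -> forall d, d < 3 -> eta (vR (c + d) v) = eta' (vR (c' + d) v)) ->
  visits es c eta i v <-> visits es c' eta' i v.
Proof.
move=> H; rewrite /visits; case: (v \in map fst es) H => H; last by split; case.
have := H isT 0 isT; have := H isT 1 isT; have := H isT 2 isT.
by rewrite !addn0 !addn1 !addn2 => -> -> ->.
Qed.

Lemma fAtP c es t v eta : c.+2 < 8 -> ti \notin pvars t -> tv \notin pvars v -> ti \notin pvars v ->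
  psat (fAt c es t v) eta <-> visits es c eta (pteval eta t) (pteval eta v).
Proof.
move=> Hc Ht Hv Hv'; rewrite /fAt !psat_let // pteval_upd // fStP //; upds.
by apply: visits_ext => _ d Hd; upds.
Qed.

Fixpoint fEdge (es : seq (nat * nat)) : pform :=
  match es with
  | [::] => PFalse
  | e :: es => POr (PAnd (PEq (PV va) (PConst e.1)) (PEq (PV vb) (PConst e.2))) (fEdge es)
  end.

Lemma fEdgeP es eta : psat (fEdge es) eta <-> (eta va, eta vb) \in es.
Proof.
elim: es => [|[s t] es IH]; first by rewrite /=; ps.
rewrite /=; ps; rewrite IH /= !mul1n inE xpair_eqE; split.
  by case=> [[-> ->]|->]; rewrite ?eqxx ?orbT.
by case/orP=> [/andP[/eqP -> /eqP ->]|->]; [left | right].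
Qed.

(** The three conjuncts make [visits] the graph of a function that starts in [vc] and follows edges,
    from which [valid_run] reads off a run. *)
Definition fValid (es : seq (nat * nat)) : pform :=
  PAnd (fAt 0 es (PConst 0) (PV vc))
    (PAnd (PNot (PEx vu (PNot (PEx va (PEx vb
             (PAnd (fAt 0 es (PV vu) (PV va))
               (PAnd (fAt 0 es (PPlus (PV vu) (PConst 1)) (PV vb)) (fEdge es))))))))
          (PNot (PEx vu (PEx va (PEx vb (PAnd (PLt (PV va) (PV vb))
             (PAnd (fAt 0 es (PV vu) (PV va)) (fAt 0 es (PV vu) (PV vb))))))))).

Lemma visits_upd es c eta j v i w : c + 2 < 8 ->
  visits es c (upd eta (vF j) v) i w <-> visits es c eta i w.
Proof. by move=> Hc; apply: visits_ext => d s Hd; upds. Qed.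

Lemma fValidP es eta : psat (fValid es) eta <->
  [/\ visits es 0 eta 0 (eta vc),
      forall u, exists a b, [/\ visits es 0 eta u a, visits es 0 eta u.+1 b & (a, b) \in es]
    & forall u a b, visits es 0 eta u a -> visits es 0 eta u b -> a = b].
Proof.
rewrite /fValid; ps; rewrite fAtP //= mul1n; split.
  case=> H1 [H2 H3]; split=> //.
    move=> u; apply: NNPP => Hn; apply: H2; exists u; ps=> -[a].
    ps => -[b]; ps; rewrite !fAtP // fEdgeP /= !visits_upd //; upds.
    by rewrite addn1 => -[A [B C]]; apply: Hn; exists a, b.
  have lt u a b : visits es 0 eta u a -> visits es 0 eta u b -> a < b -> False.
    move=> Ha Hb ab; apply: H3; exists u; ps; exists a; ps; exists b.
    by ps; rewrite !fAtP //= !visits_upd //; upds.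
  by move=> u a b Ha Hb; case: (ltngtP a b) => // H; case: (lt u _ _ _ _ H).
case=> H1 H2 H3; split=> //; split.
  case=> u; ps; apply; have [a [b [Ha Hb Hab]]] := H2 u.
  ps; exists a; ps; exists b.
  by ps; rewrite !fAtP // fEdgeP /= !visits_upd //; upds; rewrite addn1.
case=> u; ps => -[a]; ps => -[b].
ps; rewrite !fAtP //= !visits_upd //; upds.
by case=> ab [Ha Hb]; rewrite (H3 _ _ _ Ha Hb) ltnn in ab.
Qed.

(** * Comparing, copying and guessing descriptions of runs *)

Definition fAgree (es : seq (nat * nat)) : pform :=
  PNot (PEx vu (PEx va (PAnd (PLe (PV vu) (PV vi))
    (PAnd (fAt 0 es (PV vu) (PV va)) (PNot (fAt 3 es (PV vu) (PV va))))))).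

(** One inclusion is enough: once both descriptions encode runs, each assigns exactly one state to
    every time. *)
Lemma fAgreeP es eta : psat (fAgree es) eta <->
  forall u a, u <= eta vi -> visits es 0 eta u a -> visits es 3 eta u a.
Proof.
rewrite /fAgree; ps; split.
  move=> H u a Hu Ha; apply: NNPP => Hn; apply: H; exists u; ps; exists a.
  by ps; rewrite !fAtP //= !visits_upd //; upds.
move=> H [u]; ps => -[a]; ps; rewrite !fAtP //= !visits_upd //; upds.
by case=> Hu [Ha]; apply; apply: H.
Qed.

Fixpoint fCopy (es : seq (nat * nat)) (g : pform) : pform :=
  match es with
  | [::] => g
  | e :: es => PLet (vR 3 e.1) (PV (vR 0 e.1)) (PLet (vR 4 e.1) (PV (vR 1 e.1))
                 (PLet (vR 5 e.1) (PV (vR 2 e.1)) (fCopy es g)))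
  end.

Lemma fCopyP es g eta : exists eta',
  [/\ psat (fCopy es g) eta <-> psat g eta',
      forall y, (forall d s, d < 3 -> s \in map fst es -> y != vR (3 + d) s) -> eta' y = eta y
    & forall d s, d < 3 -> s \in map fst es -> eta' (vR (3 + d) s) = eta (vR d s)].
Proof.
elim: es eta => [|e es IH] eta; first by exists eta; split.
have [eta' [H1 H2 H3]] := IH (upd (upd (upd eta (vR 3 e.1) (eta (vR 0 e.1)))
    (vR 4 e.1) (eta (vR 1 e.1))) (vR 5 e.1) (eta (vR 2 e.1))).
have He : e.1 \in map fst (e :: es) by apply: mem_head.
exists eta'; split.
- rewrite -H1 /= !psat_let /=; try by rewrite inE vR_vR.
  by upds.
- move=> y Hy; rewrite H2.
    have K0 := Hy 0 e.1 isT He; have K1 := Hy 1 e.1 isT He; have K2 := Hy 2 e.1 isT He.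
    by rewrite (upd_diff _ _ K2) (upd_diff _ _ K1) (upd_diff _ _ K0).
  by move=> d s Hd Hs; apply: Hy => //; rewrite inE Hs orbT.
- move=> d s Hd.
  (* If [s] is the source of a further edge, the later copy decides, with the same value, since the
     variables of the current description are only read. *)
  case Es: (s \in map fst es) => Hs.
    rewrite H3 // !upd_diff //; rewrite vR_vR //; lia.
  move: Hs; rewrite inE Es orbF => /eqP E1; subst s.
  rewrite H2; last first.
    move=> d' s' Hd' Hs'; rewrite vR_vR; try lia.
    apply/negP => /andP[_ /eqP E]; rewrite -E in Hs'.
    by move: Es; rewrite Hs'.
  by case: d Hd => [|[|[|]]] // _; rewrite /upd !vR_vR // ?eqxx.
Qed.

Fixpoint fExi (es : seq (nat * nat)) (g : pform) : pform :=
  match es with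
  | [::] => g
  | e :: es => PEx (vR 0 e.1) (PEx (vR 1 e.1) (PEx (vR 2 e.1) (fExi es g)))
  end.

Definition same_off (es : seq (nat * nat)) (eta eta' : nat -> nat) : Prop :=
  forall y, (forall d s, d < 3 -> s \in map fst es -> y != vR d s) -> eta' y = eta y.

Lemma fExiP es g eta :
  psat (fExi es g) eta <-> exists2 eta', same_off es eta eta' & psat g eta'.
Proof.
elim: es eta => [|e es IH] eta.
  split; first by exists eta.
  case=> eta' H; rewrite /= (_ : eta = eta') //; apply: functional_extensionality => y.
  by apply/esym/H.
have He : e.1 \in map fst (e :: es) by apply: mem_head.
rewrite /=; ps; split.
  case=> b0; ps => -[b1]; ps => -[b2]; rewrite IH => -[eta' H1 H2].
  exists eta' => // y Hy; rewrite H1.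
    have K0 := Hy 0 e.1 isT He; have K1 := Hy 1 e.1 isT He; have K2 := Hy 2 e.1 isT He.
    by rewrite (upd_diff _ _ K2) (upd_diff _ _ K1) (upd_diff _ _ K0).
  by move=> d s Hd Hs; apply: Hy => //; rewrite inE Hs orbT.
case=> eta' H1 H2; exists (eta' (vR 0 e.1)); ps; exists (eta' (vR 1 e.1)); ps.
exists (eta' (vR 2 e.1)); rewrite IH; exists eta' => // y Hy.
case: (eqVneq y (vR 2 e.1)) => [->|N2]; first by rewrite upd_same.
rewrite upd_diff //; case: (eqVneq y (vR 1 e.1)) => [->|N1]; first by rewrite upd_same.
rewrite upd_diff //; case: (eqVneq y (vR 0 e.1)) => [->|N0]; first by rewrite upd_same.
rewrite upd_diff //; apply: H1 => d s Hd; rewrite inE => /orP[/eqP ->|]; last exact: Hy.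
by case: d Hd => [|[|[|]]].
Qed.

Lemma same_off_exists es eta (g : nat -> nat -> nat) : exists2 eta', same_off es eta eta' &
  forall d s, d < 3 -> s \in map fst es -> eta' (vR d s) = g d s.
Proof.
(* Decodes the name [16 + 2 * d + 32 * s]: [d] comes from the remainder modulo 32 and [s] is the
   quotient. *)
exists (fun y => if [&& 16 <= y %% 32, (y %% 32 - 16) %% 2 == 0, (y %% 32 - 16) %/ 2 < 3
                   & y %/ 32 \in map fst es]
                 then g ((y %% 32 - 16) %/ 2) (y %/ 32) else eta y).
  move=> y Hy; case: ifP => // /and4P[H1 H2 H3 H4].
  have := Hy _ _ H3 H4; rewrite /vR => /eqP []; lia.
move=> d s Hd Hs.
have -> : vR d s %% 32 = 16 + 2 * d by rewrite /vR; lia.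
have -> : vR d s %/ 32 = s by rewrite /vR; lia.
have -> : (16 + 2 * d - 16) %/ 2 = d by lia.
have -> : (16 + 2 * d - 16) %% 2 == 0 by lia.
by rewrite Hd Hs leq_addr.
Qed.

Definition encodes (K : KS) (c : nat) (eta : nat -> nat) (rho : nat -> nat) : Prop :=
  forall i v, visits (ks_edges K) c eta i v <-> rho i = v.

Lemma valid_run K eta : eta vc = ks_init K -> psat (fValid (ks_edges K)) eta ->
  exists2 rho, is_run K rho & encodes K 0 eta rho.
Proof.
move=> Hc; rewrite fValidP => -[H1 H2 H3].
have He u : exists a, visits (ks_edges K) 0 eta u a.
  by have [a [b [Ha _ _]]] := H2 u; exists a.
pose rho u := proj1_sig (constructive_indefinite_description _ (He u)).
have Hrho u : visits (ks_edges K) 0 eta u (rho u).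
  by rewrite /rho; case: constructive_indefinite_description.
exists rho; last first.
  by move=> i v; split=> [Hv|<-] //; apply: H3 Hv.
split; first by rewrite -Hc; apply: H3 (Hrho 0) H1.
move=> i; have [a [b [Ha Hb Hab]]] := H2 i.
by rewrite /ks_edge (H3 _ _ _ (Hrho i) Ha) (H3 _ _ _ (Hrho i.+1) Hb).
Qed.

(** Here flatness enters the correctness proof: by [run_visits] every run has a description whose
    periods respect the bound in [visits]. *)
Lemma run_encoding K rho : flat K -> is_run K rho ->
  exists g : nat -> nat -> nat, forall eta,
    (forall d s, d < 3 -> s \in map fst (ks_edges K) -> eta (vR d s) = g d s) ->
    encodes K 0 eta rho.
Proof.
move=> HK Hr.
have H s : exists p : nat * nat * nat, p.2 <= size (ks_edges K) /\
    forall i, rho i = s <-> (exists q, i = p.1.1 + p.2 * q) /\ ~ (0 < p.1.2 /\ p.1.2 <= i).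
  by have [f [l [p Hp]]] := run_visits s HK Hr; exists (f, l, p).
pose h s := proj1_sig (constructive_indefinite_description _ (H s)).
have Hh s : (h s).2 <= size (ks_edges K) /\
    forall i, rho i = s <-> (exists q, i = (h s).1.1 + (h s).2 * q) /\ ~ (0 < (h s).1.2 /\ (h s).1.2 <= i).
  by rewrite /h; case: constructive_indefinite_description.
exists (fun d s => match d with 0 => (h s).1.1 | 1 => (h s).1.2 | _ => (h s).2 end).
move=> eta Heta i v; have [H1 H2] := Hh v.
case Ev: (v \in map fst (ks_edges K)); last first.
  rewrite /visits Ev; split=> [[]//|E]; have [_ /(_ i)] := Hr.
  by rewrite E => /(map_f fst); rewrite /= Ev.
rewrite /visits Ev (Heta 0) // (Heta 1) // (Heta 2) // H2.
by split=> [[_ _ A B]|[A B]].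
Qed.

Lemma run_valid K eta rho : is_run K rho -> encodes K 0 eta rho -> eta vc = ks_init K ->
  psat (fValid (ks_edges K)) eta.
Proof.
move=> [H0 He] H Hc; rewrite fValidP; split.
- by apply/H; rewrite H0.
- by move=> u; exists (rho u), (rho u.+1); split; [apply/H | apply/H | apply: He].
- by move=> u a b /H <- /H <-.
Qed.

Definition fE es g := fCopy es (fExi es (PAnd (fValid es) (PAnd (fAgree es) g))).

(** The invariant under which formulas are translated. It is silent on the saved copy and on all
    bookkeeping variables except [vc] and [vi], so inner formulas may rebind those. *)
Definition tracks (K : KS) (S : seq nat) (eta rho : nat -> nat) (i : nat) (th : nat -> nat) :=
  [/\ is_run K rho, encodes K 0 eta rho, eta vc = ks_init K, eta vi = i
    & forall x, x \in S -> eta (vU x) = th x].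

(** The saved copy is consulted by [fAgree] alone, never by [g], so nested path quantifiers can
    share the same names. *)
Lemma fEP K S eta rho i th g (Q : (nat -> nat) -> Prop) : flat K ->
  tracks K S eta rho i th ->
  (forall eta' rho', tracks K S eta' rho' i th -> (psat g eta' <-> Q rho')) ->
  psat (fE (ks_edges K) g) eta <-> exists rho', is_run K rho' /\ agree rho rho' i /\ Q rho'.
Proof.
move=> HK [Hr He Hc Hi HS] HQ; rewrite /fE.
have [eta1 [-> E1 E2]] := fCopyP (ks_edges K) (fExi (ks_edges K) (PAnd (fValid (ks_edges K)) (PAnd (fAgree (ks_edges K)) g))) eta.
rewrite fExiP.
have Off eta2 : same_off (ks_edges K) eta1 eta2 ->
    [/\ eta2 vc = ks_init K, eta2 vi = i, forall x, x \in S -> eta2 (vU x) = th x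
      & encodes K 3 eta2 rho].
  move=> H2; split.
  - by rewrite H2 ?E1 // => d s Hd _; apply/eqP/eqP; distinct_vars.
  - by rewrite H2 ?E1 // => d s Hd _; apply/eqP/eqP; distinct_vars.
  - by move=> x Hx; rewrite H2 ?E1 ?HS // => d s Hd _; apply/eqP/eqP; distinct_vars.
  - move=> j v; rewrite -He; apply: visits_ext => Hv d Hd.
    rewrite H2; first by apply: E2.
    by move=> d' s Hd' _; rewrite vR_vR; lia.
split.
  case=> eta2 H2; ps => -[HV [HA Hg]]; have [Hc2 Hi2 HS2 He2] := Off _ H2.
  have [rho' Hr' He'] := valid_run Hc2 HV.
  exists rho'; split=> //; split; last first.
    have Ht : tracks K S eta2 rho' i th by split.
    by apply/(HQ _ _ Ht).
  move=> j Hj; move: HA; rewrite fAgreeP Hi2 => /(_ j (rho' j) Hj) H.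
  by apply/He2/H/He'.
case=> rho' [Hr' [Ha HQ']].
have [gg Hgg] := run_encoding HK Hr'.
have [eta2 H2 Hg2] := same_off_exists (ks_edges K) eta1 gg.
have [Hc2 Hi2 HS2 He2] := Off _ H2.
have He' := Hgg _ Hg2.
exists eta2 => //; ps; split; first exact: run_valid Hr' He' Hc2.
split; last first.
  have Ht : tracks K S eta2 rho' i th by split.
  by apply/(HQ _ _ Ht).
rewrite fAgreeP Hi2 => u a Hu /He' <-; apply/He2; exact: Ha.
Qed.

(** * Translation of formulas *)

Fixpoint fLabIn (ps : seq nat) : pform :=
  match ps with
  | [::] => PFalse
  | p :: ps => POr (PEq (PV vx) (PConst p)) (fLabIn ps)
  end.

Lemma fLabInP ps eta : psat (fLabIn ps) eta <-> eta vx \in ps.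
Proof.
elim: ps => [|p ps IH]; rewrite /=; ps; first by [].
by rewrite IH /= mul1n inE; split=> [[->|->]|/orP[/eqP ->|->]]; rewrite ?eqxx ?orbT //; [left|right].
Qed.

(** Walks down the label list while decrementing [tv]; running off the end yields no label, as does
    the default of [nth]. *)
Fixpoint fLab (ls : seq (seq nat)) : pform :=
  match ls with
  | [::] => PFalse
  | l :: ls => POr (PAnd (PEq (PV tv) (PConst 0)) (fLabIn l))
                   (PEx vw (PAnd (PEq (PV tv) (PPlus (PV vw) (PConst 1)))
                                 (PLet tv (PV vw) (fLab ls))))
  end.

Lemma fLabP ls eta : psat (fLab ls) eta <-> eta vx \in nth [::] ls (eta tv).
Proof.
elim: ls eta => [|l ls IH] eta; rewrite /=; ps; first by rewrite nth_nil in_nil.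
rewrite fLabInP /= mul1n; split.
  case=> [[-> //]|[w]]; ps; rewrite IH; upds.
  by case=> ->; rewrite addn1.
case E: (eta tv) => [|v] /= H; first by left.
right; exists v; ps; rewrite IH; upds; rewrite addn1.
by split.
Qed.

Definition fAP es ls p := PLet vx (PConst p) (PEx tv (PAnd (PLet ti (PV vi) (fSt 0 es)) (fLab ls))).

(* The value of a counting term is the difference [vP - vN]. *)
Definition fSigned (a : Z) (t : pterm) : pform :=
  if (a <? 0)%Z then PEq (PPlus (PV vP) t) (PV vN) else PEq (PV vP) (PPlus (PV vN) t).

Lemma fSignedP a t eta n : pteval eta t = Z.abs_nat a * n ->
  psat (fSigned a t) eta <-> (Z.of_nat (eta vP) - Z.of_nat (eta vN) = a * Z.of_nat n)%Z.
Proof.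
move=> Ht; rewrite /fSigned; case: Z.ltb_spec => Ha; ps; rewrite /= !mul1n Ht.
- have : (Z.of_nat (Z.abs_nat a * n) = - a * Z.of_nat n)%Z by nia.
  by move: (_ * n) => m Hm; split; lia.
- have : (Z.of_nat (Z.abs_nat a * n) = a * Z.of_nat n)%Z by nia.
  by move: (_ * n) => m Hm; split; lia.
Qed.

(** Each subterm is evaluated in a scope of its own, with [vP] and [vN] rebound to its pair. So [c]
    can compare the two pairs with each other and, for [cPlus], with the outer [vP] and [vN]. *)
Definition fPair (c : pform) (g1 g2 : pform) : pform :=
  PEx vP1 (PEx vN1 (PEx vP2 (PEx vN2 (PAnd c
    (PAnd (PLet vP (PV vP1) (PLet vN (PV vN1) g1))
          (PLet vP (PV vP2) (PLet vN (PV vN2) g2))))))).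
Definition cLe := PLe (PPlus (PV vP1) (PV vN2)) (PPlus (PV vP2) (PV vN1)).
Definition cPlus := PEq (PPlus (PV vP) (PPlus (PV vN1) (PV vN2)))
                        (PPlus (PV vN) (PPlus (PV vP1) (PV vP2))).

Lemma psat_count x y g eta : psat (PExCount x y g) eta =
  exists s : seq nat, [/\ uniq s, size s = eta x &
    forall b, b \in s <-> psat g (upd eta y b)].
Proof. by []. Qed.

Section Translation.
Variable (K : KS).

(** The detour over [vw] in the case of [CX] is due to [PLet], whose term must not mention the
    variable being set. *)
Fixpoint fT (f : cform) : pform :=
  match f with
  | CAP p => fAP (ks_edges K) (ks_label K) p
  | CAnd f1 f2 => PAnd (fT f1) (fT f2)
  | CNot f1 => PNot (fT f1)
  | CX f1 => PLet vw (PPlus (PV vi) (PConst 1)) (PLet vi (PV vw) (fT f1))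
  | CU f1 f2 =>
      PEx vk (PAnd (PLe (PV vi) (PV vk))
        (PAnd (PNot (PEx vj (PAnd (PLe (PV vi) (PV vj)) (PAnd (PLt (PV vj) (PV vk))
                 (PNot (PLet vi (PV vj) (fT f1)))))))
              (PLet vi (PV vk) (fT f2))))
  | CE f1 => fE (ks_edges K) (fT f1)
  | CBind x f1 => PLet (vU x) (PV vi) (fT f1)
  | CLe t1 t2 => fPair cLe (fV t1) (fV t2)
  end
with fV (t : cterm) : pform :=
  match t with
  | CConst a => fSigned a (PConst (Z.abs_nat a))
  | CCount a x f1 =>
      PEx vz (PAnd (fSigned a (PMul (Z.abs_nat a) vz))
        (PExCount vz vy (PAnd (PLe (PV (vU x)) (PV vy)) (PAnd (PLe (PV vy) (PV vi))
           (PLet vi (PV vy) (fT f1))))))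
  | CPlus t1 t2 => fPair cPlus (fV t1) (fV t2)
  end.

Fixpoint leaves (t : tree) : seq nat :=
  match t with
  | Leaf n => [:: n]
  | Node _ ks => flatten (map leaves ks)
  end.

Lemma tracks_upd S eta rho i th j v : 1 < j -> tracks K S eta rho i th ->
  tracks K S (upd eta (vF j) v) rho i th.
Proof.
move=> Hj [H1 H2 H3 H4 H5].
have N a : a < 2 -> vF a != vF j by move=> Ha; rewrite vF_vF; lia.
split=> //.
- by move=> u s; rewrite visits_upd.
- by rewrite upd_diff ?N.
- by rewrite upd_diff ?N.
- by move=> x Hx; upds; apply: H5.
Qed.

Lemma tracks_pos S eta rho i th k : tracks K S eta rho i th ->
  tracks K S (upd eta vi k) rho k th.
Proof.
move=> [H1 H2 H3 H4 H5]; split=> //; try by upds.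
by move=> x Hx; upds; apply: H5.
Qed.

Lemma tracks_pos1 S eta rho i th j a k : 1 < j -> tracks K S eta rho i th ->
  tracks K S (upd (upd eta (vF j) a) vi k) rho k th.
Proof. by move=> Hj /(tracks_upd a Hj); apply: tracks_pos. Qed.

Lemma tracks_pos2 S eta rho i th j a j' b k : 1 < j -> 1 < j' -> tracks K S eta rho i th ->
  tracks K S (upd (upd (upd eta (vF j) a) (vF j') b) vi k) rho k th.
Proof. by move=> Hj Hj' /(tracks_upd a Hj); apply: tracks_pos1. Qed.

Lemma sum_ind_size lo hi (P : nat -> Prop) n :
  (exists s : seq nat, [/\ uniq s, size s = n & forall b, b \in s <-> (lo <= b < hi /\ P b)]) <->
  n = \sum_(lo <= j < hi) ind (P j).
Proof.
pose p j := ind (P j) == 1.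
have pP j : p j <-> P j.
  by rewrite /p /ind; case: excluded_middle_informative.
pose s0 := [seq j <- index_iota lo hi | p j].
have E : size s0 = \sum_(lo <= j < hi) ind (P j).
  rewrite size_filter -sum1_count big_mkcond; apply: eq_bigr => j _.
  by rewrite /p /ind; case: excluded_middle_informative.
have Hs0 b : b \in s0 <-> (lo <= b < hi /\ P b).
  by rewrite mem_filter mem_index_iota andbC -pP; split=> [/andP[]|[-> ->]].
rewrite -E; split; last by move=> ->; exists s0; rewrite filter_uniq ?iota_uniq.
case=> s [Us <- Hs]; apply/perm_size/uniq_perm => //; first by rewrite filter_uniq ?iota_uniq.
by move=> b; apply/idP/idP => [/Hs/Hs0|/Hs0/Hs].
Qed.

Hypothesis flatK : flat K.

Scheme cform_ind2 := Induction for cform Sort Prop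
  with cterm_ind2 := Induction for cterm Sort Prop.
Combined Scheme cform_cterm_ind from cform_ind2, cterm_ind2.

Lemma fPairP c g1 g2 eta rho i th S (v1 v2 : Z) :
  tracks K S eta rho i th ->
  (forall eta', tracks K S eta' rho i th ->
     psat g1 eta' <-> (Z.of_nat (eta' vP) - Z.of_nat (eta' vN) = v1)%Z) ->
  (forall eta', tracks K S eta' rho i th ->
     psat g2 eta' <-> (Z.of_nat (eta' vP) - Z.of_nat (eta' vN) = v2)%Z) ->
  psat (fPair c g1 g2) eta <->
  exists p1 n1 p2 n2, [/\ psat c (upd (upd (upd (upd eta vP1 p1) vN1 n1) vP2 p2) vN2 n2),
    (Z.of_nat p1 - Z.of_nat n1 = v1)%Z & (Z.of_nat p2 - Z.of_nat n2 = v2)%Z].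
Proof.
move=> Ht H1 H2; rewrite /fPair; ps.
have T p1 n1 p2 n2 a b c' d :
   tracks K S (upd (upd (upd (upd (upd (upd eta vP1 p1) vN1 n1) vP2 p2) vN2 n2) (vF a.+2) b) (vF c'.+2) d) rho i th.
  by do! apply: tracks_upd => //.
split.
  case=> p1; ps => -[n1]; ps => -[p2]; ps => -[n2]; ps; rewrite H1; last exact: (T).
  rewrite H2; last exact: (T).
  by upds=> -[Hc [E1 E2]]; exists p1, n1, p2, n2.
case=> p1 [n1 [p2 [n2 [Hc E1 E2]]]].
exists p1; ps; exists n1; ps; exists p2; ps; exists n2; ps.
rewrite H1; last exact: (T). rewrite H2; last exact: (T).
by upds.
Qed.

(** The value of a term is fixed only as the difference of [vP] and [vN]. The set [S] stays the same
    while the formula shrinks, so valuations are compared on one fixed set of names. *)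
Lemma translation_correct :
  (forall f S eta rho i th, {subset leaves (enc_cform f) <= S} -> tracks K S eta rho i th ->
     psat (fT f) eta <-> csat K f rho i th) /\
  (forall t S eta rho i th, {subset leaves (enc_cterm t) <= S} -> tracks K S eta rho i th ->
     psat (fV t) eta <-> (Z.of_nat (eta vP) - Z.of_nat (eta vN) = cteval K t rho i th)%Z).
Proof.
apply: cform_cterm_ind => [p|f IHf g IHg|f IHf|f IHf|f IHf g IHg|f IHf|x f IHf|t IHt u IHu|a|a x f IHf|t IHt u IHu]
  S eta rho i th HS Ht; cbn [fT fV csat cteval].
- have [H1 H2 H3 H4 _] := Ht.
  rewrite /fAP; ps; split.
    case=> v; ps; rewrite fStP // fLabP; upds; rewrite H4 !visits_upd //.
    by case=> /H2 <-.
  move=> Hp; exists (rho i); ps; rewrite fStP // fLabP; upds; split=> //.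
  by rewrite !visits_upd // H4; apply/H2.
- have Hf : {subset leaves (enc_cform f) <= S} by move=> y Hy; apply: HS; rewrite /= mem_cat Hy.
  have Hg : {subset leaves (enc_cform g) <= S} by move=> y Hy; apply: HS; rewrite /= cats0 mem_cat Hy orbT.
  by ps; rewrite (IHf S _ rho i th) // (IHg S _ rho i th).
- have Hf : {subset leaves (enc_cform f) <= S} by move=> y Hy; apply: HS; rewrite /= mem_cat Hy.
  by ps; rewrite (IHf S _ rho i th).
- have Hf : {subset leaves (enc_cform f) <= S} by move=> y Hy; apply: HS; rewrite /= mem_cat Hy.
  have [_ _ _ Hi _] := Ht.
  ps; upds; rewrite Hi addn1 (IHf S _ rho i.+1 th) //.
  by apply: tracks_pos1 Ht.
- have Hf : {subset leaves (enc_cform f) <= S} by move=> y Hy; apply: HS; rewrite /= mem_cat Hy.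
  have Hg : {subset leaves (enc_cform g) <= S} by move=> y Hy; apply: HS; rewrite /= cats0 mem_cat Hy orbT.
  have [_ _ _ Hi _] := Ht.
  ps; split.
    case=> k; ps; upds; rewrite Hi (IHg S _ rho k th) //; last first.
      by apply: tracks_pos1 Ht.
    case=> ik [H Hk]; exists k; split=> //; split=> // j ij jk.
    apply: NNPP => Hn; apply: H; exists j; ps; upds.
    rewrite Hi; split=> //; split=> //; rewrite (IHf S _ rho j th) //.
    by apply: tracks_pos2 Ht.
  case=> k [ik [Hk H]]; exists k; ps; upds; rewrite Hi (IHg S _ rho k th) //; last first.
    by apply: tracks_pos1 Ht.
  split=> //; split=> //; case=> j; ps; upds; rewrite Hi (IHf S _ rho j th) //.
    by case=> ij [jk]; apply; apply: H.
  by apply: tracks_pos2 Ht.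
- have Hf : {subset leaves (enc_cform f) <= S} by move=> y Hy; apply: HS; rewrite /= mem_cat Hy.
  by apply: (fEP flatK Ht) => eta' rho' H'; apply: IHf H'.
- have Hf : {subset leaves (enc_cform f) <= S}.
    by move=> y Hy; apply: HS; rewrite /= inE mem_cat Hy orbT.
  have [H1 H2 H3 H4 H5] := Ht.
  rewrite psat_let; last by rewrite inE vU_vF.
  rewrite (IHf S _ rho i (upd th x i)) //; split=> //; try by upds.
    by move=> u s; rewrite -H2; apply: visits_ext => _ d Hd; upds.
  move=> y Hy; rewrite /upd vU_vU; case: eqP => _; last exact: H5.
  by rewrite /= mul1n.
- have Hf : {subset leaves (enc_cterm t) <= S} by move=> y Hy; apply: HS; rewrite /= mem_cat Hy.
  have Hg : {subset leaves (enc_cterm u) <= S} by move=> y Hy; apply: HS; rewrite /= cats0 mem_cat Hy orbT.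
  rewrite (fPairP _ Ht (fun e => IHt S e rho i th Hf) (fun e => IHu S e rho i th Hg)).
  rewrite /cLe; split.
    by case=> p1 [n1 [p2 [n2 []]]]; ps; upds; lia.
  (* Positive and negative part of each value. *)
  move=> H; exists (Z.to_nat (cteval K t rho i th)), (Z.to_nat (- cteval K t rho i th)),
    (Z.to_nat (cteval K u rho i th)), (Z.to_nat (- cteval K u rho i th)).
  by ps; upds; split; lia.
- by rewrite (@fSignedP _ _ _ 1) /= ?muln1 // Z.mul_1_r.
- have Hf : {subset leaves (enc_cform f) <= S}.
    by move=> y Hy; apply: HS; rewrite /= !inE mem_cat Hy !orbT.
  have [H1 H2 H3 H4 H5] := Ht.
  have Hx : eta (vU x) = th x by apply: H5; apply: HS; rewrite /= !inE eqxx orbT.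
  have Hc b z : psat (PAnd (PLe (PV (vU x)) (PV vy)) (PAnd (PLe (PV vy) (PV vi))
           (PLet vi (PV vy) (fT f)))) (upd (upd eta vz z) vy b) <->
     (th x <= b < i.+1 /\ csat K f rho b th).
    ps; upds; rewrite Hx H4 ltnS (IHf S _ rho b th) //.
      by split=> [[-> [-> H]]|[/andP[-> ->] H]].
    by apply: tracks_pos2 Ht.
  have Hn z : psat (PExCount vz vy (PAnd (PLe (PV (vU x)) (PV vy)) (PAnd (PLe (PV vy) (PV vi))
           (PLet vi (PV vy) (fT f))))) (upd eta vz z) <->
     z = \sum_(th x <= j < i.+1) ind (csat K f rho j th).
    rewrite -sum_ind_size psat_count upd_same; split=> -[s [U Z E]]; exists s; split=> // b.
      by rewrite E Hc.
    by rewrite E -(Hc b z).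
  ps; split.
    case=> z; rewrite psat_and Hn (fSignedP (n := z)) /=; upds => //.
    by case=> -> ->.
  move=> E; exists (\sum_(th x <= j < i.+1) ind (csat K f rho j th)).
  rewrite psat_and Hn (fSignedP (n := \sum_(th x <= j < i.+1) ind (csat K f rho j th))) /=; upds => //.
- have Hf : {subset leaves (enc_cterm t) <= S} by move=> y Hy; apply: HS; rewrite /= mem_cat Hy.
  have Hg : {subset leaves (enc_cterm u) <= S} by move=> y Hy; apply: HS; rewrite /= cats0 mem_cat Hy orbT.
  rewrite (fPairP _ Ht (fun e => IHt S e rho i th Hf) (fun e => IHu S e rho i th Hg)).
  rewrite /cPlus; split.
    by case=> p1 [n1 [p2 [n2 []]]]; ps; upds; lia.
  move=> H; exists (Z.to_nat (cteval K t rho i th)), (Z.to_nat (- cteval K t rho i th)),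
    (Z.to_nat (cteval K u rho i th)), (Z.to_nat (- cteval K u rho i th)).
  by ps; upds; split; lia.
Qed.

Fixpoint fZero (xs : seq nat) (g : pform) : pform :=
  match xs with
  | [::] => g
  | x :: xs => PEx (vU x) (PAnd (PLe (PV (vU x)) (PConst 0)) (fZero xs g))
  end.

Lemma fZeroP xs g eta : psat (fZero xs g) eta <->
  psat g (foldl (fun e x => upd e (vU x) 0) eta xs).
Proof.
elim: xs eta => [|x xs IH] eta //=; ps; rewrite -IH; split.
  by case=> b; ps; upds; rewrite leqn0 => -[/eqP ->].
by move=> H; exists 0; ps; upds.
Qed.

(** [models] asks for some position at which the run is in the initial state, not for position 0;
    hence the quantifier over [vi]. *)
Definition fTop (Phi : cform) : pform :=
  PLet vc (PConst (ks_init K))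
    (fZero (leaves (enc_cform Phi)) (fExi (ks_edges K) (PAnd (fValid (ks_edges K))
       (PEx vi (PAnd (PLet ti (PV vi) (PLet tv (PV vc) (fSt 0 (ks_edges K)))) (fT Phi)))))).

Lemma fTopP Phi : ph_satisfiable (fTop Phi) <-> models K Phi.
Proof.
have Z eta : foldl (fun e x => upd e (vU x) 0) eta (leaves (enc_cform Phi)) vc = eta vc /\
   forall x, x \in leaves (enc_cform Phi) ->
     foldl (fun e x => upd e (vU x) 0) eta (leaves (enc_cform Phi)) (vU x) = 0.
  elim: (leaves _) eta => [|y ys IH] eta //=; have [A B] := IH (upd eta (vU y) 0).
  split; first by rewrite A; upds.
  move=> x; rewrite inE => Hx; case E: (x \in ys); first exact: B.
  move: Hx; rewrite E orbF => /eqP ->.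
  elim: (ys) (upd eta _ _) (upd_same eta (vU y) 0) => //= z zs IHz e He; apply: IHz.
  by rewrite /upd He; case: ifP.
have T eta rho i : is_run K rho -> encodes K 0 eta rho -> eta vc = ks_init K ->
    (forall x, x \in leaves (enc_cform Phi) -> eta (vU x) = 0) ->
    tracks K (leaves (enc_cform Phi)) (upd eta vi i) rho i (fun _ => 0).
  move=> H1 H2 H3 H4; split=> //; try by upds.
  by move=> x /H4 <-; upds.
rewrite /fTop; split.
  case=> eta; ps; rewrite fZeroP.
  set eta1 := foldl _ _ _ => H.
  have [Zc Zx] : eta1 vc = ks_init K /\ forall x, x \in leaves (enc_cform Phi) -> eta1 (vU x) = 0.
    by have [A B] := Z (upd eta vc (ks_init K)); split=> //; rewrite /eta1 A; upds.
  move: H; rewrite fExiP => -[eta2 Hs]; ps => -[HV [i]]; ps; rewrite fStP // => -[HS HT].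
  have Hc : eta2 vc = ks_init K.
    by rewrite Hs // => d s Hd _; distinct_vars.
  have Hx x : x \in leaves (enc_cform Phi) -> eta2 (vU x) = 0.
    by move=> Hx; rewrite Hs ?Zx // => d s Hd _; distinct_vars.
  have [rho Hr He] := valid_run Hc HV.
  exists rho, i; split=> //; split.
    by move: HS; upds; rewrite !visits_upd // Hc; move/He.
  have [C _] := translation_correct.
  by apply/(C Phi (leaves (enc_cform Phi)) _ rho i (fun _ => 0) _ (T _ _ _ Hr He Hc Hx)).
case=> rho [i [Hr [Ei HT]]]; exists (fun _ => 0); ps; rewrite fZeroP.
set eta1 := foldl _ _ _.
have [Zc Zx] : eta1 vc = ks_init K /\ forall x, x \in leaves (enc_cform Phi) -> eta1 (vU x) = 0.
  by have [A B] := Z (upd (fun _ => 0) vc (ks_init K)); split=> //; rewrite /eta1 A; upds.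
have [gg Hgg] := run_encoding flatK Hr.
have [eta2 Hs Hg2] := same_off_exists (ks_edges K) eta1 gg.
have He := Hgg _ Hg2.
have Hc : eta2 vc = ks_init K.
  by rewrite Hs // => d s Hd _; distinct_vars.
have Hx x : x \in leaves (enc_cform Phi) -> eta2 (vU x) = 0.
  by move=> Hx; rewrite Hs ?Zx // => d s Hd _; distinct_vars.
rewrite fExiP; exists eta2 => //; ps; split; first exact: run_valid Hr He Hc.
exists i; ps; split.
  by rewrite fStP //; upds; rewrite !visits_upd // Hc; apply/He.
have [C _] := translation_correct.
by apply/(C Phi (leaves (enc_cform Phi)) _ rho i (fun _ => 0) _ (T _ _ _ Hr He Hc Hx)).
Qed.
End Translation.

(** * Templates *)

Definition emit (s : sym) : nat :=
  match s with SLeaf => 1 | SNode => 2 | SEnd => 3 | S0 => 4 | S1 => 5 end.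
Definition emits (g : nat) : bool := (0 < g) && (g < 6).

(* Registers: 0 input, 1 output, 2 agenda, 3 last number read, 4 scratch, 5 edges,
   6 labels, 7 source formula. Registers 1, 3, 5, 6 and 7 are filled by pushing,
   hence reversed. *)
Definition iPasteN := 6.
Definition iPasteN' := 7.
Definition iPasteE := 8.
Definition iPasteE' := 9.
Definition iPasteL := 10.
Definition iPasteL' := 11.
Definition iPasteP := 12.
Definition iPasteP' := 13.
Definition iDrop := 14.
Definition iRead := 15.
Definition iReadBits := 16.
Definition iSaveE := 17.
Definition iSaveE' := 18.
Definition iSaveL := 19.
Definition iSaveL' := 20.
Definition iSaveP := 21.
Definition iScan := 22.
Definition iClear := 23.
Definition iOut := 24.
Definition iLook (c : nat) := if c == 0 then 25 else 26.
Definition iMul := 27.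
Definition iEdge := 28.
Definition iCopy := 29.
Definition iExi := 30.
Definition iExiTop := 31.
Definition iLab := 32.
Definition iLabIn := 33.
Definition iF := 34.
Definition iConst := 35.
Definition iCoef := 36.
Definition iTag (i : nat) := 40 + i.

Definition lit (s : seq sym) : seq nat := map emit s.
Definition aT (t : tree) : seq nat := lit (ser t).
Definition aNode (k : nat) (ws : seq (seq nat)) : seq nat :=
  lit (SNode :: nat_bits k ++ [:: SEnd]) ++ flatten ws ++ lit [:: SEnd].
(** Writes the number whose digits, lowest first, are [w] followed by the number last read. This is
    all the arithmetic that variable names require. *)
Definition aLeafN (w : seq sym) : seq nat := lit (SLeaf :: w) ++ iPasteN :: lit [:: SEnd].

(** The five lowest digits of [vR c s]: 0, the three digits of [c], then 1. *)
Definition vtag (c : nat) : seq sym :=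
  let bit b := if b then S1 else S0 in
  [:: S0; bit (odd c); bit (odd c./2); bit (odd c./2./2); S1].

Notation aF f := (aT (enc_pform f)).
Notation aP t := (aT (enc_pterm t)).
Notation aX n := (aT (Leaf n)).
Notation aConstN := (aNode 0 [:: aLeafN [::]]).
Notation aPV v := (aNode 1 [:: aX 1; v]).
Notation aPlus s t := (aNode 2 [:: s; t]).
Notation aLe s t := (aNode 0 [:: s; t]).
Notation aNot w := (aNode 1 [:: w]).
Notation aAnd v w := (aNode 2 [:: v; w]).
Notation aEx x w := (aNode 3 [:: x; w]).
Notation aExCount x y w := (aNode 4 [:: x; y; w]).
Notation aEq s t := (aAnd (aLe s t) (aLe t s)).
Notation aOr v w := (aNot (aAnd (aNot v) (aNot w))).
Notation aLet x t w := (aEx x (aAnd (aEq (aPV x) t) w)).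

Definition wFalse := aF PFalse.

(** The enclosing fold has consumed the [SNode] of the edge. Its tag 0 has no digits, so the two
    drops remove the end of the tag and the [SLeaf] of the source. The target is read at the end
    merely to skip it. *)
Definition wLook (c : nat) : seq nat :=
  iDrop :: iDrop :: iRead ::
  aOr (aAnd (aEq (aP (PV tv)) aConstN)
        (aAnd (aEq (aP (PV vf)) (aPV (aLeafN (vtag c))))
           (aAnd (aEq (aP (PV vl)) (aPV (aLeafN (vtag c.+1))))
                 (aEq (aP (PV vp)) (aPV (aLeafN (vtag c.+2)))))))
      [:: iDrop; iRead; iDrop; iLook c].

Definition wMul : seq nat :=
  iDrop :: iDrop :: iRead :: iDrop :: iRead :: iDrop ::
  aEx (aX vp1) (aEx (aX vm1) (aAnd (aF fStep)
    (aLet (aX vp) (aP (PV vp1)) (aLet (aX vm) (aP (PV vm1)) [:: iMul])))).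

Definition wMul0 : seq nat := aF (fMul [::]).

Definition wEdge : seq nat :=
  iDrop :: iDrop :: iRead ::
  aOr (aAnd (aEq (aP (PV va)) aConstN)
            (iDrop :: iRead :: iDrop :: aEq (aP (PV vb)) aConstN))
      [:: iEdge].

Definition wCopy : seq nat :=
  iDrop :: iDrop :: iRead ::
  aLet (aLeafN (vtag 3)) (aPV (aLeafN (vtag 0)))
    (aLet (aLeafN (vtag 4)) (aPV (aLeafN (vtag 1)))
      (aLet (aLeafN (vtag 5)) (aPV (aLeafN (vtag 2))) [:: iDrop; iRead; iDrop; iCopy])).

Definition wExi (i : nat) : seq nat :=
  iDrop :: iDrop :: iRead ::
  aEx (aLeafN (vtag 0)) (aEx (aLeafN (vtag 1)) (aEx (aLeafN (vtag 2)) [:: iDrop; iRead; iDrop; i])).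

Definition wSt (c : nat) : seq nat :=
  aEx (aX vf) (aEx (aX vl) (aEx (aX vp) (aAnd [:: iPasteE; iLook c]
    (aEx (aX vq) (aEx (aX vm) (aAnd [:: iPasteE; iMul]
      (aF (PAnd (PEq (PV ti) (PPlus (PV vf) (PV vm)))
             (PNot (PAnd (PLe (PConst 1) (PV vl)) (PLe (PV vl) (PV ti)))))))))))).

Definition wAt (c : nat) (t v : pterm) : seq nat :=
  aLet (aX ti) (aP t) (aLet (aX tv) (aP v) (wSt c)).

Definition wValid : seq nat :=
  aAnd (wAt 0 (PConst 0) (PV vc))
    (aAnd (aNot (aEx (aX vu) (aNot (aEx (aX va) (aEx (aX vb)
             (aAnd (wAt 0 (PV vu) (PV va))
               (aAnd (wAt 0 (PPlus (PV vu) (PConst 1)) (PV vb)) [:: iPasteE; iEdge])))))))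
          (aNot (aEx (aX vu) (aEx (aX va) (aEx (aX vb) (aAnd (aF (PLt (PV va) (PV vb)))
             (aAnd (wAt 0 (PV vu) (PV va)) (wAt 0 (PV vu) (PV vb))))))))).

Definition wAgree : seq nat :=
  aNot (aEx (aX vu) (aEx (aX va) (aAnd (aF (PLe (PV vu) (PV vi)))
    (aAnd (wAt 0 (PV vu) (PV va)) (aNot (wAt 3 (PV vu) (PV va))))))).

Definition wBody : seq nat := aAnd wValid (aAnd wAgree [:: iF]).

Definition wTopBody : seq nat :=
  aAnd wValid (aEx (aX vi) (aAnd (aLet (aX ti) (aP (PV vi)) (aLet (aX tv) (aP (PV vc)) (wSt 0))) [:: iF])).

Definition wLab : seq nat :=
  iDrop :: aOr (aAnd (aF (PEq (PV tv) (PConst 0))) [:: iLabIn])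
     (aEx (aX vw) (aAnd (aF (PEq (PV tv) (PPlus (PV vw) (PConst 1))))
                        (aLet (aX tv) (aP (PV vw)) [:: iLab]))).

Definition wLabIn : seq nat := iRead :: aOr (aEq (aP (PV vx)) aConstN) [:: iLabIn].

Definition wScan : seq nat :=
  iRead :: aEx (aLeafN [:: S1]) (aAnd (aLe (aPV (aLeafN [:: S1])) (aP (PConst 0))) [:: iScan]).

(** The sign is the node tag, and the symbol that selects the template is already consumed: the end
    of the tag for tag 0, the digit for tag 1. In the latter case one more symbol remains to be
    dropped. *)
Definition wPos (t : seq nat) : seq nat :=
  iDrop :: iRead :: iDrop :: aEq (aP (PV vP)) (aPlus (aP (PV vN)) t).
Definition wNeg (t : seq nat) : seq nat :=
  iDrop :: iDrop :: iRead :: iDrop :: aEq (aPlus (aP (PV vP)) t) (aP (PV vN)).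

Definition wPair (c : pform) : seq nat :=
  aEx (aX vP1) (aEx (aX vN1) (aEx (aX vP2) (aEx (aX vN2) (aAnd (aF c)
    (aAnd (aLet (aX vP) (aP (PV vP1)) (aLet (aX vN) (aP (PV vN1)) [:: iF]))
          (aLet (aX vP) (aP (PV vP2)) (aLet (aX vN) (aP (PV vN2)) [:: iF]))))))).

Definition wAP : seq nat :=
  aLet (aX vx) aConstN (aEx (aX tv) (aAnd (aLet (aX ti) (aP (PV vi)) (wSt 0)) [:: iPasteL; iLab])).

Definition wNext : seq nat :=
  aLet (aX vw) (aP (PPlus (PV vi) (PConst 1))) (aLet (aX vi) (aP (PV vw)) [:: iF]).

Definition wBind : seq nat :=
  iDrop :: iRead :: aLet (aLeafN [:: S1]) (aP (PV vi)) [:: iF].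

Definition wU : seq nat :=
  aEx (aX vk) (aAnd (aF (PLe (PV vi) (PV vk)))
        (aAnd (aNot (aEx (aX vj) (aAnd (aF (PLe (PV vi) (PV vj))) (aAnd (aF (PLt (PV vj) (PV vk)))
                 (aNot (aLet (aX vi) (aP (PV vj)) [:: iF]))))))
              (aLet (aX vi) (aP (PV vk)) [:: iF]))).

Definition wCoef : seq nat := [:: iDrop; iCoef].
Definition wCount : seq nat :=
  aEx (aX vz) (aAnd wCoef
     (iDrop :: iRead :: aExCount (aX vz) (aX vy) (aAnd (aLe (aPV (aLeafN [:: S1])) (aP (PV vy)))
        (aAnd (aF (PLe (PV vy) (PV vi))) (aLet (aX vi) (aP (PV vy)) [:: iF]))))).

(* Node tags 0..10 are read least significant bit first; index [i] is the
   prefix read so far, preceded by a leading 1. *)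
Definition wNode (i : nat) : seq nat :=
  match i with
  | 1 => iDrop :: iRead :: wAP
  | 3 => aAnd [:: iF] [:: iF]
  | 5 => aNot [:: iF]
  | 7 => wNext
  | 9 => wU
  | 13 => [:: iPasteE; iCopy]
  | 11 => wBind
  | 15 => wPair cLe
  | 17 => [:: iDrop; iConst]
  | 25 => wCount
  | 21 => wPair cPlus
  | _ => [::]
  end ++ [:: iDrop].

(** Once everything is saved, the formula is pasted back and scanned for leaves before it is
    translated. The last two items empty register 0 and move the output there, which also undoes its
    reversal. *)
Definition wInit : seq nat :=
  iDrop :: iDrop :: iDrop :: iDrop :: iDrop :: iRead :: iDrop :: iRead ::
  aLet (aX vc) aConstN
    [:: iDrop; iDrop; iSaveE; iDrop; iDrop; iSaveL; iDrop; iSaveP; iPasteP; iScan]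
  ++ [:: iClear; iOut].

Notation action := (nat * (option sym -> seq (nat * sym) * seq nat))%type.

Definition onI (f : option sym -> seq nat) : action := (0, fun o => ([::], f o)).
Definition fold (step base : seq nat) : action :=
  onI (fun o => match o with Some SNode => step | Some SEnd => base | _ => [::] end).
(** Popping the reversed register onto the input restores the order; the second copy, on the scratch
    register, refills [r] afterwards. *)
Definition paste (r g g' : nat) : action :=
  (r, fun o => if o is Some s then ([:: (0, s); (4, s)], [:: g]) else ([::], [:: g'])).
Definition restore (r g' : nat) : action :=
  (4, fun o => if o is Some s then ([:: (r, s)], [:: g']) else ([::], [::])).
(** After the tag of a node, [g] runs twice: for the children, up to the closing [SEnd], and for the
    siblings that follow. *)
Definition save (r g g' : nat) : action :=
  (0, fun o => match o with
    | Some SLeaf => ([:: (r, SLeaf)], [:: g'; g])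
    | Some SNode => ([:: (r, SNode)], [:: g'; g; g])
    | Some SEnd => ([:: (r, SEnd)], [::])
    | _ => ([::], [::]) end).
Definition saveBits (r g' : nat) : action :=
  (0, fun o => match o with
    | Some S0 => ([:: (r, S0)], [:: g'])
    | Some S1 => ([:: (r, S1)], [:: g'])
    | Some SEnd => ([:: (r, SEnd)], [::])
    | _ => ([::], [::]) end).
(** Every action pops some register; the scratch register is empty whenever output is written. *)
Definition output (s : sym) : action := (4, fun _ => ([:: (1, s)], [::])).
Definition idle : action := (4, fun _ => ([::], [::])).

Definition table : seq action := [::
  (4, fun _ => ([::], wInit));
  output SLeaf; output SNode; output SEnd; output S0; output S1;
  (3, fun o => if o is Some s then ([:: (4, s)], [:: iPasteN]) else ([::], [:: iPasteN']));
  (4, fun o => if o is Some s then ([:: (1, s); (3, s)], [:: iPasteN']) else ([::], [::]));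
  paste 5 iPasteE iPasteE'; restore 5 iPasteE';
  paste 6 iPasteL iPasteL'; restore 6 iPasteL';
  paste 7 iPasteP iPasteP'; restore 7 iPasteP';
  onI (fun _ => [::]);
  (3, fun o => ([::], [:: if o is Some _ then iRead else iReadBits]));
  (0, fun o => match o with
               | Some S0 => ([:: (3, S0)], [:: iReadBits])
               | Some S1 => ([:: (3, S1)], [:: iReadBits])
               | _ => ([::], [::]) end);
  save 5 iSaveE iSaveE'; saveBits 5 iSaveE';
  save 6 iSaveL iSaveL'; saveBits 6 iSaveL';
  (0, fun o => if o is Some s then ([:: (7, s)], [:: iSaveP]) else ([::], [::]));
  onI (fun o => match o with None => [:: iPasteP; iPasteE; iExiTop]
                           | Some SLeaf => wScan | Some _ => [:: iScan] end);
  onI (fun o => if o is Some _ then [:: iClear] else [::]);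
  (1, fun o => if o is Some s then ([:: (0, s)], [:: iOut]) else ([::], [::]));
  fold (wLook 0) wFalse; fold (wLook 3) wFalse;
  fold wMul wMul0; fold wEdge wFalse;
  fold wCopy [:: iPasteE; iExi]; fold (wExi iExi) wBody; fold (wExi iExiTop) wTopBody;
  fold wLab wFalse;
  onI (fun o => match o with Some SLeaf => wLabIn | Some SEnd => wFalse | _ => [::] end);
  onI (fun _ => [:: iTag 1]);
  onI (fun o => match o with Some SEnd => wPos aConstN | Some _ => wNeg aConstN | _ => [::] end);
  onI (fun o => match o with Some SEnd => wPos (aNode 1 [:: aLeafN [::]; aX vz])
                           | Some _ => wNeg (aNode 1 [:: aLeafN [::]; aX vz]) | _ => [::] end)].

Definition act (g : nat) : action :=
  if g < 40 then nth idle table g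
  else if g < 72 then
    onI (fun o => match o with
      | Some S0 => [:: iTag (2 * (g - 40))]
      | Some S1 => [:: iTag (2 * (g - 40)).+1]
      | Some SEnd => wNode (g - 40)
      | _ => [::] end)
  else idle.

Lemma act_cases (P : action -> Prop) : (forall a, List.In a table -> P a) -> P idle ->
  (forall g, 40 <= g < 72 -> P (act g)) -> forall g, P (act g).
Proof.
move=> H1 H2 H3 g; case: (ltnP g 40) => Hg; last first.
  case: (ltnP g 72) => Hg'; first by apply: H3; rewrite Hg.
  by rewrite /act ltnNge Hg /= ltnNge Hg'.
rewrite /act Hg; case: (ltnP g (size table)) => Hs; last by rewrite nth_default.
apply: H1; elim: (table) g Hs {Hg} => // a s IH [|g] /= Hs; first by left.
by right; apply: IH.
Qed.

Lemma act_reg g : reg_fine 8 (act g).1.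
Proof.
apply: (act_cases (P := fun a => reg_fine 8 a.1)) => [a|//|{}g /andP[H1 H2]].
  rewrite /table; do 37! (case=> [<- //|]); by [].
by rewrite /act ltnNge H1 H2.
Qed.

Lemma act_push g o : all (fun p => reg_fine 8 p.1) ((act g).2 o).1.
Proof.
move: o; apply: (act_cases (P := fun a => forall o, all (fun p => reg_fine 8 p.1) (a.2 o).1)) => [a|//|{}g /andP[H1 H2]].
  by rewrite /table; do 37! (case=> [<- o|]; first by case: o => [[]|]).
by rewrite /act ltnNge H1 H2 => -[[]|].
Qed.

(** The largest item is [iTag 63], numbered 103; 127 is a convenient bound above it. *)
Lemma act_items g o : all (fun g => g <= 127) ((act g).2 o).2.
Proof.
move: o; apply: (act_cases (P := fun a => forall o, all (fun g => g <= 127) (a.2 o).2)) => [a|//|{}g /andP[H1 H2]].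
  by rewrite /table; do 37! (case=> [<- o|]; first by case: o => [[]|]; vm_compute).
rewrite /act ltnNge H1 H2 => -[[]|] //=; rewrite /iTag; try lia.
(* [wNode] has explicit entries up to index 25; beyond that only the default remains. *)
by move: (g - 40) => i; do 26! (case: i => [|i]; first by vm_compute); vm_compute.
Qed.

Lemma act_emits g o : emits g -> ((act g).2 o).2 = [::].
Proof. by case: g => [|[|[|[|[|[|g]]]]]]. Qed.

(** * Execution of templates *)

Definition bits_only : pred (seq sym) := all (fun s => match s with S0 | S1 => true | _ => false end).

Lemma pos_bits_only p : bits_only (pos_bits p).
Proof. by elim: p. Qed.
Lemma nat_bits_only n : bits_only (nat_bits n).
Proof. by rewrite /nat_bits; case: N.of_nat => //; apply: pos_bits_only. Qed.

Lemma nat_bits_even n : 0 < n -> nat_bits (2 * n) = S0 :: nat_bits n.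
Proof.
move=> Hn; rewrite /nat_bits; have -> : N.of_nat (2 * n) = N.double (N.of_nat n) by exact: (Nnat.Nat2N.inj_double n).
case E: (N.of_nat n) => //.
by move: (Nnat.Nat2N.id n) Hn; rewrite E => <-.
Qed.
Lemma nat_bits_odd n : nat_bits (2 * n + 1) = S1 :: nat_bits n.
Proof.
rewrite /nat_bits; have -> : N.of_nat (2 * n + 1) = N.succ_double (N.of_nat n).
  by rewrite addn1; exact: (Nnat.Nat2N.inj_succ_double n).
by case: N.of_nat.
Qed.

Lemma nat_bits_vU x : nat_bits (vU x) = [:: S1] ++ nat_bits x.
Proof. exact: nat_bits_odd. Qed.

Lemma nat_bits_vR c s : c < 8 -> nat_bits (vR c s) = vtag c ++ nat_bits s.
Proof.
pose bit (b : bool) : nat := b.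
have E b n : 0 < n -> nat_bits (2 * n + bit b) = (if b then S1 else S0) :: nat_bits n.
  by case: b => Hn; rewrite /bit ?nat_bits_odd // addn0 nat_bits_even.
move=> Hc.
have -> : vR c s = 2 * (2 * (2 * (2 * (2 * s + 1) + bit (odd c./2./2)) + bit (odd c./2)) + bit (odd c)) + bit false.
  by rewrite /vR /bit; lia.
by rewrite !E ?nat_bits_odd ?addn_gt0 ?muln_gt0 ?addn_gt0 ?orbT.
Qed.

Definition state := (seq sym * seq sym * (seq sym * seq sym * seq sym))%type.
Definition regs (s : state) (O : seq sym) : seq (seq sym) :=
  let: (i, N, (e, l, p)) := s in [:: i; O; [::]; N; [::]; e; l; p].
Definition num (s : state) : seq sym := s.1.2.

Local Notation wrun := (wsteps act emits).

(* Clearing the number register is paid for when the number is loaded, hence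
   the size of that register as a potential. *)
Definition ev (w : seq nat) (s : state) (o : seq sym) (s' : state) (c : nat) : Prop :=
  forall O W, exists2 k, k + size (num s') <= c + size (num s) &
    wrun (regs s O, w ++ W) (regs s' (rev o ++ O), W) k.

Definition gen w s t s' c := ev w s (ser t) s' c.

Lemma ev_cat w1 w2 s o1 s1 o2 s2 c1 c2 :
  ev w1 s o1 s1 c1 -> ev w2 s1 o2 s2 c2 -> ev (w1 ++ w2) s (o1 ++ o2) s2 (c1 + c2).
Proof.
move=> H1 H2 O W; have [k1 Hk1 R1] := H1 O (w2 ++ W); have [k2 Hk2 R2] := H2 (rev o1 ++ O) W.
exists (k1 + k2); first by lia.
by rewrite -catA rev_cat -catA; apply: wsteps_trans R1 R2.
Qed.

Lemma ev_le w s o s' c c' : ev w s o s' c -> c <= c' -> ev w s o s' c'.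
Proof. by move=> H Hc O W; have [k Hk R] := H O W; exists k => //; lia. Qed.

Lemma wrun1 rs g W c k : wrun (perform act rs g W) c k -> wrun (rs, g :: W) c (~~ emits g + k).
Proof. exact: wsteps_step. Qed.

Lemma ev_nil s : ev [::] s [::] s 0.
Proof. by move=> O W; exists 0 => //; apply: wsteps_refl. Qed.

Lemma ev_lit o s : ev (lit o) s o s 0.
Proof.
elim: o => [|a o IH]; first exact: ev_nil.
move=> O W; have [k Hk R] := IH (a :: O) W; exists k => //.
rewrite rev_cons cat_rcons.
have -> : k = ~~ emits (emit a) + k by case: (a).
apply: wrun1; move: R; case: s {IH Hk} => [[I N] [[e l] p]].
by case: a.
Qed.

Lemma ev_onI g f a I N m o s' c : act g = onI f -> ~~ emits g ->
  ev (f (Some a)) (I, N, m) o s' c -> ev [:: g] (a :: I, N, m) o s' c.+1.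
Proof.
move=> Hg He H O W; have [k Hk R] := H O W; exists k.+1; first by rewrite addSn.
rewrite -[k.+1]/(true + k) -He; apply: wrun1; move: R.
by case: m {H Hk} => [[e l] p]; rewrite /perform Hg.
Qed.

Lemma ev_drop a I N m w o s' c : ev w (I, N, m) o s' c -> ev (iDrop :: w) (a :: I, N, m) o s' c.+1.
Proof.
move=> H; rewrite -[iDrop :: w]/([:: iDrop] ++ w) -[o]/([::] ++ o) -add1n.
by apply: ev_cat H; apply: ev_onI (ev_nil _).
Qed.

Lemma ev_read b I N m w o s' c : bits_only b -> ev w (I, rev b, m) o s' c ->
  ev (iRead :: w) (b ++ SEnd :: I, N, m) o s' (c + 2 * size b + 2).
Proof.
move=> Hb H O W; have [k Hk R] := H O W.
(* Clearing the old number is covered by the potential; each new digit costs 1 for reading and 1 set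
   aside for its own clearing. *)
exists (size N + 1 + (size b + 1 + k)); first by move: Hk; rewrite /num /= size_rev; lia.
move: R; rewrite /=; case: m {H Hk} => [[e l] p] R; rewrite /=.
have aux N' : wrun ([:: I; O; [::]; rev b ++ N'; [::]; e; l; p], w ++ W) (regs s' (rev o ++ O), W) k ->
    wrun ([:: b ++ SEnd :: I; O; [::]; N'; [::]; e; l; p], iReadBits :: w ++ W)
      (regs s' (rev o ++ O), W) (size b + 1 + k).
  elim: b Hb N' {R} => [|a b IH] /= Hb N' R.
    by rewrite add0n; apply: (wrun1 (g := iReadBits)).
  case/andP: Hb => Ha Hb; rewrite addSn.
  rewrite rev_cons cat_rcons in R; have {}R := IH Hb _ R.
  by apply: (wrun1 (g := iReadBits)); case: a Ha R.
have {}R : wrun ([:: b ++ SEnd :: I; O; [::]; [::]; [::]; e; l; p], iReadBits :: w ++ W)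
      (regs s' (rev o ++ O), W) (size b + 1 + k) by apply: aux; rewrite cats0.

elim: N => [|a N IH]; first by rewrite add0n; apply: (wrun1 (g := iRead)).
by rewrite /= 2!addSn; apply: (wrun1 (g := iRead)).
Qed.

(** Moving the digits to the scratch register brings the first one to the top; moving them back
    writes them in order and keeps the number for further use. *)
Lemma ev_pasteN b I m : ev [:: iPasteN] (I, rev b, m) b (I, rev b, m) (2 * size b + 2).
Proof.
move=> O W; case: m => [[e l] p]; exists (size b + 1 + (size b + 1)); first by rewrite /=; lia.
rewrite /=.
have H2 (t N' O' : seq sym) : wrun ([:: I; O'; [::]; N'; t; e; l; p], iPasteN' :: W)
    ([:: I; rev t ++ O'; [::]; rev t ++ N'; [::]; e; l; p], W) (size t + 1).
  elim: t N' O' => [|a t IH] N' O'.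
    by apply: (wrun1 (g := iPasteN')); apply: wsteps_refl.
  by rewrite !rev_cons !cat_rcons /= addSn; apply: (wrun1 (g := iPasteN')); apply: IH.
have {}H2 := H2 b [::] O; rewrite cats0 in H2.
have H1 r t k : wrun ([:: I; O; [::]; [::]; rev r ++ t; e; l; p], iPasteN' :: W)
      ([:: I; rev b ++ O; [::]; rev b; [::]; e; l; p], W) k ->
    wrun ([:: I; O; [::]; r; t; e; l; p], iPasteN :: W)
      ([:: I; rev b ++ O; [::]; rev b; [::]; e; l; p], W) (size r + 1 + k).
  elim: r t => [|a r IH] t H; first by apply: (wrun1 (g := iPasteN)).
  rewrite rev_cons cat_rcons in H.
  by rewrite /= !addSn; apply: (wrun1 (g := iPasteN)); apply: IH.
by have := H1 (rev b) [::] (size b + 1); rewrite size_rev; apply; rewrite revK cats0.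
Qed.

Lemma paste_run (r g g' : nat) (rs : seq sym -> seq sym -> seq sym -> seq (seq sym)) :
  act g = paste r g g' -> act g' = restore r g' -> ~~ emits g -> ~~ emits g' ->
  (forall i t x, nth [::] (rs i t x) r = x /\
     forall x', set_nth [::] (rs i t x) r x' = rs i t x') ->
  (forall i t x, nth [::] (rs i t x) 4 = t /\
     forall t', set_nth [::] (rs i t x) 4 t' = rs i t' x) ->
  (forall i t x, nth [::] (rs i t x) 0 = i /\
     forall i', set_nth [::] (rs i t x) 0 i' = rs i' t x) ->
  forall i x W, wrun (rs i [::] x, g :: W) (rs (rev x ++ i) [::] x, W) (2 * size x + 2).
Proof.
move=> Hg Hg' Eg Eg' Hr H4 H0 i x W.
have H2 t x' : wrun (rs (rev x ++ i) t x', g' :: W) (rs (rev x ++ i) [::] (rev t ++ x'), W) (size t + 1).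
  elim: t x' => [|a t IH] x'.
    rewrite add0n -[1]/(true + 0) -Eg'; apply: wrun1.
    rewrite /perform Hg' /= (H4 _ _ _).1 /= (H4 _ _ _).2; exact: wsteps_refl.
  rewrite /= addSn rev_cons cat_rcons -[_.+1]/(true + (size t + 1)) -Eg'; apply: wrun1.
  rewrite /perform Hg' /= (H4 _ _ _).1 /= (H4 _ _ _).2 /push_on /= (Hr _ _ _).1 (Hr _ _ _).2.
  exact: IH.
have H1 y i' t k : wrun (rs (rev y ++ i') (rev y ++ t) [::], g' :: W) (rs (rev x ++ i) [::] x, W) k ->
    wrun (rs i' t y, g :: W) (rs (rev x ++ i) [::] x, W) (size y + 1 + k).
  elim: y i' t => [|a y IH] i' t R.
    rewrite add0n addnC addn1 -[_.+1]/(true + k) -Eg; apply: wrun1.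
    by rewrite /perform Hg /= (Hr _ _ _).1 /= (Hr _ _ _).2.
  rewrite /= !addSn -[_.+1]/(true + (size y + 1 + k)) -Eg; apply: wrun1.
  rewrite /perform Hg /= (Hr _ _ _).1 /= (Hr _ _ _).2 /push_on /= (H0 _ _ _).1 (H0 _ _ _).2.
  rewrite (H4 _ _ _).1 (H4 _ _ _).2.
  by apply: IH; rewrite !rev_cons !cat_rcons in R.
have -> : 2 * size x + 2 = size x + 1 + (size x + 1) by lia.
apply: H1; rewrite cats0.
by have := H2 (rev x) [::]; rewrite revK cats0 size_rev.
Qed.

Lemma ev_pasteE i N e l p :
  ev [:: iPasteE] (i, N, (e, l, p)) [::] (rev e ++ i, N, (e, l, p)) (2 * size e + 2).
Proof.
move=> O W; exists (2 * size e + 2) => //.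
by apply: (paste_run (r := 5) (g' := iPasteE') (rs := fun i t x => [:: i; O; [::]; N; t; x; l; p])).
Qed.

Lemma ev_pasteL i N e l p :
  ev [:: iPasteL] (i, N, (e, l, p)) [::] (rev l ++ i, N, (e, l, p)) (2 * size l + 2).
Proof.
move=> O W; exists (2 * size l + 2) => //.
by apply: (paste_run (r := 6) (g' := iPasteL') (rs := fun i t x => [:: i; O; [::]; N; t; e; x; p])).
Qed.

Lemma ev_pasteP i N e l p :
  ev [:: iPasteP] (i, N, (e, l, p)) [::] (rev p ++ i, N, (e, l, p)) (2 * size p + 2).
Proof.
move=> O W; exists (2 * size p + 2) => //.
by apply: (paste_run (r := 7) (g' := iPasteP') (rs := fun i t x => [:: i; O; [::]; N; t; e; l; x])).
Qed.

Lemma gen_T t s : gen (aT t) s t s 0.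
Proof. exact: ev_lit. Qed.

Lemma gen_LeafN w n n' i m : nat_bits n' = w ++ nat_bits n ->
  gen (aLeafN w) (i, rev (nat_bits n), m) (Leaf n') (i, rev (nat_bits n), m) (2 * size (nat_bits n) + 2).
Proof.
move=> E; rewrite /gen /= E -catA -cat_cons -[_ + _]add0n.
apply: ev_cat; first exact: ev_lit.
rewrite -[_ + _]addn0; apply: (ev_cat (w1 := [:: iPasteN])); first exact: ev_pasteN.
exact: ev_lit.
Qed.

Inductive gens : seq (seq nat) -> state -> seq tree -> state -> nat -> Prop :=
| gens_nil s : gens [::] s [::] s 0
| gens_cons w ws s t s1 ts s2 c1 c2 : gen w s t s1 c1 -> gens ws s1 ts s2 c2 ->
    gens (w :: ws) s (t :: ts) s2 (c1 + c2).

Lemma ev_gens ws s ts s' c : gens ws s ts s' c ->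
  ev (flatten ws) s (flatten (map ser ts)) s' c.
Proof.
elim=> [?|? ? ? ? ? ? ? ? ? H1 _ IH] /=; first exact: ev_nil.
exact: ev_cat H1 IH.
Qed.

Lemma gen_Node k ws s ts s' c : gens ws s ts s' c -> gen (aNode k ws) s (Node k ts) s' c.
Proof.
move=> H; rewrite /gen /= -[c]add0n.
have -> : SNode :: nat_bits k ++ SEnd :: flatten [seq ser i | i <- ts] ++ [:: SEnd] =
   (SNode :: nat_bits k ++ [:: SEnd]) ++ flatten [seq ser i | i <- ts] ++ [:: SEnd].
  by rewrite /= -catA.
apply: ev_cat; first exact: ev_lit.
by rewrite -[c]addn0; apply: ev_cat (ev_gens H) (ev_lit _ _).
Qed.

Lemma gen_le w s t s' c c' : gen w s t s' c -> c <= c' -> gen w s t s' c'.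
Proof. exact: ev_le. Qed.

Lemma gen_drop a i N m w t s' c : gen w (i, N, m) t s' c -> gen (iDrop :: w) (a :: i, N, m) t s' c.+1.
Proof. exact: ev_drop. Qed.
Lemma gen_read n i N m w t s' c : gen w (i, rev (nat_bits n), m) t s' c ->
  gen (iRead :: w) (nat_bits n ++ SEnd :: i, N, m) t s' (c + 2 * size (nat_bits n) + 2).
Proof. by apply: ev_read; apply: nat_bits_only. Qed.
Lemma gen_mode g f a i N m t s' c : act g = onI f -> ~~ emits g ->
  gen (f (Some a)) (i, N, m) t s' c -> gen [:: g] (a :: i, N, m) t s' c.+1.
Proof. exact: ev_onI. Qed.
Lemma gen_fold_step g step base i N m t s' c : act g = fold step base -> ~~ emits g ->
  gen step (i, N, m) t s' c -> gen [:: g] (SNode :: i, N, m) t s' c.+1.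
Proof. by move=> H E G; apply: (gen_mode (a := SNode) H E G). Qed.
Lemma gen_fold_base g step base i N m t s' c : act g = fold step base -> ~~ emits g ->
  gen base (i, N, m) t s' c -> gen [:: g] (SEnd :: i, N, m) t s' c.+1.
Proof. by move=> H E G; apply: (gen_mode (a := SEnd) H E G). Qed.

Ltac gstep :=
  lazymatch goal with
  | |- gens [::] _ _ _ _ => apply: gens_nil
  | |- gens (_ :: _) _ _ _ _ => eapply gens_cons
  | |- gen (aT _) _ _ _ _ => apply: gen_T
  | |- gen (aNode _ _) _ _ _ _ => eapply gen_Node
  | |- gen (aLeafN _) _ _ _ _ =>
      eapply gen_LeafN; first [exact: nat_bits_vR | exact: nat_bits_vU | reflexivity]
  | |- gen (iDrop :: _) _ _ _ _ => eapply gen_drop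
  | |- gen (iRead :: _) _ _ _ _ => eapply gen_read
  | |- gen _ _ _ _ _ => eassumption
  end.
Ltac gsolve := repeat gstep.

(** * Templates that pass over the lists of edges and labels *)

Definition enc_edge (e : nat * nat) : tree := Node 0 [:: Leaf e.1; Leaf e.2].
Definition enc_label (l : seq nat) : tree := Node 0 (map Leaf l).
Definition body (ts : seq tree) : seq sym := flatten (map ser ts) ++ [:: SEnd].

Lemma body_edge e es i : body (map enc_edge (e :: es)) ++ i =
  SNode :: SEnd :: SLeaf :: nat_bits e.1 ++ SEnd :: SLeaf :: nat_bits e.2 ++ SEnd :: SEnd ::
  (body (map enc_edge es) ++ i).
Proof. by rewrite /body /=; do 8! (rewrite -?catA ?cats0 /=). Qed.
Lemma size_body_edge e es : size (body (map enc_edge (e :: es))) =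
  7 + size (nat_bits e.1) + size (nat_bits e.2) + size (body (map enc_edge es)).
Proof.
have := congr1 size (body_edge e es [::]); rewrite !cats0 => ->.
by do 8! (rewrite ?size_cat /=); lia.
Qed.

Definition last_edge (es : seq (nat * nat)) (N : seq sym) : seq sym :=
  foldl (fun _ e => rev (nat_bits e.2)) N es.

Section Folds.
Variable m : seq sym * seq sym * seq sym.

Lemma gen_look c es i N : (c == 0) || (c == 3) ->
  gen [:: iLook c] (body (map enc_edge es) ++ i, N, m) (enc_pform (fLook c es))
      (i, last_edge es N, m) (20 * size (body (map enc_edge es))).
Proof.
move=> Hc.
have Ha : act (iLook c) = fold (wLook c) wFalse by case/orP: Hc => /eqP ->.
have He : ~~ emits (iLook c) by case/orP: Hc => /eqP ->.
have H8 : c.+2 < 8 by case/orP: Hc => /eqP ->.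
have H81 : c.+1 < 8 by exact: ltnW.
have H80 : c < 8 by exact: ltnW.
elim: es N => [|e es IH] N.
  by apply: gen_le; first by apply: (gen_fold_base Ha He); apply: gen_T.
have {}IH := IH (rev (nat_bits e.2)).
rewrite body_edge size_body_edge; apply: gen_le.
  apply: (gen_fold_step Ha He); rewrite /wLook.
  gsolve.
by lia.
Qed.

Lemma gen_mul es i N :
  gen [:: iMul] (body (map enc_edge es) ++ i, N, m) (enc_pform (fMul es))
      (i, last_edge es N, m) (20 * size (body (map enc_edge es))).
Proof.
have Ha : act iMul = fold wMul wMul0 by [].
elim: es N => [|e es IH] N.
  by apply: gen_le; first by apply: (gen_fold_base Ha isT); apply: gen_T.
have {}IH := IH (rev (nat_bits e.2)).
rewrite body_edge size_body_edge; apply: gen_le.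
  by apply: (gen_fold_step Ha isT); rewrite /wMul; gsolve.
by lia.
Qed.

Lemma gen_edge es i N :
  gen [:: iEdge] (body (map enc_edge es) ++ i, N, m) (enc_pform (fEdge es))
      (i, last_edge es N, m) (20 * size (body (map enc_edge es))).
Proof.
have Ha : act iEdge = fold wEdge wFalse by [].
elim: es N => [|e es IH] N.
  by apply: gen_le; first by apply: (gen_fold_base Ha isT); apply: gen_T.
have {}IH := IH (rev (nat_bits e.2)).
rewrite body_edge size_body_edge; apply: gen_le.
  by apply: (gen_fold_step Ha isT); rewrite /wEdge; gsolve.
by lia.
Qed.

(** [g] is produced by the base case of the fold, inside the formula for the last edge; so its
    generation is a hypothesis and its cost is added once. *)
Lemma gen_copy es i N g s' c :
  gen [:: iPasteE; iExi] (i, last_edge es N, m) (enc_pform g) s' c ->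
  gen [:: iCopy] (body (map enc_edge es) ++ i, N, m) (enc_pform (fCopy es g)) s'
      (40 * size (body (map enc_edge es)) + c).
Proof.
have Ha : act iCopy = fold wCopy [:: iPasteE; iExi] by [].
elim: es N => [|e es IH] N H.
  by apply: gen_le; [apply: (gen_fold_base Ha isT); exact: H | rewrite /body /=; lia].
have {}IH := IH (rev (nat_bits e.2)) H.
rewrite body_edge size_body_edge; apply: gen_le.
  by apply: (gen_fold_step Ha isT); rewrite /wCopy; gsolve.
by lia.
Qed.

Lemma gen_exi x w es i N g s' c : act x = fold (wExi x) w -> ~~ emits x ->
  gen w (i, last_edge es N, m) (enc_pform g) s' c ->
  gen [:: x] (body (map enc_edge es) ++ i, N, m) (enc_pform (fExi es g)) s'
      (20 * size (body (map enc_edge es)) + c).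
Proof.
move=> Ha He; elim: es N => [|e es IH] N H.
  by apply: gen_le; [apply: (gen_fold_base Ha He); exact: H | rewrite /body /=; lia].
have {}IH := IH (rev (nat_bits e.2)) H.
rewrite body_edge size_body_edge; apply: gen_le.
  by apply: (gen_fold_step Ha He); rewrite /wExi; gsolve.
by lia.
Qed.

Definition last_leaf (l : seq nat) (N : seq sym) : seq sym :=
  foldl (fun _ q => rev (nat_bits q)) N l.
Definition last_label (ls : seq (seq nat)) (N : seq sym) : seq sym :=
  foldl (fun N l => last_leaf l N) N ls.

Lemma body_leaf q l i : body (map Leaf (q :: l)) ++ i =
  SLeaf :: nat_bits q ++ SEnd :: (body (map Leaf l) ++ i).
Proof. by rewrite /body /=; do 4! (rewrite -?catA /=). Qed.

Lemma body_label l ls i : body (map enc_label (l :: ls)) ++ i =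
  SNode :: SEnd :: body (map Leaf l) ++ (body (map enc_label ls) ++ i).
Proof. by rewrite /body /=; do 4! (rewrite -?catA /=). Qed.

Lemma gen_labIn l i N : gen [:: iLabIn] (body (map Leaf l) ++ i, N, m) (enc_pform (fLabIn l))
  (i, last_leaf l N, m) (20 * size (body (map Leaf l))).
Proof.
elim: l N => [|q l IH] N.
  apply: (gen_le (c := 1)); last by [].
  by apply: (gen_mode (a := SEnd) (g := iLabIn) erefl isT); exact: gen_T.
have {}IH := IH (rev (nat_bits q)).
have := congr1 size (body_leaf q l [::]); rewrite !cats0 body_leaf => ->.
apply: gen_le.
  apply: (gen_mode (a := SLeaf) (g := iLabIn) erefl isT).
  by rewrite /wLabIn; gsolve.
by rewrite /= size_cat /=; lia.
Qed.

Lemma gen_lab ls i N : gen [:: iLab] (body (map enc_label ls) ++ i, N, m) (enc_pform (fLab ls))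
  (i, last_label ls N, m) (20 * size (body (map enc_label ls))).
Proof.
have Ha : act iLab = fold wLab wFalse by [].
elim: ls N => [|l ls IH] N.
  by apply: gen_le; first by apply: (gen_fold_base Ha isT); apply: gen_T.
have {}IH := IH (last_leaf l N).
have HI := gen_labIn l (body (map enc_label ls) ++ i) N.
have := congr1 size (body_label l ls [::]); rewrite !cats0 body_label => ->.
apply: gen_le.
  by apply: (gen_fold_step Ha isT); rewrite /wLab; gsolve.
by rewrite /= size_cat /=; lia.
Qed.
End Folds.

Section Chunks.
Variables (es : seq (nat * nat)) (ls : seq (seq nat)) (p : seq sym).
Let E := body (map enc_edge es).
Let L := body (map enc_label ls).
Let m := (rev E, rev L, p).

Lemma gen_pasteE i N w t s' c : gen w (E ++ i, N, m) t s' c ->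
  gen (iPasteE :: w) (i, N, m) t s' (2 * size E + 2 + c).
Proof.
move=> H; rewrite /gen -[ser t]cat0s; apply: (ev_cat (w1 := [:: iPasteE])) H.
by have := ev_pasteE i N (rev E) (rev L) p; rewrite revK size_rev.
Qed.

Lemma gen_pasteL i N w t s' c : gen w (L ++ i, N, m) t s' c ->
  gen (iPasteL :: w) (i, N, m) t s' (2 * size L + 2 + c).
Proof.
move=> H; rewrite /gen -[ser t]cat0s; apply: (ev_cat (w1 := [:: iPasteL])) H.
by have := ev_pasteL i N (rev E) (rev L) p; rewrite revK size_rev.
Qed.

Lemma E_pos : 0 < size E.
Proof. by rewrite size_cat addn1. Qed.
Lemma L_pos : 0 < size L.
Proof. by rewrite size_cat addn1. Qed.

Lemma gen_St c i N : (c == 0) || (c == 3) ->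
  gen (wSt c) (i, N, m) (enc_pform (fSt c es)) (i, last_edge es (last_edge es N), m) (48 * size E).
Proof.
move=> Hc.
have H1 := gen_pasteE (gen_look m es i N Hc).
have H2 := gen_pasteE (gen_mul m es i (last_edge es N)).
apply: gen_le; first by rewrite /wSt; gsolve.
by have := E_pos; rewrite -/E; lia.
Qed.

Lemma gen_At c i N t v : (c == 0) || (c == 3) ->
  gen (wAt c t v) (i, N, m) (enc_pform (fAt c es t v)) (i, last_edge es (last_edge es N), m) (48 * size E).
Proof.
move=> Hc; have H := gen_St i N Hc.
by apply: gen_le; [rewrite /wAt; gsolve | lia].
Qed.

Ltac gchunk := repeat first [gstep | apply: gen_At; reflexivity | apply: gen_St; reflexivity].

Lemma gen_valid i N : exists N', gen wValid (i, N, m) (enc_pform (fValid es)) (i, N', m) (300 * size E).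
Proof.
have H N' := gen_pasteE (gen_edge m es i N').
eexists; apply: gen_le.
  by rewrite /wValid; repeat first [gstep | apply: gen_At; reflexivity | apply: H].
by have := E_pos; rewrite -/E; lia.
Qed.

Lemma gen_agree i N : exists N', gen wAgree (i, N, m) (enc_pform (fAgree es)) (i, N', m) (100 * size E).
Proof.
eexists; apply: gen_le; first by rewrite /wAgree; gchunk.
by have := E_pos; lia.
Qed.
End Chunks.

Lemma gen_post w s t a i N m c : gen w s t (a :: i, N, m) c -> gen (w ++ [:: iDrop]) s t (i, N, m) c.+1.
Proof.
move=> H; rewrite /gen -[ser t]cats0 -addn1; apply: ev_cat H _.
exact: (ev_drop _ (ev_nil _)).
Qed.

Definition node_index (k : nat) : nat := nth 0 [:: 1; 3; 5; 7; 9; 13; 11; 15; 17; 25; 21] k.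

Lemma gen_tag i : i < 32 -> act (iTag i) = onI (fun o => match o with
      | Some S0 => [:: iTag (2 * i)]
      | Some S1 => [:: iTag (2 * i).+1]
      | Some SEnd => wNode i
      | _ => [::] end).
Proof.
move=> Hi; rewrite /act /iTag; have -> : (40 + i < 40) = false by lia.
have -> : 40 + i < 72 by lia.
by have -> : 40 + i - 40 = i by lia.
Qed.

(** The 6 pays for [iF], at most four digits of the tag, and the end of the tag. *)
Lemma gen_node k i N m t s' c : k < 11 -> gen (wNode (node_index k)) (i, N, m) t s' c ->
  gen [:: iF] (SNode :: nat_bits k ++ SEnd :: i, N, m) t s' (c + 6).
Proof.
move=> Hk H; apply: (gen_le (c := c + size (nat_bits k) + 2)).
  rewrite addn2; apply: (gen_mode (g := iF) erefl isT).
  do 11! (case: k Hk H => [|k] Hk H; first by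
    rewrite [size _]/= ?(addn1, addn2, addn3, addn4, addn0);
    repeat (eapply gen_mode; [exact: gen_tag | reflexivity | ])).
  by [].
by do 11! (case: k Hk H => [|k] Hk H; first by rewrite /=; lia).
Qed.

Lemma ser_node k ts i : ser (Node k ts) ++ i =
  SNode :: nat_bits k ++ SEnd :: (flatten (map ser ts) ++ SEnd :: i).
Proof. by rewrite /= -!catA /= -!catA. Qed.

Lemma ser_leaf n i : ser (Leaf n) ++ i = SLeaf :: nat_bits n ++ SEnd :: i.
Proof. by rewrite /= -catA. Qed.

Lemma size_ser_node k ts :
  size (ser (Node k ts)) = 3 + size (nat_bits k) + size (flatten (map ser ts)).
Proof. by rewrite /= size_cat /= size_cat /=; lia. Qed.

Lemma size_ser_leaf n : size (ser (Leaf n)) = 2 + size (nat_bits n).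
Proof. by rewrite /= size_cat /=; lia. Qed.

Lemma gen_signed g w t a i N m c :
  act g = onI (fun o => match o with Some SEnd => wPos w | Some _ => wNeg w | _ => [::] end) ->
  ~~ emits g ->
  (forall i, gen w (i, rev (nat_bits (Z.abs_nat a)), m) (enc_pterm t)
                 (i, rev (nat_bits (Z.abs_nat a)), m) c) ->
  gen [:: iDrop; g] (ser (enc_Z a) ++ i, N, m) (enc_pform (fSigned a t))
      (i, rev (nat_bits (Z.abs_nat a)), m) (2 * c + 2 * size (nat_bits (Z.abs_nat a)) + 10).
Proof.
move=> Ha He Hw.
have -> : ser (enc_Z a) ++ i = SNode :: nat_bits (if (a <? 0)%Z then 1 else 0) ++
    SEnd :: SLeaf :: nat_bits (Z.abs_nat a) ++ SEnd :: SEnd :: i.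
  by rewrite /enc_Z ser_node /= cats0 -catA.
rewrite /fSigned; case: (a <? 0)%Z.
- apply: gen_le.
    apply: gen_drop; apply: (gen_mode (a := S1) Ha He); rewrite /wNeg.
    by have H1 := Hw i; gsolve; apply: Hw.
  by lia.
- apply: gen_le.
    apply: gen_drop; apply: (gen_mode (a := SEnd) Ha He); rewrite /wPos.
    by gsolve; apply: Hw.
  by lia.
Qed.

Lemma ser_node1 k a i : ser (Node k [:: a]) ++ i =
  SNode :: nat_bits k ++ SEnd :: (ser a ++ SEnd :: i).
Proof. by rewrite ser_node [map _ _]/= [flatten _]/= cats0. Qed.
Lemma ser_node2 k a b i : ser (Node k [:: a; b]) ++ i =
  SNode :: nat_bits k ++ SEnd :: (ser a ++ (ser b ++ SEnd :: i)).
Proof. by rewrite ser_node [map _ _]/= [flatten _]/= cats0 -catA. Qed.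
Lemma ser_node3 k a b c i : ser (Node k [:: a; b; c]) ++ i =
  SNode :: nat_bits k ++ SEnd :: (ser a ++ (ser b ++ (ser c ++ SEnd :: i))).
Proof. by rewrite ser_node [map _ _]/= [flatten _]/= cats0 -!catA. Qed.

Lemma size_ser1 k a : size (ser (Node k [:: a])) = 3 + size (nat_bits k) + size (ser a).
Proof. by rewrite size_ser_node [map _ _]/= [flatten _]/= cats0. Qed.
Lemma size_ser2 k a b : size (ser (Node k [:: a; b])) =
  3 + size (nat_bits k) + (size (ser a) + size (ser b)).
Proof. by rewrite size_ser_node [map _ _]/= [flatten _]/= cats0 size_cat. Qed.
Lemma size_ser3 k a b c : size (ser (Node k [:: a; b; c])) =
  3 + size (nat_bits k) + (size (ser a) + (size (ser b) + size (ser c))).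
Proof. by rewrite size_ser_node [map _ _]/= [flatten _]/= cats0 !size_cat. Qed.

Lemma gen_node_drop k w i0 i N N' m t c : k < 11 -> wNode (node_index k) = w ++ [:: iDrop] ->
  gen w (i0, N, m) t (SEnd :: i, N', m) c ->
  gen [:: iF] (SNode :: nat_bits k ++ SEnd :: i0, N, m) t (i, N', m) (c + 7).
Proof.
move=> Hk Ew H; rewrite addnS -addSn; apply: gen_node => //.
by rewrite Ew; apply: gen_post H.
Qed.

(** * Transduction of the source formula *)

Section Formulas.
Variables (K : KS) (p : seq sym).
Let es := ks_edges K.
Let ls := ks_label K.
Let E := body (map enc_edge es).
Let L := body (map enc_label ls).
Let m := (rev E, rev L, p).
(** A generous price per source symbol: a node re-reads the two lists a bounded number of times. *)
Let B := 1000 * (size E + size L).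

Let B_large x : 1000 * x <= B * x.
Proof.
rewrite leq_mul2r; apply/orP; right; have := E_pos es; rewrite -/E /B; lia.
Qed.

Lemma gen_body f i N i' c : (forall N, exists N', gen [:: iF] (i, N, m) (enc_pform f) (i', N', m) c) ->
  exists N', gen wBody (i, N, m)
    (enc_pform (PAnd (fValid es) (PAnd (fAgree es) f))) (i', N', m) (400 * size E + c).
Proof.
move=> H; have [N1 H1] := gen_valid es ls p i N; have [N2 H2] := gen_agree es ls p i N1.
have [N3 H3] := H N2; exists N3; apply: gen_le; first by rewrite /wBody; gsolve.
by rewrite -/E; lia.
Qed.

Lemma gen_E f i N i' c : (forall N, exists N', gen [:: iF] (i, N, m) (enc_pform f) (i', N', m) c) ->
  exists N', gen [:: iPasteE; iCopy] (i, N, m) (enc_pform (fE es f)) (i', N', m) (500 * size E + c).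
Proof.
move=> H; have [N' H'] := gen_body (last_edge es (last_edge es N)) H.
exists N'; apply: gen_le.
  apply: gen_pasteE; apply: gen_copy; apply: gen_pasteE.
  by apply: (gen_exi (x := iExi) erefl isT); exact: H'.
by have := E_pos es; rewrite -/E; lia.
Qed.

(** What remains in the number register depends on the subformula and is irrelevant afterwards, so
    only its existence is claimed. *)
Lemma gen_formula :
  (forall f i N, exists N', gen [:: iF] (ser (enc_cform f) ++ i, N, m) (enc_pform (fT K f))
     (i, N', m) (B * size (ser (enc_cform f)))) /\
  (forall t i N, exists N', gen [:: iF] (ser (enc_cterm t) ++ i, N, m) (enc_pform (fV K t))
     (i, N', m) (B * size (ser (enc_cterm t)))).
Proof.
have HE := E_pos es; have HL := L_pos ls; rewrite -/E in HE; rewrite -/L in HL.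
have HB : B = 1000 * (size E + size L) by [].
apply: cform_cterm_ind => [q|f IHf g IHg|f IHf|f IHf|f IHf g IHg|f IHf|x f IHf|t IHt u IHu|a|a x f IHf|t IHt u IHu] i N;
  cbn [enc_cform enc_cterm].
- have HS := gen_St es ls p (SEnd :: i) (rev (nat_bits q)) (c := 0) isT.
  have HLab N' := gen_pasteL (gen_lab m ls (SEnd :: i) N').
  eexists; rewrite ser_node1 ser_leaf size_ser1 size_ser_leaf; apply: gen_le.
    apply: (gen_node_drop (k := 0) (w := iDrop :: iRead :: wAP) isT erefl).
    by rewrite /wAP; repeat first [gstep | apply: HLab].
  by have := B_large (size (nat_bits q)); rewrite -/E -/L !mulnDr; lia.
- have [N1 H1] := IHf (ser (enc_cform g) ++ SEnd :: i) N; have [N2 H2] := IHg (SEnd :: i) N1.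
  exists N2; rewrite ser_node2 size_ser2; apply: gen_le.
    by apply: (gen_node_drop (k := 1) (w := aAnd [:: iF] [:: iF]) isT erefl); gsolve.
  by rewrite !mulnDr; lia.
- have [N1 H1] := IHf (SEnd :: i) N.
  exists N1; rewrite ser_node1 size_ser1; apply: gen_le.
    by apply: (gen_node_drop (k := 2) (w := aNot [:: iF]) isT erefl); gsolve.
  by rewrite !mulnDr; lia.
- have [N1 H1] := IHf (SEnd :: i) N.
  exists N1; rewrite ser_node1 size_ser1; apply: gen_le.
    by apply: (gen_node_drop (k := 3) (w := wNext) isT erefl); rewrite /wNext; gsolve.
  by rewrite !mulnDr; lia.
- have [N1 H1] := IHf (ser (enc_cform g) ++ SEnd :: i) N; have [N2 H2] := IHg (SEnd :: i) N1.
  exists N2; rewrite ser_node2 size_ser2; apply: gen_le.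
    by apply: (gen_node_drop (k := 4) (w := wU) isT erefl); rewrite /wU; gsolve.
  by rewrite !mulnDr; lia.
- have [N1 H1] := gen_E N (IHf (SEnd :: i)).
  exists N1; rewrite ser_node1 size_ser1; apply: gen_le.
    by apply: (gen_node_drop (k := 5) (w := [:: iPasteE; iCopy]) isT erefl); exact: H1.
  by rewrite !mulnDr; lia.
- have [N1 H1] := IHf (SEnd :: i) (rev (nat_bits x)).
  exists N1; rewrite ser_node2 ser_leaf size_ser2 size_ser_leaf; apply: gen_le.
    by apply: (gen_node_drop (k := 6) (w := wBind) isT erefl); rewrite /wBind; gsolve.
  by have := B_large (size (nat_bits x)); rewrite !mulnDr; lia.
- have [N1 H1] := IHt (ser (enc_cterm u) ++ SEnd :: i) N; have [N2 H2] := IHu (SEnd :: i) N1.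
  exists N2; rewrite ser_node2 size_ser2; apply: gen_le.
    by apply: (gen_node_drop (k := 7) (w := wPair cLe) isT erefl); rewrite /wPair; gsolve.
  by rewrite !mulnDr; lia.
- have HC := gen_signed (g := iConst) (w := aConstN) (t := PConst (Z.abs_nat a)) (a := a) (SEnd :: i) N (m := m) erefl isT.
  have Hw i' : gen aConstN (i', rev (nat_bits (Z.abs_nat a)), m) (enc_pterm (PConst (Z.abs_nat a)))
      (i', rev (nat_bits (Z.abs_nat a)), m) (2 * size (nat_bits (Z.abs_nat a)) + 2).
    by apply: gen_le; [gsolve | lia].
  have {}HC := HC _ Hw.
  eexists; rewrite ser_node1 size_ser1; apply: gen_le.
    by apply: (gen_node_drop (k := 8) (w := [:: iDrop; iConst]) isT erefl); exact: HC.
  rewrite /enc_Z size_ser1 size_ser_leaf.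
  by have := B_large (size (nat_bits (Z.abs_nat a))); rewrite !mulnDr; lia.
- have HC := gen_signed (g := iCoef) (w := aNode 1 [:: aLeafN [::]; aX vz]) (t := PMul (Z.abs_nat a) vz) (a := a)
    (SLeaf :: nat_bits x ++ SEnd :: (ser (enc_cform f) ++ SEnd :: i)) N (m := m) erefl isT.
  have Hw i' : gen (aNode 1 [:: aLeafN [::]; aX vz]) (i', rev (nat_bits (Z.abs_nat a)), m) (enc_pterm (PMul (Z.abs_nat a) vz))
      (i', rev (nat_bits (Z.abs_nat a)), m) (2 * size (nat_bits (Z.abs_nat a)) + 2).
    by apply: gen_le; [gsolve | lia].
  have {}HC := HC _ Hw.
  have [N1 H1] := IHf (SEnd :: i) (rev (nat_bits x)).
  exists N1; rewrite ser_node3 ser_leaf size_ser3 size_ser_leaf; apply: gen_le.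
    by apply: (gen_node_drop (k := 9) (w := wCount) isT erefl); rewrite /wCount; gsolve.
  rewrite /enc_Z size_ser1 size_ser_leaf.
  have := B_large (size (nat_bits (Z.abs_nat a))).
  by have := B_large (size (nat_bits x)); rewrite !mulnDr; lia.
- have [N1 H1] := IHt (ser (enc_cterm u) ++ SEnd :: i) N; have [N2 H2] := IHu (SEnd :: i) N1.
  exists N2; rewrite ser_node2 size_ser2; apply: gen_le.
    by apply: (gen_node_drop (k := 10) (w := wPair cPlus) isT erefl); rewrite /wPair; gsolve.
  by rewrite !mulnDr; lia.
Qed.
End Formulas.

(** * Saving the lists and scanning for variables *)

Fixpoint tree_nested_ind (P : tree -> Prop) (HL : forall n, P (Leaf n))
  (HN : forall k ts, foldr (fun t Q => P t /\ Q) True ts -> P (Node k ts)) (t : tree) : P t :=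
  match t with
  | Leaf n => HL n
  | Node k ts => HN k ts ((fix all_trees ts : foldr (fun t Q => P t /\ Q) True ts :=
      match ts with
      | [::] => Logic.I
      | t :: ts => conj (tree_nested_ind HL HN t) (all_trees ts)
      end) ts)
  end.

Section Save.
Variables (r g g' : nat) (rs : seq sym -> seq sym -> seq (seq sym)).
Hypothesis act_g : act g = save r g g'.
Hypothesis act_g' : act g' = saveBits r g'.
Hypothesis emits_g : ~~ emits g.
Hypothesis emits_g' : ~~ emits g'.
Hypothesis rs_r : forall i x, nth [::] (rs i x) r = x /\
  forall x', set_nth [::] (rs i x) r x' = rs i x'.
Hypothesis rs_0 : forall i x, nth [::] (rs i x) 0 = i /\
  forall i', set_nth [::] (rs i x) 0 i' = rs i' x.

Lemma save_step h a ws i x W c k : ~~ emits h -> (act h).1 = 0 ->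
  (act h).2 (Some a) = ([:: (r, a)], ws) ->
  wrun (rs i (a :: x), ws ++ W) c k -> wrun (rs (a :: i) x, h :: W) c k.+1.
Proof.
move=> He H1 H2 H; rewrite -[k.+1]/(true + k) -He; apply: wsteps_step.
rewrite /perform H1 (rs_0 _ _).1 [ohead _]/= H2 (rs_0 _ _).2 /push_on /= (rs_r _ _).1.
by rewrite (rs_r _ _).2.
Qed.

Lemma save_bits n i x W c k : wrun (rs i (rev (nat_bits n ++ [:: SEnd]) ++ x), W) c k ->
  wrun (rs (nat_bits n ++ SEnd :: i) x, g' :: W) c (k + (size (nat_bits n)).+1).
Proof.
move: (nat_bits n) (nat_bits_only n) => b Hb; elim: b Hb x => [|a b IH] Hb x H.
  by rewrite addn1; apply: (save_step (ws := [::])) H; rewrite ?act_g'.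
case/andP: Hb => Ha Hb; rewrite addnS.
apply: (save_step (ws := [:: g'])); rewrite ?act_g' //; first by case: a Ha {H}.
by apply: IH => //; rewrite /= rev_cons cat_rcons in H.
Qed.

Lemma save_tree t i x W c k : wrun (rs i (rev (ser t) ++ x), g :: W) c k ->
  wrun (rs (ser t ++ i) x, g :: W) c (k + size (ser t)).
Proof.
elim/tree_nested_ind: t i x W k => [n|n ts IH] i x W k H.
  rewrite ser_leaf size_ser_leaf add2n !addnS.
  apply: (save_step (ws := [:: g'; g])); rewrite ?act_g //.
  rewrite -addnS; apply: save_bits.
  by rewrite /= rev_cons cat_rcons in H.
rewrite ser_node size_ser_node.
have -> : k + (3 + size (nat_bits n) + size (flatten (map ser ts))) =
   ((k.+1 + size (flatten (map ser ts))) + (size (nat_bits n)).+1).+1 by lia.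
apply: (save_step (ws := [:: g'; g; g])); rewrite ?act_g //.
have {}IH i' x' W' k' : wrun (rs i' (rev (flatten (map ser ts)) ++ x'), g :: W') c k' ->
    wrun (rs (flatten (map ser ts) ++ i') x', g :: W') c (k' + size (flatten (map ser ts))).
  elim: ts IH i' x' W' k' {H} => [|t ts IHts] /=; first by move=> *; rewrite addn0.
  case=> Ht Hts i' x' W' k' H.
  rewrite -catA size_cat (addnC (size (ser t))) addnA; apply: Ht; apply: IHts => //.
  by rewrite rev_cat -catA in H.
apply: save_bits; apply: IH.
apply: (save_step (ws := [::])); rewrite ?act_g //.
have E : ser (Node n ts) = [:: SNode] ++ (nat_bits n ++ [:: SEnd]) ++ flatten (map ser ts) ++ [:: SEnd].
  by rewrite /= -catA.
have {}E x' : rev (ser (Node n ts)) ++ x' =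
    SEnd :: rev (flatten (map ser ts)) ++ (rev (nat_bits n ++ [:: SEnd]) ++ SNode :: x').
  rewrite E; move: (nat_bits n ++ _) (flatten _) => u v.
  by rewrite rev_cat rev_cat rev_cat /= -!catA.
by rewrite cat0s; rewrite E in H.
Qed.

Lemma save_body ts i x W c k : wrun (rs i (rev (body ts) ++ x), W) c k ->
  wrun (rs (body ts ++ i) x, g :: W) c (k + size (body ts)).
Proof.
rewrite /body; elim: ts x => [|t ts IH] x H /=.
  by rewrite addn1; apply: (save_step (ws := [::])) H; rewrite ?act_g.
set fl := flatten _ in IH H *.
have E : (ser t ++ fl) ++ [:: SEnd] = ser t ++ (fl ++ [:: SEnd]) by rewrite catA.
rewrite /= -/fl E in H *; rewrite size_cat (addnC (size (ser t))) addnA -catA.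
by apply: save_tree; apply: IH; rewrite rev_cat -catA in H.
Qed.
End Save.

Lemma gen_saveE ts i N l p w t s' c : gen w (i, N, (rev (body ts), l, p)) t s' c ->
  gen (iSaveE :: w) (body ts ++ i, N, ([::], l, p)) t s' (c + size (body ts)).
Proof.
move=> H O W; have [k Hk R] := H O W.
exists (k + size (body ts)); first by move: Hk; rewrite /num /=; lia.
apply: (@save_body 5 iSaveE iSaveE' (fun i x => [:: i; O; [::]; N; [::]; x; l; p])) => //.
by rewrite cats0.
Qed.

Lemma gen_saveL ts i N e p w t s' c : gen w (i, N, (e, rev (body ts), p)) t s' c ->
  gen (iSaveL :: w) (body ts ++ i, N, (e, [::], p)) t s' (c + size (body ts)).
Proof.
move=> H O W; have [k Hk R] := H O W.
exists (k + size (body ts)); first by move: Hk; rewrite /num /=; lia.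
apply: (@save_body 6 iSaveL iSaveL' (fun i x => [:: i; O; [::]; N; [::]; e; x; p])) => //.
by rewrite cats0.
Qed.

Lemma gen_saveP i N e l w t s' c : gen w ([::], N, (e, l, rev i)) t s' c ->
  gen (iSaveP :: w) (i, N, (e, l, [::])) t s' (c + size i + 1).
Proof.
move=> H O W; have [k Hk R] := H O W.
exists (k + size i + 1); first by move: Hk; rewrite /num /=; lia.
have aux x : wrun ([:: [::]; O; [::]; N; [::]; e; l; rev i ++ x], w ++ W) (regs s' (rev (ser t) ++ O), W) k ->
    wrun ([:: i; O; [::]; N; [::]; e; l; x], iSaveP :: w ++ W) (regs s' (rev (ser t) ++ O), W) (k + size i + 1).
  elim: i x {H R Hk} => [|a i IH] x R.
    by rewrite addn0 addn1; apply: (wrun1 (g := iSaveP)).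
  rewrite [size _]/=; have -> : k + (size i).+1 + 1 = (k + size i + 1).+1 by lia.
  apply: (wrun1 (g := iSaveP)).
  by apply: IH; rewrite rev_cons cat_rcons in R.
by apply: aux; rewrite cats0.
Qed.

Lemma gen_pasteP i N e l x w t s' c : gen w (x ++ i, N, (e, l, rev x)) t s' c ->
  gen (iPasteP :: w) (i, N, (e, l, rev x)) t s' (2 * size x + 2 + c).
Proof.
move=> H; rewrite /gen -[ser t]cat0s; apply: (ev_cat (w1 := [:: iPasteP])) H.
by have := ev_pasteP i N e l (rev x); rewrite revK size_rev.
Qed.

Lemma gen_mode_end g f N m t s' c : act g = onI f -> ~~ emits g ->
  gen (f None) ([::], N, m) t s' c -> gen [:: g] ([::], N, m) t s' c.+1.
Proof.
move=> Hg He H O W; have [k Hk R] := H O W; exists k.+1; first by rewrite addSn.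
rewrite -[k.+1]/(true + k) -He; apply: wrun1; move: R.
by case: m {H Hk} => [[e l] p]; rewrite /perform Hg.
Qed.

Lemma fZero_cat xs ys f : fZero (xs ++ ys) f = fZero xs (fZero ys f).
Proof. by elim: xs => //= x xs ->. Qed.

Definition scans m i f j c := forall N, exists N',
  gen [:: iScan] (i, N, m) (enc_pform f) (j, N', m) c.

Lemma scans_skip m a i f j c : a <> SLeaf -> scans m i f j c -> scans m (a :: i) f j c.+1.
Proof.
move=> Ha H N; have [N' H'] := H N; exists N'.
by apply: (gen_mode (g := iScan) erefl isT); case: a Ha.
Qed.

Lemma scans_bits m n i f j c : scans m i f j c ->
  scans m (nat_bits n ++ SEnd :: i) f j (c + size (nat_bits n) + 1).
Proof.
move=> H; move: (nat_bits n) (nat_bits_only n) => b; elim: b => [|a b IH] /=.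
  by move=> _; rewrite addn0 addn1; apply: scans_skip.
case/andP=> Ha /IH {}IH; have -> : c + (size b).+1 + 1 = (c + size b + 1).+1 by lia.
  apply: scans_skip IH.
by case: a Ha.
Qed.

(** The scan ignores the tree structure: no digit is [SLeaf], so each [SLeaf] met opens a leaf and
    yields one quantifier of [fZero]. *)
Lemma scans_tree m t i f j c : scans m i f j c ->
  scans m (ser t ++ i) (fZero (leaves t) f) j (c + 20 * size (ser t)).
Proof.
elim/tree_nested_ind: t i f c => [n|n ts IH] i f c H.
  rewrite ser_leaf size_ser_leaf => N; have [N' H'] := H (rev (nat_bits n)).
  exists N'; apply: gen_le.
    apply: (gen_mode (a := SLeaf) (g := iScan) erefl isT).
    by rewrite /= /wScan; gsolve.
  by lia.
have {}IH : scans m (flatten (map ser ts) ++ SEnd :: i) (fZero (leaves (Node n ts)) f) j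
    (c.+1 + 20 * size (flatten (map ser ts))).
  have {}H := scans_skip (a := SEnd) ltac:(done) H.
  elim: ts IH => [|t ts IHts] /=; first by rewrite addn0.
  case=> Ht Hts; rewrite -catA fZero_cat size_cat mulnDr (addnC (20 * _)) addnA.
  by apply: Ht; apply: IHts.
rewrite ser_node size_ser_node => N.
have [N' H'] := @scans_skip m SNode _ _ _ _ ltac:(done) (scans_bits n IH) N.
by exists N'; apply: gen_le H' _; lia.
Qed.

(** * Complexity of the reduction *)

Section Instance.
Variables (K : KS) (Phi : cform).
Let es := ks_edges K.
Let ls := ks_label K.
Let E := body (map enc_edge es).
Let L := body (map enc_label ls).
Let F := ser (enc_cform Phi) ++ [:: SEnd].
Let m := (rev E, rev L, rev F).
Let B := 1000 * (size E + size L).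

Lemma instance_ser : enc_instance K Phi =
  SNode :: SEnd :: SNode :: SEnd :: SLeaf :: nat_bits (ks_size K) ++ SEnd ::
  SLeaf :: nat_bits (ks_init K) ++ SEnd :: SNode :: SEnd :: (E ++
  SNode :: SEnd :: (L ++ SEnd :: F)).
Proof.
rewrite /enc_instance -[LHS]cats0 ser_node2 /enc_KS ser_node [map _ _]/= [flatten _]/=.
rewrite cats0 /E /L /F /body /=; do 6! (rewrite -?catA /=).
by [].
Qed.

Lemma size_instance : size (enc_instance K Phi) =
  size (nat_bits (ks_size K)) + size (nat_bits (ks_init K)) + size E + size L + size F + 13.
Proof.
have H (a b x y z : seq sym) : size (SNode :: SEnd :: SNode :: SEnd :: SLeaf :: a ++ SEnd ::
    SLeaf :: b ++ SEnd :: SNode :: SEnd :: (x ++ SNode :: SEnd :: (y ++ SEnd :: z))) =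
    size a + size b + size x + size y + size z + 13.
  by do 8! (rewrite ?size_cat /=); lia.
by rewrite instance_ser H.
Qed.

Lemma gen_top_body N : exists N', gen wTopBody (F, N, m)
  (enc_pform (PAnd (fValid es) (PEx vi (PAnd (PLet ti (PV vi) (PLet tv (PV vc) (fSt 0 es))) (fT K Phi)))))
  ([:: SEnd], N', m) (400 * size E + B * size (ser (enc_cform Phi))).
Proof.
have [N1 H1] := gen_valid es ls (rev F) F N.
have [C _] := gen_formula K (rev F).
have [N3 H3] := C Phi [:: SEnd] (last_edge es (last_edge es N1)).
have H2 := gen_St es ls (rev F) F N1 (c := 0) isT.
exists N3; apply: gen_le; first by rewrite /wTopBody; gsolve.
by rewrite -/E -/L -/B; lia.
Qed.

Lemma gen_scan : scans m F (fZero (leaves (enc_cform Phi)) (fExi es (PAnd (fValid es)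
    (PEx vi (PAnd (PLet ti (PV vi) (PLet tv (PV vc) (fSt 0 es))) (fT K Phi)))))) [:: SEnd]
  (500 * size E + B * size (ser (enc_cform Phi)) + 30 * size F).
Proof.
have HE := E_pos es; rewrite -/E in HE.
have SF : size F = size (ser (enc_cform Phi)) + 1 by rewrite size_cat.
have H0 : scans m [:: SEnd] (fExi es (PAnd (fValid es)
    (PEx vi (PAnd (PLet ti (PV vi) (PLet tv (PV vc) (fSt 0 es))) (fT K Phi)))))
    [:: SEnd] (450 * size E + B * size (ser (enc_cform Phi)) + 2 * size F).
  move=> N; have [N' H'] := gen_top_body (last_edge es N).
  exists N'; apply: gen_le.
    (* The last [SEnd] of the instance is skipped; the exhausted input then triggers the translation
       proper. *)
    apply: (gen_mode (a := SEnd) (g := iScan) erefl isT).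
    apply: (gen_mode_end (g := iScan) erefl isT).
    apply: gen_pasteP; rewrite cats0; apply: gen_pasteE.
    by apply: (gen_exi (x := iExiTop) erefl isT); exact: H'.
  by rewrite -/E; lia.
move=> N; have [N' H'] := scans_tree (enc_cform Phi) H0 N.
by exists N'; apply: gen_le H' _; lia.
Qed.

(** The quadratic term is [B] times the length of the formula, both at most linear in the size of
    the instance. *)
Lemma gen_init : exists N', gen
  (iDrop :: iDrop :: iDrop :: iDrop :: iDrop :: iRead :: iDrop :: iRead ::
   aLet (aX vc) aConstN
    [:: iDrop; iDrop; iSaveE; iDrop; iDrop; iSaveL; iDrop; iSaveP; iPasteP; iScan])
  (enc_instance K Phi, [::], ([::], [::], [::])) (enc_pform (fTop K Phi)) ([:: SEnd], N', m)
  (3000 * size (enc_instance K Phi) ^ 2).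
Proof.
have [N' H'] := gen_scan (rev (nat_bits (ks_init K))).
exists N'; have Sx := size_instance.
have HE := E_pos es; have HL := L_pos ls; rewrite -/E -/L in HE HL.
apply: (gen_le (c := 510 * size E + size L + B * size (ser (enc_cform Phi)) + 40 * size F
   + 2 * size (nat_bits (ks_size K)) + 10 * size (nat_bits (ks_init K)) + 40)).
  rewrite instance_ser; apply: gen_le.
    do 5! apply: gen_drop; apply: gen_read; apply: gen_drop; apply: gen_read.
    eapply gen_Node; gstep; first by gstep.
    gstep; last by gstep.
    eapply gen_Node; gstep; first by gsolve.
    gstep; last by gstep.
    do 2! apply: gen_drop; apply: gen_saveE; do 2! apply: gen_drop; apply: gen_saveL.
    apply: gen_drop; apply: gen_saveP; apply: gen_pasteP; rewrite cats0; exact: H'.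
  by rewrite -/E -/L; lia.
have SF : size F = size (ser (enc_cform Phi)) + 1 by rewrite size_cat.
move: Sx; move: (size (enc_instance K Phi)) => n.
rewrite SF; move: (size (ser (enc_cform Phi))) => f; rewrite /B.
move: (size E) (size L) (size (nat_bits (ks_size K))) (size (nat_bits (ks_init K))) HE HL => a b c d Ha Hb Hn.
have : 1000 * (a + b) * f <= 1000 * n * n by apply: leq_mul; lia.
have : n <= n * n by rewrite leq_pmulr; lia.
by rewrite expnS expn1; lia.
Qed.

Lemma run_clear i O N e l p W c k : wrun ([:: [::]; O; [::]; N; [::]; e; l; p], W) c k ->
  wrun ([:: i; O; [::]; N; [::]; e; l; p], iClear :: W) c (size i + 1 + k).
Proof.
move=> R; elim: i => [|a i IH]; first by rewrite add0n; apply: (wrun1 (g := iClear)).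
by rewrite /= !addSn; apply: (wrun1 (g := iClear)).
Qed.

Lemma run_out i O N e l p : wrun ([:: i; O; [::]; N; [::]; e; l; p], [:: iOut])
  ([:: rev O ++ i; [::]; [::]; N; [::]; e; l; p], [::]) (size O + 1).
Proof.
elim: O i => [|a O IH] i; first by apply: (wrun1 (g := iOut)); exact: wsteps_refl.
by rewrite rev_cons cat_rcons /= addSn; apply: (wrun1 (g := iOut)); exact: IH.
Qed.

Lemma instance_run : exists rs k, [/\ k <= 3000 * size (enc_instance K Phi) ^ 2,
    size (ser (enc_pform (fTop K Phi))) <= size wInit * width 127 act + k.+1 * (width 127 act + width 127 act * width 127 act)
  & wrun (enc_instance K Phi :: nseq 7 [::], wInit)
      (ser (enc_pform (fTop K Phi)) :: rs, [::]) (k + (size (ser (enc_pform (fTop K Phi))) + 3))].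
Proof.
have [N' H] := gen_init.
have [k Hk R] := H [::] [:: iClear; iOut].
set y := ser (enc_pform (fTop K Phi)) in R *.
set c1 := (X in wrun _ X _) in R.
have {}R : wrun (enc_instance K Phi :: nseq 7 [::], wInit) c1 k := R.
have Hout := wsteps_output (R := 8) isT act_items act_emits 1 R (act_items 0 None).
eexists; exists k; split.
- by move: Hk; rewrite /num /=; lia.
- move: Hout; rewrite {1}/c1 [nth _ _ _]/= cats0 size_rev => Hout.
  apply: leq_trans (leq_trans (leq_addr _ _) Hout) _.
  by rewrite add0n leq_add2l leq_mul2r leqnSn orbT.
- apply: wsteps_trans R _.
  (* [iClear] removes the single [SEnd] left on the input and [iOut] moves the output; each needs
     one more step to notice that it is done. *)
  have -> : size y + 3 = size [:: SEnd] + 1 + (size (rev y) + 1) by rewrite size_rev /=; lia.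
  rewrite /c1 cats0; apply: run_clear.
  have := run_out [::] (rev y) N' (rev E) (rev L) (rev F).
  rewrite revK cats0 => HH; exact: HH.
Qed.
End Instance.

(** Hides [wInit] and [width] behind variables, so that later arithmetic never unfolds them. *)
Lemma translation_run : exists c0 I w W, forall K Phi, exists rs k,
  [/\ k <= c0 * size (enc_instance K Phi) ^ 2,
    size (ser (enc_pform (fTop K Phi))) <= I * w + k.+1 * W
  & wsteps act emits (enc_instance K Phi :: nseq 7 [::], wInit)
      (ser (enc_pform (fTop K Phi)) :: rs, [::]) (k + (size (ser (enc_pform (fTop K Phi))) + 3))].
Proof.
exists 3000, (size wInit), (width 127 act), (width 127 act + width 127 act * width 127 act).
exact: instance_run.
Qed.

Lemma run_bound c0 I w W k y q : 0 < q -> k <= c0 * q -> y <= I * w + k.+1 * W ->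
  (k + (y + 3)).+1 <= (c0 + I * w + c0.+1 * W + 4) * q.
Proof.
move=> Hq Hk Hy.
have H1 : k.+1 * W <= c0.+1 * W * q.
  by rewrite mulnAC leq_mul2r mulSn; apply/orP; right; lia.
have H2 : I * w <= I * w * q by rewrite leq_pmulr.
have E a b c : (a + b + c + 4) * q = a * q + b * q + c * q + 4 * q by rewrite !mulnDl.
rewrite E; move: (k.+1 * W) (c0.+1 * W * q) (I * w * q) (I * w) (c0 * q) Hk Hy H1 H2.
by move=> *; lia.
Qed.

(** The number of stack steps and the tape length are both of order [n ^ 2]; their product has
    degree 4. *)
Lemma time_bound A D n s : 0 < n -> s <= D * n ^ 2 ->
  A * s * (4 * (8 + n + A * s) + 10) <= A * D * (4 * (9 + A * D) + 10) * n ^ 4.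
Proof.
move=> Hn Hs.
have Hs2 : A * s <= A * D * n ^ 2 by rewrite -mulnA leq_mul2l Hs orbT.
have Hn2 : n <= n ^ 2 by rewrite expnS expn1 leq_pmulr.
have Hn1 : 0 < n ^ 2 by rewrite expn_gt0 Hn.
have -> : n ^ 4 = n ^ 2 * n ^ 2 by rewrite -expnD.
apply: (@leq_trans (A * D * n ^ 2 * ((4 * (9 + A * D) + 10) * n ^ 2))); last first.
  by rewrite mulnACA mulnA.
apply: leq_mul => //.
move: (A * s) (A * D) (n ^ 2) Hs2 Hn2 Hn1 => a d q H1 H2 H3.
by rewrite mulnDl -mulnA mulnDl; lia.
Qed.

Theorem theorem15 :
  exists (M : TM) (c k : nat),
    forall (K : KS) (Phi : cform),
      ks_wf K -> flat K ->
      exists psi : pform,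
        tm_computes_within M (enc_instance K Phi)
          (c * (size (enc_instance K Phi)) ^ k + c) (ser (enc_pform psi)) /\
        (ph_satisfiable psi <-> models K Phi).
Proof.
have [A HA] := agenda_TM_computes (R := 8) (G := 127) (emits := emits) isT act_reg act_push act_items act_emits
   (g0 := 0) isT erefl.
have [c0 [I [w [W Hrun]]]] := translation_run.
pose D := c0 + I * w + c0.+1 * W + 4.
exists (agenda_TM 8 127 act 0), (A * D * (4 * (9 + A * D) + 10)), 4 => K Phi _ HK.
exists (fTop K Phi); split; last exact: fTopP.
have [rs [k [Hk Hy R]]] := Hrun K Phi.
have [t [Ht HT]] := HA _ _ _ _ R.
exists t; split=> //; apply: leq_trans Ht _; apply: leq_trans (leq_addr _ _).
have Hn : 0 < size (enc_instance K Phi) by rewrite instance_ser.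
apply: time_bound => //; apply: run_bound Hk Hy.
by rewrite expn_gt0 Hn.
Qed.
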